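(* Let $\mathbf{d}=\mathbf{d}(n)$ be a nice degree sequence satisfying the extra restriction $\Delta\le\omega^{1/4}$, where $\omega=\log\log\log n$ and $\Delta$ is the maximum degree. Let $G$ be chosen uniformly at random from $\mathcal{G}(\mathbf{d})$. Weight the edges of $G$ with the min-deg weighting scheme, that is, assign each edge $(u,v)$ the weight $w(u,v)=1/\min\{d(u),d(v)\}$, and denote the resulting weighted graph by $G_w$. Then with high probability $$\mathbf{COV}[G_w]\le(1+o(1))\,\frac{\delta-1}{\delta-2}\;8n\log n,$$ where $\delta$ is the minimum degree.
   Context: Degree sequences: for each $n$, $\mathbf{d}=(d_1,\dots,d_n)$ is a sequence of positive integers with even sum $\sum_i d_i=2m$. Put $V=\{1,\dots,n\}$, $n_j=|\{i:d_i=j\}|$, $\theta=2m/n$ (average degree), $\delta=\min_i d_i$, $\Delta=\max_i d_i$. $\mathcal{G}(\mathbf{d})$ is the set of all simple graphs on $V$ in which vertex $i$ has degree $d_i$, with the uniform distribution. Nice: let $0<\alpha<1$ and $0<\kappa<1/11$ be constants, let $d$ be a fixed positive integer, and let $\gamma=\gamma(n)$ be defined by $\theta=\sqrt{\log n}/\gamma^3$ (so $\gamma\to\infty$ by (i)). The (family of) degree sequence(s) $\mathbf{d}$ is nice if, as $n\to\infty$: (i) $\theta=o(\sqrt{\log n})$; (ii) $\delta\ge 3$; (iii) $n_i=O(n^{\kappa i/d})$ for $\delta\le i<d$; (iv) $n_d=\alpha n\pm o(n)$, and $d$ is called the effective minimum degree; (v) $\Delta=O(n^{\kappa(d-1)/d})$;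 (vi) $\sum_{j=\gamma\theta}^{\Delta}n_j=O(n^{\kappa(d-1)/d})$ (sum over integers $j$ with $\gamma\theta\le j\le\Delta$). The random walk on the weighted graph $G_w$ moves from $u$ to a neighbour $v$ with probability $w(u,v)/\sum_{x\in N(u)}w(u,x)$. $\mathbf{COV}[G_w]$ is the maximum over starting vertices $u$ of the expected number of steps for this walk started at $u$ to visit every vertex ($+\infty$ if the graph is disconnected). Logarithms are natural. ''With high probability'' means with probability tending to $1$ as $n\to\infty$; the claim means that there is a deterministic $\varepsilon_n\to0$ such that the inequality with $1+\varepsilon_n$ in place of $1+o(1)$ holds with probability tending to $1$. *)

(* Defs.v *)
From HB Require Import structures.
From mathcomp Require Import all_boot all_order all_algebra.
From mathcomp Require Import all_classical all_reals all_analysis.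

Set Implicit Arguments.
Unset Strict Implicit.
Unset Printing Implicit Defensive.

Import Order.TTheory GRing.Theory Num.Theory.
Import numFieldNormedType.Exports.
Local Open Scope ring_scope.

Section DegreeSequence.
Variables (R : realType) (n : nat) (ds : 'I_n -> nat).

Definition degree_sequence : Prop :=
  (forall i, (0 < ds i)%N) /\ ~~ odd (\sum_i ds i)%N.

Definition num_deg (j : nat) : nat := #|[set i | ds i == j]|.

Definition max_deg : nat := (\max_i ds i)%N.

(* The neutral value max_deg makes this min_i ds i as soon as 0 < n. *)
Definition min_deg : nat := (\big[minn/max_deg]_i ds i)%N.

Definition avg_deg : R := (\sum_i ds i)%:R / n%:R.

(* The solution gamma of avg_deg = sqrt (log n) / gamma ^ 3. *)
Definition gamma_deg : R := (Num.sqrt (ln n%:R) / avg_deg) `^ 3^-1.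

End DegreeSequence.
Arguments avg_deg R {n} ds.
Arguments gamma_deg R {n} ds.

(* A simple graph on V is given by its set of edges, the edges being 2-element
   subsets of V. *)
Section Graph.
Variable V : finType.
Implicit Type G : {set {set V}}.

Definition simple_graph G : bool := [forall e in G, #|e| == 2].

Definition adj G (u v : V) : bool := [set u; v] \in G.

Definition vdeg G (u : V) : nat := #|[set v | adj G u v]|.

End Graph.

Definition graphs_with (n : nat) (ds : 'I_n -> nat) : {set {set {set 'I_n}}} :=
  [set G | simple_graph G && [forall i, vdeg G i == ds i]].

Definition unif_prob (R : realType) (T : finType) (S : {set T}) (A : pred T) : R :=
  #|[set x in S | A x]|%:R / #|S|%:R.

Section Cover.
Variables (R : realType) (V : finType) (G : {set {set V}}) (w : V -> V -> R).

Definition trans_prob (u v : V) : R :=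
  if adj G u v then w u v / \sum_(x | adj G u x) w u x else 0.

(* Probability that the walk started at u makes s as its first size s steps. *)
Fixpoint walk_prob (u : V) (s : seq V) : R :=
  if s is v :: s' then trans_prob u v * walk_prob v s' else 1.

Definition covers (u : V) (s : seq V) : bool := [forall v, v \in u :: s].

Definition covers_first (u : V) (s : seq V) : bool :=
  covers u s && [forall i : 'I_(size s), ~~ covers u (take i s)].

(* Probability that the cover time of the walk started at u equals t. *)
Definition cover_time_prob (u : V) (t : nat) : R :=
  \sum_(s : t.-tuple V | covers_first u s) walk_prob u s.

(* Expectation of the cover time, a random variable with values in nat and
   +oo; recall that +oo * 0 = 0 in \bar R.  If G is disconnected, the cover
   time is +oo almost surely and so is its expectation. *)
Definition expected_cover_time (u : V) : \bar R :=
  (\sum_(0 <= t <oo) (t%:R * cover_time_prob u t)%:E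
   + +oo * (1 - \sum_(0 <= t <oo) (cover_time_prob u t)%:E))%E.

Definition COV : \bar R := \big[maxe/-oo%E]_(u : V) expected_cover_time u.

End Cover.

Definition min_deg_weight (R : realType) (V : finType) (G : {set {set V}})
    (u v : V) : R :=
  1 / (minn (vdeg G u) (vdeg G v))%:R.

Local Open Scope classical_set_scope.

(* d is the effective minimum degree.  In nice_low the indices i < min_deg may
   be included since then num_deg i = 0. *)
Record nice (R : realType) (alpha kappa : R) (d : nat)
    (ds : forall n, 'I_n -> nat) : Prop := Nice {
  nice_avg : (fun n => avg_deg R (ds n)) =o_\oo
             (fun n : nat => Num.sqrt (ln n%:R) : R);
  nice_min : \forall n \near \oo, (3 <= min_deg (ds n))%N;
  nice_low : forall i : nat, (i < d)%N ->
    (fun n => (num_deg (ds n) i)%:R : R) =O_\oo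
    (fun n : nat => n%:R `^ (kappa * i%:R / d%:R));
  nice_eff : (fun n => (num_deg (ds n) d)%:R - alpha * n%:R) =o_\oo
             (fun n : nat => n%:R : R);
  nice_max : (fun n => (max_deg (ds n))%:R : R) =O_\oo
             (fun n : nat => n%:R `^ (kappa * (d%:R - 1) / d%:R));
  nice_tail :
    (fun n => (\sum_(0 <= j < (max_deg (ds n)).+1
                 | (gamma_deg R (ds n) * avg_deg R (ds n) <= j%:R)%R)
                 num_deg (ds n) j)%N%:R : R) =O_\oo
    (fun n : nat => n%:R `^ (kappa * (d%:R - 1) / d%:R))
}.

(* Main.v *)
(* The total weight of G_w is at most 2n.  Stop the expected hitting time of a
   vertex a at time t: the resulting function g is a subsolution of the hitting
   time equations, so its Dirichlet energy E(g) is at most sum_u w(u) g(u).  If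
   the ball of radius L around a vertex v is a tree, the flow leaving v and
   dividing equally among children has energy at most R = (delta-1)/(delta-2)
   and ends spread out on a sphere; since G is an expander, Cheeger's inequality
   says that the average of g over such a spread out measure is close to a
   constant b independent of v.  Hence |g(v) - b| is at most about sqrt(R E(g))
   at every tree-like vertex v, which bounds the hitting times of tree-like
   vertices by (1+o(1)) 8 n R.  The other vertices are few and have hitting
   times O(n Delta), and Matthews' argument, applied first to them and then to
   the rest, bounds the cover time.
   Tree-likeness and expansion hold with high probability by switchings carried
   out directly on simple graphs: the number of graphs with k edges across a
   given cut changes with k as it does for random pairings. *)
Require Import Defs.
From HB Require Import structures.
From mathcomp Require Import all_boot all_order all_algebra.
From mathcomp Require Import all_classical all_reals all_analysis.
From mathcomp Require Import ring lra zify.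
From mathcomp Require Import fintype finset.

Set Implicit Arguments.
Unset Strict Implicit.
Unset Printing Implicit Defensive.

Import Order.TTheory GRing.Theory Num.Theory.
Import numFieldNormedType.Exports.
Local Open Scope ring_scope.

(** * Cover times and Matthews' bound *)

(** The constant 8 arises as follows. Let e^2 be the energy of g with each edge counted once, let
    rho^2 be close to R, and let W <= 2n be the sum of the vertex weights. At tree-like vertices |g
    - b| <= rho e, and the target is such a vertex with g = 0, so g <= 2 rho e there. Up to the
    other vertices, e^2 <= sum w g <= 2 rho e W, so e <= 2 rho W and g <= 4 rho^2 W <= 8nR.

    One parameter L, about log log n, fixes all scales. Balls have radius L, so the flow ends with
    mass at most 2^-L per vertex, which outweighs the factor O(Delta) = O(L) lost in the Poincare
    inequality. At most 2^(L^3) vertices are not tree-like: their weight is negligible, and the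
    logarithm of their number is O(L^3) = o(log n), so that their slower hitting times add little to
    the cover time.

    Probabilities are ratios of cardinalities, with 0/0 = 0; hence the existence of a graph with the
    given degrees needs a proof of its own. *)

Definition harmonic_sum (R : realType) (k : nat) : R := \sum_(i < k) (i.+1%:R)^-1.

Section TruncatedCover.
Variables (R : realType) (V : finType) (p : V -> V -> R).
Hypothesis p_ge0 : forall u v, 0 <= p u v.
Hypothesis p_sum1 : forall u, \sum_v p u v = 1.
Implicit Types (A B : {set V}) (a u v : V).

(* Expectation of min(t, T), where T is the time the walk from u needs to visit
   all of A; the starting point u itself does not count as visited. *)
Fixpoint trunc_cover (t : nat) (u : V) (A : {set V}) : R :=
  if t is t'.+1 then
    if A == set0 then 0 else 1 + \sum_v p u v * trunc_cover t' v (A :\ v)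
  else 0.

(* Probability that a is the last vertex of A to be visited, and that the rest
   of A is visited by time t. *)
Fixpoint last_prob (t : nat) (u : V) (A : {set V}) (a : V) : R :=
  if A == [set a] then 1 else
  if t is t'.+1 then \sum_v p u v * last_prob t' v (A :\ v) a else 0.

Lemma trunc_cover_ge0 t u A : 0 <= trunc_cover t u A.
Proof.
elim: t u A => //= t IH u A; case: ifP => // _.
by rewrite addr_ge0 ?ler01 // sumr_ge0 // => v _; rewrite mulr_ge0.
Qed.

Lemma trunc_cover0 t u : trunc_cover t u set0 = 0.
Proof. by case: t => //= t; rewrite eqxx. Qed.

Lemma trunc_cover_leS t u A : trunc_cover t u A <= trunc_cover t.+1 u A.
Proof.
elim: t u A => [|t IH] u A; first exact: trunc_cover_ge0.
rewrite [in leLHS]/= [in leRHS]/=; case: ifP => // _.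
rewrite lerD2l; apply: ler_sum => v _; apply: ler_wpM2l => //; exact: IH.
Qed.

Lemma last_prob_ge0 t u A a : 0 <= last_prob t u A a.
Proof.
elim: t u A => [|t IH] u A /=; case: ifP => // _.
by rewrite sumr_ge0 // => v _; rewrite mulr_ge0.
Qed.

Lemma last_prob_notin t u A a : a \notin A -> last_prob t u A a = 0.
Proof.
have ne B : a \notin B -> (B == [set a]) = false.
  by move=> aB; apply: contraNF aB => /eqP ->; rewrite inE.
elim: t u A => [|t IH] u A aA /=; rewrite ne //.
rewrite big1 // => v _; rewrite IH ?mulr0 // !inE negb_and aA orbT //.
Qed.

(** Two vertices cannot both be last. Mass is lost to the walks that still miss several vertices at
    time [t]. *)
Lemma sum_last_prob_le1 t u A : \sum_a last_prob t u A a <= 1.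
Proof.
elim: t u A => [|t IH] u A /=.
  case: (pickP [pred a | A == [set a]]) => [b /= /eqP -> | nA].
    rewrite (bigD1 b) //= eqxx big1 ?addr0 // => a ab.
    by case: eqP => // /setP /(_ a); rewrite !inE eqxx (negbTE ab).
  by rewrite big1 // => a _; move: (nA a) => /= ->.
case: (pickP [pred a | A == [set a]]) => [b /= /eqP -> | nA].
  rewrite (bigD1 b) //= eqxx big1 ?addr0 // => a ab.
  case: eqP => [/setP /(_ a)|_]; first by rewrite !inE eqxx (negbTE ab).
  rewrite big1 // => v _; rewrite last_prob_notin ?mulr0 //.
  by rewrite !inE negb_and (negbTE ab) orbT.
under eq_bigr => a _ do move: (nA a) => /= ->.
rewrite exchange_big /=.
apply: (@le_trans _ _ (\sum_v p u v)); last by rewrite p_sum1.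
apply: ler_sum => v _; rewrite -mulr_sumr -[leRHS]mulr1.
by apply: ler_wpM2l.
Qed.

(** Beyond the time to visit [A :\ a], extra time is spent only if [a] is last, and then the walk
    just has to hit [a] from where it stands. The current position is never among the unvisited
    targets, so it differs from [a] and [H] applies. *)
Lemma trunc_cover_del (H : R) a :
  (forall t u, u != a -> trunc_cover t u [set a] <= H) ->
  forall t u A, u \notin A ->
  trunc_cover t u A <= trunc_cover t u (A :\ a) + H * last_prob t u A a.
Proof.
move=> hH; elim=> [|t IH] u A uA.
  case: (boolP (A == [set a])) => [/eqP EA|nA] /=; last first.
    by rewrite (negbTE nA) mulr0 addr0.
  rewrite EA eqxx add0r mulr1; apply: (hH 0%N u).
  by move: uA; rewrite EA inE.
case: (boolP (a \in A)) => aA; last first.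
  rewrite last_prob_notin // mulr0 addr0.
  suff -> : A :\ a = A by [].
  by apply/setP => x; rewrite !inE; case: eqP => // ->; rewrite (negbTE aA).
case: (boolP (A == [set a])) => [/eqP EA|nA].
  rewrite /last_prob EA eqxx mulr1.
  apply: ler_wpDl; first exact: trunc_cover_ge0.
  by apply: hH; move: uA; rewrite EA inE.
have A0 : A != set0 by apply/set0Pn; exists a.
have Aa0 : A :\ a != set0.
  apply: contra nA => /eqP E.
  by rewrite -(setD1K aA) E setU0.
rewrite /= (negbTE A0) (negbTE Aa0) (negbTE nA) -addrA lerD2l mulr_sumr -big_split /=.
apply: ler_sum => v _; rewrite mulrCA -mulrDr; apply: ler_wpM2l => //.
have -> : A :\ a :\ v = A :\ v :\ a.
  by apply/setP => x; rewrite !inE andbCA.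
by apply: IH; rewrite !inE eqxx.
Qed.

Lemma harmonic_sumS k : harmonic_sum R k.+1 = harmonic_sum R k + k.+1%:R^-1.
Proof. by rewrite /harmonic_sum big_ord_recr. Qed.

(** Averaging [trunc_cover_del] over [a] in [C] takes the place of the random ordering of the
    targets in the usual proof of Matthews' bound: the probabilities of being last add up to at most
    1, so the extra cost is [H] divided by [#|C|]. *)
Lemma trunc_cover_avg (H K : R) t u A (C : {set V}) :
  u \notin A -> C != set0 ->
  (forall a, a \in C -> forall t u, u != a -> trunc_cover t u [set a] <= H) ->
  (forall a, a \in C -> trunc_cover t u (A :\ a) <= K) ->
  0 <= H ->
  trunc_cover t u A <= K + H * #|C|%:R^-1.
Proof.
move=> uA C0 hH hK H0.
have C_gt0 : 0 < #|C|%:R :> R by rewrite ltr0n card_gt0.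
rewrite -(ler_pM2l C_gt0) mulrDr [X in _ + X]mulrC mulfVK ?gt_eqF //.
have -> : #|C|%:R * trunc_cover t u A = \sum_(a in C) trunc_cover t u A.
  by rewrite sumr_const mulr_natl.
apply: (@le_trans _ _ (\sum_(a in C) (K + H * last_prob t u A a))).
  apply: ler_sum => a aC; apply: le_trans (trunc_cover_del (hH a aC) t uA) _.
  by rewrite lerD2r; apply: hK.
rewrite big_split /= sumr_const mulr_natl lerD2l -mulr_sumr -[leRHS]mulr1.
apply: ler_wpM2l => //.
apply: le_trans (sum_last_prob_le1 t u A).
rewrite [leRHS](bigID (mem C)) /= ler_wpDr // sumr_ge0 // => *.
exact: last_prob_ge0.
Qed.

(* Matthews' bound; averaging over the targets in B first separates the two
   kinds of targets. *)
Lemma matthews (H1 H2 : R) B :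
  0 <= H1 -> 0 <= H2 ->
  (forall a, a \notin B ->
     forall t u, u != a -> trunc_cover t u [set a] <= H1) ->
  (forall a, a \in B ->
     forall t u, u != a -> trunc_cover t u [set a] <= H2) ->
  forall t u A, u \notin A ->
  trunc_cover t u A <=
    H1 * harmonic_sum R #|A :\: B| + H2 * harmonic_sum R #|A :&: B|.
Proof.
move=> H1_ge0 H2_ge0 h1 h2 t u A.
have [k] := ubnP #|A|; elim: k A => // k IH A Ak uA.
have uD a : u \notin A :\ a by rewrite !inE negb_and uA orbT.
have ltk a : a \in A -> (#|A :\ a| < k)%N.
  by move=> aA; move: Ak; rewrite (cardsD1 a A) aA.
case: (eqVneq (A :&: B) set0) => [AB0|ABn0]; last first.
  have [a0 a0AB] := set0Pn _ ABn0.
  case EC: #|A :&: B| => [|c].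
    by move: EC; rewrite (cardsD1 a0) a0AB.
  rewrite harmonic_sumS mulrDr addrA -EC.
  apply: trunc_cover_avg => // [a|a].
    by rewrite inE => /andP[_ /h2].
  move=> aAB; move: (aAB); rewrite inE => /andP[aA aB].
  apply: le_trans (IH _ (ltk a aA) (uD a)) _.
  have -> : (A :\ a) :\: B = A :\: B.
    by apply/setP => x; rewrite !inE; case: eqP => // ->; rewrite aB.
  have -> : (A :\ a) :&: B = (A :&: B) :\ a.
    by apply/setP => x; rewrite !inE andbA.
  by move: EC; rewrite (cardsD1 a (A :&: B)) aAB add1n => -[->].
rewrite AB0 cards0.
case: (eqVneq A set0) => [->|An0].
  rewrite trunc_cover0 set0D cards0 /harmonic_sum !big_ord0 !mulr0 addr0 //.
have AB : A :\: B = A.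
  by rewrite -[LHS]set0U -AB0 setID.
have [a0 a0A] := set0Pn _ An0.
rewrite AB; case EC: #|A| => [|c].
  by move: EC; rewrite (cardsD1 a0) a0A.
rewrite harmonic_sumS mulrDr addrAC -EC.
have notB a : a \in A -> a \notin B.
  by move=> aA; move/setP: AB => /(_ a); rewrite !inE aA andbT.
apply: trunc_cover_avg => // [a aA|a aA].
  by apply: h1; apply: notB.
apply: le_trans (IH _ (ltk a aA) (uD a)) _.
have -> : (A :\ a) :\: B = A :\ a.
  apply/setP => x; rewrite !inE.
  by case xA: (x \in A); rewrite ?andbF ?andbT // (notB x xA).
have -> : (A :\ a) :&: B = set0.
  apply/setP => x; rewrite !inE.
  by case xA: (x \in A); rewrite ?andbF ?andbT // (negbTE (notB x xA)) andbF.
rewrite cards0.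
by move: EC; rewrite (cardsD1 a A) aA add1n => -[->].
Qed.

End TruncatedCover.

(** * Truncated and true expected cover times *)

Lemma sum_tupleS (M : nmodType) (V : finType) k (P : pred (seq V))
    (f : seq V -> M) :
  \sum_(s : k.+1.-tuple V | P s) f s =
  \sum_v \sum_(s : k.-tuple V | P (v :: s)) f (v :: s).
Proof.
rewrite pair_big_dep /=.
rewrite (reindex (fun q : V * k.-tuple V => [tuple of q.1 :: q.2])) /=.
  by apply: eq_big => // -[v s].
exists (fun s : k.+1.-tuple V => (thead s, [tuple of behead s])) => [[v s] _|s _].
  by rewrite theadE; congr pair; apply: val_inj.
by rewrite [RHS]tuple_eta.
Qed.

Lemma sum_tuple0 (M : nmodType) (V : finType) (P : pred (seq V))
    (f : seq V -> M) :
  \sum_(s : 0.-tuple V | P s) f s = if P [::] then f [::] else 0.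
Proof.
case: ifP => P0.
  rewrite (big_pred1 [tuple of [::]]) // => s.
  by rewrite (tuple0 s) /= P0 eqxx.
by rewrite big_pred0 // => s; rewrite (tuple0 s).
Qed.

Section ExpectedCover.
Variables (R : realType) (V : finType) (G : {set {set V}}) (w : V -> V -> R).
Let p := trans_prob G w.
Hypothesis p_ge0 : forall u v, 0 <= p u v.
Hypothesis p_sum1 : forall u, \sum_v p u v = 1.

Let uncovered k u (A : {set V}) : R :=
  \sum_(s : k.-tuple V | ~~ (A \subset (s : seq V))) walk_prob G w u s.

Let just_covered k u (A : {set V}) : R :=
  \sum_(s : k.-tuple V | (A \subset (s : seq V)) &&
      [forall i : 'I_(size s), ~~ (A \subset take i s)]) walk_prob G w u s.

Lemma subset_cons (A : {set V}) v (s : seq V) :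
  (A \subset v :: s) = (A :\ v \subset s).
Proof.
apply/subsetP/subsetP => sA x.
  by rewrite !inE => /andP[/negbTE xv /sA]; rewrite inE xv.
by move=> xA; rewrite inE; case: eqP => //= /eqP xv; apply: sA; rewrite !inE xv.
Qed.

Lemma subset_nil (A : {set V}) : (A \subset [::]) = (A == set0).
Proof.
apply/subsetP/eqP => [sA|-> x]; last by rewrite inE.
by apply/setP => x; rewrite inE; apply/negP => /sA.
Qed.

Lemma uncovered0 u A : uncovered 0 u A = (A != set0)%:R.
Proof. by rewrite /uncovered (sum_tuple0 (fun s => ~~ (A \subset s)) (walk_prob G w u)) subset_nil; case: eqP. Qed.

Lemma uncoveredS k u A :
  uncovered k.+1 u A = \sum_v p u v * uncovered k v (A :\ v).
Proof.
rewrite /uncovered (sum_tupleS k (fun s => ~~ (A \subset s)) (walk_prob G w u)).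
apply: eq_bigr => v _.
by rewrite mulr_sumr; apply: eq_big => [s|s _] //; rewrite subset_cons.
Qed.

Lemma just_covered0 u A : just_covered 0 u A = (A == set0)%:R.
Proof.
rewrite /just_covered.
rewrite (sum_tuple0 (fun s => (A \subset s) &&
  [forall i : 'I_(size s), ~~ (A \subset take i s)]) (walk_prob G w u)) /= subset_nil.
rewrite (_ : [forall i, _] = true); last by apply/forallP => -[].
by rewrite andbT; case: eqP.
Qed.

Lemma just_coveredS k u A : just_covered k.+1 u A =
  if A == set0 then 0 else \sum_v p u v * just_covered k v (A :\ v).
Proof.
rewrite /just_covered (sum_tupleS k (fun s => (A \subset s) &&
  [forall i : 'I_(size s), ~~ (A \subset take i s)]) (walk_prob G w u)).
have eqc v (s : seq V) :
    [forall i : 'I_(size s).+1, ~~ (A \subset take i (v :: s))] =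
    (A != set0) && [forall i : 'I_(size s), ~~ (A :\ v \subset take i s)].
  apply/forallP/andP => [h|[A0 /forallP h] i].
    split; first by move: (h ord0); rewrite /= subset_nil.
    by apply/forallP => i; move: (h (lift ord0 i)); rewrite /= subset_cons.
  case: i => -[|i] ilt /=; first by rewrite subset_nil.
  by rewrite subset_cons; apply: (h (Ordinal (ilt : (i < size s)%N))).
case: ifPn => A0.
  rewrite big1 // => v _; rewrite big_pred0 // => s.
  by rewrite eqc A0 andbF.
apply: eq_bigr => v _; rewrite mulr_sumr; apply: eq_big => [s|s _] //.
by rewrite eqc A0 subset_cons.
Qed.

Lemma uncovered_set0 k u : uncovered k u set0 = 0.
Proof.
rewrite /uncovered big_pred0 // => s; apply/negbTE; rewrite negbK.
by apply/subsetP => x; rewrite inE.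
Qed.

Lemma just_coveredE k u A :
  just_covered k.+1 u A = uncovered k u A - uncovered k.+1 u A.
Proof.
elim: k u A => [|k IH] u A.
  rewrite just_coveredS uncoveredS uncovered0.
  case: eqP => [->|A0].
    rewrite big1 ?subrr // => v _.
    by rewrite uncovered0 set0D eqxx mulr0.
  rewrite /= -(p_sum1 u) -sumrB; apply: eq_bigr => v _.
  rewrite just_covered0 uncovered0 -[X in X - _]mulr1 -mulrBr.
  by case: eqP => _; rewrite ?subr0 ?subrr.
rewrite just_coveredS uncoveredS [uncovered k.+2 _ _]uncoveredS.
case: eqP => [->|A0].
  by rewrite !big1 ?subrr // => v _; rewrite set0D uncovered_set0 mulr0.
by rewrite -sumrB; apply: eq_bigr => v _; rewrite IH mulrBr.
Qed.

(** The tail formula E min(T, t) = sum of P(T > k) over k < t. It links the sums over walks in the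
    definition of [COV] to the recursion [trunc_cover]. *)
Lemma sum_uncovered t u A : \sum_(k < t) uncovered k u A = trunc_cover p t u A.
Proof.
elim: t u A => [|t IH] u A; first by rewrite big_ord0.
rewrite big_ord_recl uncovered0 /=; case: eqP => [->|A0].
  by rewrite add0r big1 // => k _; rewrite uncovered_set0.
congr (_ + _).
under eq_bigr => k _ do rewrite uncoveredS.
by rewrite exchange_big /=; apply: eq_bigr => v _; rewrite -mulr_sumr IH.
Qed.

Lemma walk_prob_ge0 u s : 0 <= walk_prob G w u s.
Proof. by elim: s u => //= v s IH u; rewrite mulr_ge0 ?p_ge0. Qed.

Lemma cover_time_probE u t : cover_time_prob G w u t = just_covered t u (~: [set u]).
Proof.
have cov (s : seq V) : covers u s = (~: [set u] \subset s).
  apply/forallP/subsetP => h x; first by rewrite !inE => /negbTE xu; move: (h x); rewrite inE xu.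
  by rewrite inE; case: eqP => //= /eqP xu; apply: h; rewrite !inE.
rewrite /cover_time_prob; apply: eq_bigl => s; rewrite /covers_first cov.
by congr andb; apply: eq_forallb => i; rewrite cov.
Qed.

(** Tail probabilities decrease, so N P(T > N) <= E min(T, N) <= C. Hence T is almost surely finite
    and the summand with the factor +oo vanishes; summation by parts bounds the partial sums of t
    P(T = t) by E min(T, N). *)
Lemma expected_cover_time_le u (C : R) :
  (forall t, trunc_cover p t u (~: [set u]) <= C) ->
  (expected_cover_time G w u <= C%:E)%E.
Proof.
set A := ~: [set u] => hC.
have jge0 t : 0 <= just_covered t u A by apply: sumr_ge0 => *; exact: walk_prob_ge0.
have uge0 t : 0 <= uncovered t u A by apply: sumr_ge0 => *; exact: walk_prob_ge0.
have udecr k l : (k <= l)%N -> uncovered l u A <= uncovered k u A.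
  elim: l => [|l IH]; first by rewrite leqn0 => /eqP ->.
  rewrite leq_eqVlt => /orP[/eqP -> //|]; rewrite ltnS => /IH; apply: le_trans.
  by rewrite -subr_ge0 -just_coveredE.
have sumj N : \sum_(0 <= t < N.+1) just_covered t u A = 1 - uncovered N u A.
  elim: N => [|N IH].
    rewrite big_nat1 just_covered0 uncovered0.
    by case: eqP; rewrite ?subr0 ?subrr.
  by rewrite big_nat_recr //= IH just_coveredE addrA subrK.
have sumtj N : \sum_(0 <= t < N.+1) t%:R * just_covered t u A =
    trunc_cover p N u A - N%:R * uncovered N u A.
  elim: N => [|N IH]; first by rewrite big_nat1 !mul0r subrr.
  rewrite big_nat_recr // IH -!sum_uncovered big_ord_recr just_coveredE.
  by rewrite /= -natr1; ring.
have C_ge0 : 0 <= C by apply: le_trans (hC 0%N); exact: trunc_cover_ge0.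
have ubound N : N%:R * uncovered N u A <= C.
  apply: le_trans (hC N); rewrite -sum_uncovered.
  rewrite mulr_natl -[X in _ *+ X]card_ord -sumr_const.
  by apply: ler_sum => k _; apply: udecr; apply: ltnW.
have ulim : (uncovered N u A @[N --> \oo] --> (0 : R))%classic.
  rewrite -(cvg_shiftS _ _).
  apply: (@squeeze_cvgr _ _ _ _ (fun=> 0) (fun N => C * (N.+1%:R)^-1)).
  - near=> N; rewrite uge0 /= ler_pdivlMr ?ltr0n // mulrC; exact: ubound.
  - exact: cvg_cst.
  - rewrite -(mulr0 C); apply: cvgMr; exact: cvg_harmonic.
rewrite /expected_cover_time.
under eq_eseriesr => t _ do rewrite cover_time_probE.
under [X in (1 - X)%E]eq_eseriesr => t _ do rewrite cover_time_probE.
have -> : (\sum_(0 <= t <oo) (just_covered t u A)%:E = 1)%E.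
  apply/cvg_lim => //.
  rewrite -(cvg_shiftS _ _).
  rewrite (_ : (fun n => _) = (fun N => (1 - uncovered N u A)%:E)); last first.
    by apply/funext => N; rewrite sumEFin sumj.
  apply: cvg_EFin; first by near=> N.
  rewrite -[X in (_ --> X)%classic]subr0.
  apply: cvgB => //; exact: cvg_cst.
rewrite subee // mule0 adde0.
apply: lime_le.
  apply: is_cvg_nneseries => t _ _.
  by rewrite lee_fin mulr_ge0.
near=> N.
rewrite sumEFin lee_fin.
apply: (@le_trans _ _ (\sum_(0 <= t < N.+1) t%:R * just_covered t u A)).
  by rewrite big_nat_recr //= lerDl mulr_ge0.
rewrite sumtj; apply: le_trans (hC N).
by rewrite gerBl mulr_ge0.
Unshelve. all: by end_near.
Qed.

Lemma COV_le (C : R) :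
  (forall u t, trunc_cover p t u (~: [set u]) <= C) -> (COV G w <= C%:E)%E.
Proof.
move=> hC; rewrite /COV.
apply: (big_ind (fun x => (x <= C%:E)%E)).
- exact: leNye.
- by move=> x y hx hy; rewrite ge_max hx hy.
- by move=> u _; apply: expected_cover_time_le.
Qed.

End ExpectedCover.

(** * Hitting times through Dirichlet energy *)

Section Potential.
Variables (R : realType) (V : finType) (c : V -> V -> R).
Hypothesis c_ge0 : forall u v, 0 <= c u v.
Hypothesis c_sym : forall u v, c u v = c v u.
Implicit Types (g h : V -> R) (a u v z : V) (B : {set V}).

Definition wt u : R := \sum_v c u v.

(** The sum runs over ordered pairs, which doubles the usual energy; the factors 2 in
    [spread_source] and [half] compensate for this. *)
Definition dirichlet g : R := \sum_u \sum_v c u v * (g u - g v) ^+ 2.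

Definition poincare (lam : R) : Prop :=
  forall g, exists b, lam * \sum_u (g u - b) ^+ 2 <= dirichlet g.

(** Dual form of a bound on effective resistance: it is what a unit flow of energy at most [Rs] from
    [a] to the weights [mu] provides. The bound on the squares of [mu] is there for Cauchy-Schwarz,
    which compares the average of [g] under [mu] with the constant of the Poincare inequality. *)
Definition spread_source (Rs ep : R) a : Prop :=
  exists mu : V -> R, [/\ \sum_u mu u = 1, \sum_u mu u ^+ 2 <= ep &
    forall g, (g a - \sum_u mu u * g u) ^+ 2 *+ 2 <= Rs * dirichlet g].

Lemma wt_ge0 u : 0 <= wt u.
Proof. exact: sumr_ge0. Qed.

Lemma dirichlet_ge0 g : 0 <= dirichlet g.
Proof.
by apply: sumr_ge0 => u _; apply: sumr_ge0 => v _; rewrite mulr_ge0 ?sqr_ge0.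
Qed.

Lemma cauchy_schwarz_sum (I : finType) (x y : I -> R) :
  (\sum_i x i * y i) ^+ 2 <= (\sum_i x i ^+ 2) * (\sum_i y i ^+ 2).
Proof.
rewrite -subr_ge0 -(pmulrn_lge0 _ (isT : (0 < 2)%N)).
have -> : ((\sum_i x i ^+ 2) * (\sum_i y i ^+ 2) - (\sum_i x i * y i) ^+ 2) *+ 2 =
    \sum_i \sum_j (x i * y j - x j * y i) ^+ 2.
  have E : \sum_i \sum_j x i ^+ 2 * y j ^+ 2 = (\sum_i x i ^+ 2) * (\sum_i y i ^+ 2).
    by rewrite mulr_suml; apply: eq_bigr => i _; rewrite mulr_sumr.
  have E2 : \sum_i \sum_j x i * y i * (x j * y j) = (\sum_i x i * y i) ^+ 2.
    by rewrite expr2 mulr_suml; apply: eq_bigr => i _; rewrite mulr_sumr.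
  have E3 : \sum_i \sum_j x j ^+ 2 * y i ^+ 2 = \sum_i \sum_j x i ^+ 2 * y j ^+ 2.
    exact: exchange_big.
  rewrite -E -E2 mulrnBl mulr2n -{2}E3.
  have E4 : \sum_i \sum_j (x i * y j - x j * y i) ^+ 2 =
    \sum_i \sum_j (x i ^+ 2 * y j ^+ 2) + \sum_i \sum_j (x j ^+ 2 * y i ^+ 2)
    + \sum_i \sum_j - (x i * y i * (x j * y j) *+ 2).
    rewrite -!big_split; apply: eq_bigr => i _; rewrite -!big_split.
    by apply: eq_bigr => j _ /=; ring.
  rewrite E4; congr (_ + _); rewrite -sumrMnl -sumrN.
  by apply: eq_bigr => i _; rewrite sumrN sumrMnl.
by apply: sumr_ge0 => i _; apply: sumr_ge0 => j _; exact: sqr_ge0.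
Qed.

(** The excess h of [g] over [kap] satisfies (h u - h v)^2 <= (h u - h v) (g u - g v). Summation by
    parts turns the right side into h tested against the Laplacian of [g], which is at most [wt]
    except at [a], where h vanishes. *)
Lemma dirichlet_excess g a kap :
  0 <= kap -> g a <= kap ->
  (forall u, u != a -> \sum_v c u v * (g u - g v) <= wt u) ->
  dirichlet (fun u => Num.max (g u - kap) 0) <=
    (\sum_u Num.max (g u - kap) 0 * wt u) *+ 2.
Proof.
move=> kap0 ga sub; pose h u := Num.max (g u - kap) 0.
rewrite -[leLHS]/(dirichlet h) -[X in _ <= X *+ 2]/(\sum_u h u * wt u).
have h_ge0 u : 0 <= h u by rewrite /h le_max lexx orbT.
apply: (@le_trans _ _ (\sum_u \sum_v c u v * ((h u - h v) * (g u - g v)))).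
  apply: ler_sum => u _; apply: ler_sum => v _; apply: ler_wpM2l => //.
  rewrite /h !maxEle; case: (lerP (g u - kap) 0) => gu; case: (lerP (g v - kap) 0) => gv.
  - by rewrite !subr0 expr2 !mul0r.
  - by nra.
  - by nra.
  - by rewrite expr2; nra.
have -> : \sum_u \sum_v c u v * ((h u - h v) * (g u - g v)) =
    (\sum_u h u * \sum_v c u v * (g u - g v)) *+ 2.
  have E : \sum_u h u * \sum_v c u v * (g u - g v) =
      \sum_u \sum_v c u v * h u * (g u - g v).
    apply: eq_bigr => u _; rewrite mulr_sumr; apply: eq_bigr => v _; ring.
  have E2 : \sum_u \sum_v c u v * h u * (g u - g v) =
      \sum_u \sum_v c u v * h v * (g v - g u).
    rewrite exchange_big; apply: eq_bigr => u _; apply: eq_bigr => v _.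
    by rewrite c_sym.
  rewrite mulr2n {2}E E2 E -big_split; apply: eq_bigr => u _.
  by rewrite -big_split; apply: eq_bigr => v _ /=; ring.
rewrite lerMn2r /=; apply: ler_sum => u _.
case: (eqVneq u a) => [->|ua]; last by rewrite ler_wpM2l // sub.
have -> : h a = 0 by apply/max_idPr; rewrite subr_le0.
by rewrite !mul0r.
Qed.

Variable lam : R.
Hypothesis lam_gt0 : 0 < lam.
Hypothesis hP : poincare lam.

Let tau : R := Num.sqrt (2 / lam).
Let half g : R := Num.sqrt (dirichlet g / 2).

Lemma half_sqr g : half g ^+ 2 = dirichlet g / 2.
Proof. by rewrite sqr_sqrtr // divr_ge0 // dirichlet_ge0. Qed.

Lemma ler_sqr_norm (x y : R) : 0 <= y -> x ^+ 2 <= y ^+ 2 -> `|x| <= y.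
Proof.
by move=> y0; rewrite -(real_normK (num_real x)) ler_pXn2r ?nnegrE.
Qed.

Lemma center_point g b z : lam * \sum_u (g u - b) ^+ 2 <= dirichlet g ->
  `|g z - b| <= tau * half g.
Proof.
move=> hb; apply: ler_sqr_norm; first by rewrite mulr_ge0 ?sqrtr_ge0.
rewrite exprMn half_sqr sqr_sqrtr; last by rewrite divr_ge0 // ltW.
have -> : 2 / lam * (dirichlet g / 2) = dirichlet g / lam.
  by field; rewrite gt_eqF.
rewrite ler_pdivlMr // mulrC; apply: le_trans hb; rewrite ler_pM2l //.
by rewrite (bigD1 z) //= lerDl sumr_ge0 // => *; exact: sqr_ge0.
Qed.

(** The difference [g a - b] splits into [g a] minus its [mu]-average, controlled by the resistance,
    and the [mu]-average of [g - b], controlled by Cauchy-Schwarz and the Poincare inequality at the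
    price [Num.sqrt ep * tau]. *)
Lemma center_source Rs ep a g b : 0 <= Rs -> 0 <= ep ->
  spread_source Rs ep a ->
  lam * \sum_u (g u - b) ^+ 2 <= dirichlet g ->
  `|g a - b| <= (Num.sqrt Rs + Num.sqrt ep * tau) * half g.
Proof.
move=> Rs0 ep0 [mu [mu1 mu2 hmu]] hb.
have -> : g a - b = (g a - \sum_u mu u * g u) + \sum_u mu u * (g u - b).
  under [X in _ = _ + X]eq_bigr => u _ do rewrite mulrBr.
  by rewrite sumrB -mulr_suml mu1 mul1r addrA subrK.
apply: le_trans (ler_normD _ _) _; rewrite mulrDl; apply: lerD.
  apply: ler_sqr_norm; first by rewrite mulr_ge0 ?sqrtr_ge0.
  rewrite exprMn half_sqr sqr_sqrtr // mulrA ler_pdivlMr // mulr_natr.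
  exact: hmu.
apply: ler_sqr_norm; first by rewrite !mulr_ge0 ?sqrtr_ge0.
apply: le_trans (cauchy_schwarz_sum _ _) _.
rewrite !exprMn half_sqr !sqr_sqrtr //; last by rewrite divr_ge0 // ltW.
rewrite -mulrA; apply: ler_pM => //.
- by apply: sumr_ge0 => *; exact: sqr_ge0.
- by apply: sumr_ge0 => *; exact: sqr_ge0.
have -> : 2 / lam * (dirichlet g / 2) = dirichlet g / lam.
  by field; rewrite gt_eqF.
by rewrite ler_pdivlMr // mulrC.
Qed.

(** The excess h over [kap] lives on [B], so the square of [half h] is at most max h times the
    weight of [B]; since h vanishes at [a], max h is also at most 2 [tau] times [half h]. Together
    these are a quadratic inequality for max h. With [kap = 0] and [B] the whole vertex set this
    bounds hitting times of arbitrary targets. *)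
Lemma excess_bound g a kap B :
  0 <= kap -> g a <= kap ->
  (forall u, u != a -> \sum_v c u v * (g u - g v) <= wt u) ->
  (forall u, u \notin B -> g u <= kap) ->
  forall u, g u <= kap + 4 * tau ^+ 2 * \sum_(z in B) wt z.
Proof.
move=> kap0 ga sub gB u.
pose h u := Num.max (g u - kap) 0.
have h_ge0 z : 0 <= h z by rewrite /h le_max lexx orbT.
have hE := dirichlet_excess kap0 ga sub; rewrite -/h in hE.
set wB := \sum_(z in B) wt z.
have wB0 : 0 <= wB by apply: sumr_ge0 => *; exact: wt_ge0.
have [M hM] : exists z, forall v, h v <= h z.
  exists [arg max_(z > u) h z]%O; case: arg_maxP => // z _ hz v; exact: hz.
have ha : h a = 0 by apply/max_idPr; rewrite subr_le0.
have hw : \sum_z h z * wt z <= h M * wB.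
  rewrite (bigID (mem B)) /= [X in _ + X]big1 => [|z zB].
    rewrite addr0 mulr_sumr; apply: ler_sum => z _; apply: ler_wpM2r => //.
    exact: wt_ge0.
  suff -> : h z = 0 by rewrite mul0r.
  by apply/max_idPr; rewrite subr_le0; apply: gB.
have [b hb] := hP h.
have h1 : h M <= 2 * tau * half h.
  apply: le_trans (ler_norm _) _.
  have -> : h M = (h M - b) - (h a - b) by rewrite ha; ring.
  apply: le_trans (ler_normB _ _) _.
  have := center_point M hb; have := center_point a hb; lra.
have h2 : half h ^+ 2 <= h M * wB.
  rewrite half_sqr ler_pdivrMr // mulr_natr.
  by apply: le_trans hE _; rewrite lerMn2r /= hw.
have h3 : h M <= 4 * tau ^+ 2 * wB.
  have [->|hM0] := eqVneq (h M) 0.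
    by apply: mulr_ge0 => //; apply: mulr_ge0 => //; exact: sqr_ge0.
  have hMp : 0 < h M by rewrite lt_neqAle eq_sym hM0 h_ge0.
  rewrite -(ler_pM2l hMp) -expr2.
  apply: (@le_trans _ _ ((2 * tau * half h) ^+ 2)).
    by rewrite ler_pXn2r ?nnegrE //; exact: le_trans (h_ge0 M) h1.
  rewrite !exprMn.
  have : 0 <= tau ^+ 2 by exact: sqr_ge0.
  by nra.
have := hM u; rewrite /h => hu.
have : g u - kap <= h M by apply: le_trans hu; rewrite le_max lexx.
lra.
Qed.

Variables (Rs ep : R) (B : {set V}).
Hypotheses (Rs0 : 0 <= Rs) (ep0 : 0 <= ep).
Hypothesis srcB : forall a, a \notin B -> spread_source Rs ep a.

Let rho := Num.sqrt Rs + Num.sqrt ep * tau.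
Let W := \sum_u wt u.
Let wB := \sum_(u in B) wt u.

(** The leading term is 4 [rho]^2 [W]; all other terms carry the weight of [B]. *)
Definition fast_hit : R :=
  2 * rho * (2 * rho * W + (rho + tau) * wB) + 4 * tau ^+ 2 * wB.

(** As [g] vanishes at [a], the constant [b] is at most [rho * half g] in absolute value, which
    gives [gout] and [gin]. Inserted into the energy inequality they bound [half g] by [Q]. Starting
    points in [B] have only the weak constant [tau], so the bound obtained outside [B] is carried
    over to them by [excess_bound]. *)
Lemma subsolution_bound g a : a \notin B ->
  (forall u, 0 <= g u) -> g a = 0 ->
  (forall u, u != a -> \sum_v c u v * (g u - g v) <= wt u) ->
  forall u, g u <= fast_hit.
Proof.
move=> aB g0 ga sub.
have tau0 : 0 <= tau by exact: sqrtr_ge0.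
have rho0 : 0 <= rho by rewrite addr_ge0 ?mulr_ge0 ?sqrtr_ge0.
have W0 : 0 <= W by apply: sumr_ge0 => *; exact: wt_ge0.
have wB0 : 0 <= wB by apply: sumr_ge0 => *; exact: wt_ge0.
have e0 : 0 <= half g by exact: sqrtr_ge0.
have [b hb] := hP g.
have hga := center_source Rs0 ep0 (srcB aB) hb; rewrite ga -/rho in hga.
have gout z : z \notin B -> g z <= 2 * rho * half g.
  move=> zB; have := center_source Rs0 ep0 (srcB zB) hb; rewrite -/rho => hz.
  apply: le_trans (ler_norm _) _.
  have -> : g z = (g z - b) - (0 - b) by ring.
  by apply: le_trans (ler_normB _ _) _; lra.
have gin z : g z <= (rho + tau) * half g.
  have hz := center_point z hb.
  apply: le_trans (ler_norm _) _.
  have -> : g z = (g z - b) - (0 - b) by ring.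
  by apply: le_trans (ler_normB _ _) _; lra.
have hE : dirichlet g <= (\sum_u g u * wt u) *+ 2.
  have := dirichlet_excess (lexx 0) _ sub; rewrite ga => /(_ (lexx 0)) /=.
  have E u : Num.max (g u - 0) 0 = g u by rewrite subr0; apply/max_idPl.
  rewrite (eq_bigr (fun u => g u * wt u)); last by move=> u _; rewrite E.
  by rewrite (_ : (fun u => _) = g) //; apply/funext.
set Q := 2 * rho * W + (rho + tau) * wB.
have Q0 : 0 <= Q by rewrite addr_ge0 // !mulr_ge0 // addr_ge0.
have hS : \sum_u g u * wt u <= Q * half g.
  rewrite (bigID (mem B)) /= addrC /Q mulrDl; apply: lerD.
    apply: (@le_trans _ _ (\sum_(u | u \notin B) 2 * rho * half g * wt u)).
      by apply: ler_sum => z zB; rewrite ler_wpM2r ?wt_ge0 // gout.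
    rewrite -mulr_sumr mulrAC; apply: ler_wpM2r => //.
    apply: ler_wpM2l; first by rewrite mulr_ge0.
    rewrite /W [leRHS](bigID (mem B)) /= lerDr.
    by apply: sumr_ge0 => *; exact: wt_ge0.
  rewrite mulrAC mulr_sumr; apply: ler_sum => z _.
  by rewrite ler_wpM2r ?wt_ge0 // gin.
have eQ : half g <= Q.
  have [->|en0] := eqVneq (half g) 0; first by [].
  have epos : 0 < half g by rewrite lt_neqAle eq_sym en0 e0.
  rewrite -(ler_pM2r epos) -expr2 half_sqr; apply: le_trans hS.
  by rewrite ler_pdivrMr // mulr_natr.
have k0 : 0 <= 2 * rho * Q by rewrite !mulr_ge0.
apply: (excess_bound k0 _ sub); first by rewrite ga.
move=> z zB; apply: le_trans (gout z zB) _.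
by rewrite ler_wpM2l // mulr_ge0.
Qed.

Hypothesis wt_gt0 : forall u, 0 < wt u.

Let p u v := c u v / wt u.

Lemma p_ge0 u v : 0 <= p u v.
Proof. by apply: divr_ge0 => //; exact: wt_ge0. Qed.

Lemma p_sum1 u : \sum_v p u v = 1.
Proof. by rewrite -mulr_suml divff // lt0r_neq0 //; exact: wt_gt0. Qed.

Let hit a t u := if u == a then 0 else trunc_cover p t u [set a].

(** The time stopped at [t] is at most the time stopped at [t.+1], which is one step plus the
    average of the times stopped at [t]. Truncation thus turns the hitting time equation into an
    inequality in the right direction. *)
Lemma hit_subsolution a t u : u != a ->
  \sum_v c u v * (hit a t u - hit a t v) <= wt u.
Proof.
move=> ua.
under eq_bigr => v _ do rewrite mulrBr.
rewrite sumrB -mulr_suml -/(wt u) lerBlDr.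
have hle : hit a t u <= 1 + \sum_v p u v * hit a t v.
  rewrite /hit (negbTE ua); apply: le_trans (trunc_cover_leS p_ge0 _ _ _) _.
  rewrite /=; case: eqP => [/setP /(_ a)|_]; first by rewrite !inE eqxx.
  rewrite lerD2l; apply: ler_sum => v _; apply: ler_wpM2l; first exact: p_ge0.
  case: (eqVneq v a) => [->|va]; first by rewrite setDv trunc_cover0.
  suff -> : [set a] :\ v = [set a] by [].
  apply/setP => x; rewrite !inE; case: (eqVneq x a) => [->|]; last by rewrite andbF.
  by rewrite eq_sym va.
apply: (@le_trans _ _ (wt u * (1 + \sum_v p u v * hit a t v))).
  by rewrite ler_wpM2l // wt_ge0.
rewrite mulrDr mulr1 lerD2l mulr_sumr; apply: ler_sum => v _.
by rewrite /p mulrA mulrCA divff ?mulr1 // gt_eqF.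
Qed.

Lemma hit_fast a : a \notin B ->
  forall t u, u != a -> trunc_cover p t u [set a] <= fast_hit.
Proof.
move=> aB t u ua.
have := @subsolution_bound (hit a t) a aB _ _ (@hit_subsolution a t) u.
rewrite /hit (negbTE ua); apply; last by rewrite eqxx.
by move=> v; case: ifP => // _; apply: trunc_cover_ge0 p_ge0 _ _ _.
Qed.

Lemma hit_slow a :
  forall t u, u != a -> trunc_cover p t u [set a] <= 4 * tau ^+ 2 * W.
Proof.
move=> t u ua.
have h0 : hit a t a <= 0 by rewrite /hit eqxx.
have := @excess_bound (hit a t) a 0 setT (lexx _) h0 (@hit_subsolution a t) _ u.
rewrite add0r /W (eq_bigl predT); last by move=> z; rewrite inE.
by rewrite /hit (negbTE ua); apply => v; rewrite inE.
Qed.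

Lemma trunc_cover_bound t u (A : {set V}) : u \notin A ->
  trunc_cover p t u A <= fast_hit * harmonic_sum R #|V|
    + 4 * tau ^+ 2 * W * harmonic_sum R #|B|.
Proof.
have hmono k l : (k <= l)%N -> harmonic_sum R k <= harmonic_sum R l.
  elim: l => [|l IH]; first by rewrite leqn0 => /eqP ->.
  rewrite leq_eqVlt => /orP[/eqP -> //|]; rewrite ltnS => /IH /le_trans; apply.
  by rewrite harmonic_sumS lerDl invr_ge0.
have tau0 : 0 <= tau by exact: sqrtr_ge0.
have rho0 : 0 <= rho by rewrite addr_ge0 ?mulr_ge0 ?sqrtr_ge0.
have W0 : 0 <= W by apply: sumr_ge0 => *; exact: wt_ge0.
have wB0 : 0 <= wB by apply: sumr_ge0 => *; exact: wt_ge0.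
have F0 : 0 <= fast_hit by rewrite /fast_hit !(addr_ge0, mulr_ge0).
have S0 : 0 <= 4 * tau ^+ 2 * W by rewrite !mulr_ge0.
move=> uA.
apply: le_trans (matthews p_ge0 p_sum1 F0 S0 hit_fast (fun a _ => @hit_slow a) t uA) _.
apply: lerD; apply: ler_wpM2l => //; apply: hmono.
  exact: max_card.
by apply: subset_leq_card; apply: subsetIr.
Qed.

End Potential.

(** * Cheeger's inequality *)

Section Cheeger.
Variables (R : realType) (V : finType) (e : rel V).
Hypothesis e_sym : symmetric e.
Implicit Types (X : {set V}) (f g : V -> R).

Definition vol X : nat := (\sum_(u in X) \sum_v e u v)%N.

Definition cut X : nat := (\sum_(u in X) \sum_(v in ~: X) e u v)%N.

Variable K : nat.
Hypothesis isoperimetry :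
  forall X, (2 * vol X <= vol setT)%N -> (vol X <= K * cut X)%N.

Let ind (u v : V) : R := (e u v)%:R.

(** Layers are peeled off by induction on the support X: subtracting the least positive value m on X
    lowers the left side by 2 m vol X and the right side by 2 m K cut X, since each cut edge occurs
    in both orientations. *)
Lemma coarea f : (forall u, 0 <= f u) ->
  (2 * vol [set u | f u != 0%R] <= vol setT)%N ->
  2 * \sum_u \sum_v ind u v * f u <=
    K%:R * \sum_u \sum_v ind u v * `|f u - f v|.
Proof.
have [k] := ubnP #|[set u | f u != 0]|; elim: k f => // k IH f + f0.
set X := [set u | f u != 0] => Xk Xvol.
have inX u : (u \in X) = (f u != 0) by rewrite inE.
have notX u : u \notin X -> f u = 0 by rewrite inX negbK => /eqP.
have [X0|[x xX]] := set_0Vmem X.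
  rewrite big1 ?mulr0 => [|u _].
    apply: mulr_ge0 => //; apply: sumr_ge0 => u _; apply: sumr_ge0 => v _.
    by rewrite mulr_ge0 // ler0n.
  rewrite big1 // => v _; rewrite (notX u) ?mulr0 //.
  by rewrite X0 inE.
have [y yX ymin] : exists2 y, y \in X & forall u, u \in X -> f y <= f u.
  exists [arg min_(i < x | i \in X) f i]%O; by case: arg_minP => // i iX hi.
set m := f y.
have m0 : 0 < m by rewrite lt_neqAle f0 andbT eq_sym -inX.
pose f' u := f u - m * (u \in X)%:R.
have f'0 u : 0 <= f' u.
  rewrite /f'; case: (boolP (u \in X)) => [uX|/notX ->].
    by rewrite mulr1 subr_ge0 ymin.
  by rewrite mulr0 subr0.
have sub' : [set u | f' u != 0] \subset X :\ y.
  apply/subsetP => u; rewrite !inE /f'.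
  case: (eqVneq u y) => [->|uy]; first by rewrite yX mulr1 subrr eqxx.
  case: (boolP (u \in X)) => [|/notX ->]; first by rewrite inE.
  by rewrite mulr0 subr0 eqxx.
have h' : 2 * \sum_u \sum_v ind u v * f' u <=
    K%:R * \sum_u \sum_v ind u v * `|f' u - f' v|.
  apply: IH => //.
    apply: leq_ltn_trans (subset_leq_card sub') _.
    by move: Xk; rewrite (cardsD1 y X) yX.
  apply: leq_trans Xvol; rewrite leq_mul2l /=.
  rewrite /vol [leqRHS](bigID (mem [set u | f' u != 0])) /=.
  apply: leq_trans (leq_addr _ _); apply: eq_leq; apply: eq_bigl => u.
  case: (boolP (u \in [set u | f' u != 0])) => [uf|]; last by rewrite andbF.
  by move: (subsetP sub' u uf); rewrite !inE => /andP[_ ->].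
have E1 : \sum_u \sum_v ind u v * f u =
    \sum_u \sum_v ind u v * f' u + m * (vol X)%:R.
  rewrite /vol natr_sum [X in m * X]big_mkcond /= mulr_sumr -big_split /=.
  apply: eq_bigr => u _; rewrite /f'.
  under [X in _ = X + _]eq_bigr => v _ do rewrite mulrBr.
  rewrite sumrB -[LHS]addr0 -addrA; congr (_ + _).
  rewrite -mulr_suml; case: ifP => _; last by rewrite !mulr0 oppr0 addr0.
  by rewrite mulr1 natr_sum mulrC addNr.
have E2 : \sum_u \sum_v ind u v * `|f u - f v| =
    \sum_u \sum_v ind u v * `|f' u - f' v| + 2 * m * (cut X)%:R.
  pose ct u v := ind u v * ((u \in X) && (v \notin X))%:R.
  have Ec : \sum_u \sum_v ct u v = (cut X)%:R.
    rewrite /cut natr_sum [RHS]big_mkcond /=; apply: eq_bigr => u _.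
    case: ifP => uX.
      rewrite natr_sum [RHS]big_mkcond /=; apply: eq_bigr => v _.
      by rewrite /ct uX in_setC; case: (v \in X); rewrite ?mulr0 ?mulr1.
    by rewrite big1 // => v _; rewrite /ct uX mulr0.
  have Ec2 : \sum_u \sum_v ct v u = (cut X)%:R by rewrite exchange_big.
  have -> : 2 * m * (cut X)%:R =
      \sum_u \sum_v m * (ct u v + ct v u).
    under eq_bigr => u _ do rewrite -mulr_sumr big_split /=.
    rewrite -mulr_sumr big_split /= Ec Ec2; ring.
  rewrite -big_split; apply: eq_bigr => u _; rewrite -big_split; apply: eq_bigr => v _.
  rewrite /ct {2}/ind e_sym -/(ind v u) /=.
  have -> : ind v u = ind u v by rewrite /ind e_sym.
  rewrite -mulrDr mulrCA -mulrDr; congr (_ * _).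
  rewrite /f'; case: (boolP (u \in X)) => uX; case: (boolP (v \in X)) => vX /=.
  - by rewrite addr0 mulr0 addr0; congr (`|_|); ring.
  - rewrite (notX v) // mulr1 mulr0 !subr0 addr0 mulr1 !ger0_norm ?f0 ?subr_ge0 ?ymin //.
    by rewrite subrK.
  - rewrite (notX u) // mulr0 mulr1 !sub0r add0r mulr1 oppr0 sub0r !normrN.
    by rewrite !ger0_norm ?subr_ge0 ?ymin // subrK.
  - by rewrite mulr0 !subr0 addr0 mulr0 addr0.
rewrite E1 E2.
have hv : (vol X)%:R <= K%:R * (cut X)%:R :> R.
  by rewrite -natrM ler_nat; exact: isoperimetry.
rewrite !mulrDr; apply: lerD => //.
have -> : K%:R * (2 * m * (cut X)%:R) = 2 * (m * (K%:R * (cut X)%:R)) by ring.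
by apply: ler_wpM2l => //; apply: ler_wpM2l => //; exact: ltW.
Qed.

Lemma cheeger_half f : (forall u, 0 <= f u) ->
  (2 * vol [set u | f u != 0%R] <= vol setT)%N ->
  \sum_u \sum_v ind u v * f u ^+ 2 <=
    K%:R ^+ 2 * \sum_u \sum_v ind u v * (f u - f v) ^+ 2.
Proof.
move=> f0 fvol.
set F := \sum_u \sum_v _; set D := \sum_u \sum_v _.
have h : 2 * F <= K%:R * \sum_u \sum_v ind u v * `|f u ^+ 2 - f v ^+ 2|.
  apply: (@coarea (fun u => f u ^+ 2)) => [u|]; first exact: sqr_ge0.
  apply: leq_trans fvol; apply: eq_leq; congr (2 * vol _)%N.
  by apply/setP => u; rewrite !inE sqrf_eq0.
have ind0 u v : 0 <= ind u v by rewrite ler0n.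
(* AM-GM: 2 |x| y <= 2 K x^2 + y^2 / (2 K), cleared of denominators. *)
have h2 : 4 * K%:R * (\sum_u \sum_v ind u v * `|f u ^+ 2 - f v ^+ 2|) <=
    4 * K%:R ^+ 2 * D + 4 * F.
  have -> : 4 * F = \sum_u \sum_v ind u v * (2 * f u ^+ 2 + 2 * f v ^+ 2).
    have E : \sum_u \sum_v ind u v * f v ^+ 2 = F.
      rewrite exchange_big; apply: eq_bigr => u _; apply: eq_bigr => v _.
      by rewrite /ind e_sym.
    have -> : 4 * F = 2 * F + 2 * F by ring.
    rewrite -{2}E /F !mulr_sumr -big_split; apply: eq_bigr => u _.
    by rewrite !mulr_sumr -big_split; apply: eq_bigr => v _ /=; ring.
  rewrite /D !mulr_sumr -big_split; apply: ler_sum => u _.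
  rewrite !mulr_sumr -big_split; apply: ler_sum => v _ /=.
  rewrite mulrCA [X in _ <= X + _]mulrCA -mulrDr; apply: ler_wpM2l => //.
  rewrite subr_sqr normrM (ger0_norm (addr_ge0 (f0 u) (f0 v))).
  rewrite -(real_normK (num_real (f u - f v))).
  set x := `|_|; set y := f u + f v.
  have : 0 <= (2 * K%:R * x - y) ^+ 2 by exact: sqr_ge0.
  have : y ^+ 2 <= 2 * f u ^+ 2 + 2 * f v ^+ 2.
    by rewrite /y; have := sqr_ge0 (f u - f v); nra.
  by rewrite !expr2; nra.
by rewrite -[_ * D]mulrA in h2 *; lra.
Qed.

Lemma volI X (Y : {set V}) : X \subset Y -> (vol X <= vol Y)%N.
Proof.
move=> XY; rewrite /vol [leqRHS](bigID (mem X)) /=.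
apply: leq_trans (leq_addr _ _); apply: eq_leq; apply: eq_bigl => u.
by case: (boolP (u \in X)) => [/(subsetP XY) ->|]; rewrite ?andbF.
Qed.

Lemma volC X : (vol X + vol (~: X) = vol setT)%N.
Proof.
rewrite /vol [RHS](bigID (mem X)) /=; congr addn; apply: eq_bigl => u; by rewrite !inE.
Qed.

(** A median for the degree weights: the least value [g v] such that at most half of the volume lies
    above it. If more than half lay below, then less than half would lie above the next smaller
    value [g w], against minimality. *)
Lemma median_exists g (x : V) : exists b,
  (2 * vol [set u | b < g u]%R <= vol setT)%N /\
  (2 * vol [set u | g u < b]%R <= vol setT)%N.
Proof.
pose P v := (2 * vol [set u | g v < g u]%R <= vol setT)%N.
have [x0 Px0] : exists v, P v.
  exists [arg max_(i > x) g i]%O; case: arg_maxP => // v _ hv; rewrite /P.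
  suff -> : [set u | g v < g u] = set0 by rewrite /vol big_set0.
  by apply/setP => u; rewrite !inE; apply/negbTE; rewrite -leNgt; exact: hv.
have [v Pv vmin] : exists2 v, P v & forall u, P u -> g v <= g u.
  by exists [arg min_(i < x0 | P i) g i]%O; case: arg_minP.
exists (g v); split; first exact: Pv.
rewrite leqNgt; apply/negP => hlt.
have [L0|[z zL]] := set_0Vmem [set u | g u < g v].
  by move: hlt; rewrite L0 /vol big_set0.
have [w wL wmax] : exists2 w, g w < g v & forall u, g u < g v -> g u <= g w.
  exists [arg max_(i > z | g i < g v) g i]%O; case: arg_maxP => //;
    by move: zL; rewrite inE.
suff /vmin : P w by rewrite leNgt wL.
rewrite /P; have -> : [set u | g w < g u] = ~: [set u | g u < g v].
  apply/setP => u; rewrite !inE -leNgt; apply/idP/idP => [wu|]; last exact: lt_le_trans.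
  by rewrite leNgt; apply: contraL wu => /wmax; rewrite leNgt.
by have := volC [set u | g u < g v]; lia.
Qed.

Variables (c : V -> V -> R) (Dl : R).
Hypothesis Dl0 : 0 < Dl.
Hypothesis c_ge : forall u v, ind u v <= Dl * c u v.
Hypothesis deg_gt0 : forall u, (0 < \sum_v e u v)%N.
Hypothesis K_gt0 : (0 < K)%N.

(** Centred at a median, the positive and the negative part of [g - b] are each supported on at most
    half of the volume, so [cheeger_half] applies to both. Positive degrees let the degree-weighted
    sum dominate the plain one; [Dl] is the price for replacing edge indicators by [c]. *)
Lemma cheeger : poincare c (K%:R ^+ 2 * Dl)^-1.
Proof.
move=> g.
have KD : 0 < K%:R ^+ 2 * Dl by rewrite mulr_gt0 // exprn_gt0 // ltr0n.
case: (pickP [pred u : V | true]) => [x _|V0]; last first.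
  by exists 0; rewrite /dirichlet !big_pred0 ?mulr0.
have [b [hb1 hb2]] := median_exists g x.
exists b; rewrite ler_pdivrMl //.
pose f1 u := Num.max (g u - b) 0; pose f2 u := Num.max (b - g u) 0.
have f10 u : 0 <= f1 u by rewrite le_max lexx orbT.
have f20 u : 0 <= f2 u by rewrite le_max lexx orbT.
have h1 : \sum_u \sum_v ind u v * f1 u ^+ 2 <=
    K%:R ^+ 2 * \sum_u \sum_v ind u v * (f1 u - f1 v) ^+ 2.
  apply: cheeger_half => //; apply: leq_trans hb1; rewrite leq_mul2l /=.
  apply: volI; apply/subsetP => u; rewrite !inE ltNge; apply: contra => gb.
  by apply/eqP/max_idPr; rewrite subr_le0.
have h2 : \sum_u \sum_v ind u v * f2 u ^+ 2 <=
    K%:R ^+ 2 * \sum_u \sum_v ind u v * (f2 u - f2 v) ^+ 2.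
  apply: cheeger_half => //; apply: leq_trans hb2; rewrite leq_mul2l /=.
  apply: volI; apply/subsetP => u; rewrite !inE ltNge; apply: contra => gb.
  by apply/eqP/max_idPr; rewrite subr_le0.
have E u : (g u - b) ^+ 2 = f1 u ^+ 2 + f2 u ^+ 2.
  rewrite /f1 /f2 !maxEle; case: lerP => h; case: lerP => h';
    rewrite ?expr0n /=; nra.
have ind0 u v : 0 <= ind u v by rewrite ler0n.
have hl : \sum_u (g u - b) ^+ 2 <=
    \sum_u \sum_v ind u v * f1 u ^+ 2 + \sum_u \sum_v ind u v * f2 u ^+ 2.
  rewrite -big_split /=; apply: ler_sum => u _.
  rewrite -!mulr_suml -mulrDr E -[leLHS]mul1r; apply: ler_wpM2r => /=.
    by rewrite addr_ge0 // sqr_ge0.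
  by rewrite -natr_sum ler1n; exact: deg_gt0.
apply: le_trans hl _; apply: le_trans (lerD h1 h2) _.
rewrite -mulrDr -[leRHS]mulrA; apply: ler_wpM2l; first exact: sqr_ge0.
rewrite /dirichlet mulr_sumr -big_split; apply: ler_sum => u _ /=.
rewrite mulr_sumr -big_split; apply: ler_sum => v _ /=.
rewrite -mulrDr mulrA; apply: le_trans (_ : ind u v * (g u - g v) ^+ 2 <= _); last first.
  by apply: ler_wpM2r; [exact: sqr_ge0 | exact: c_ge].
apply: ler_wpM2l => //; rewrite /f1 /f2 !maxEle.
by case: (lerP (g u - b) 0) => ?; case: (lerP (b - g u) 0) => ?;
   case: (lerP (g v - b) 0) => ?; case: (lerP (b - g v) 0) => ?; nra.
Qed.

End Cheeger.

(** * Flow to a distant sphere of a tree-like ball *)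

Section Layers.
Variables (V : finType) (e : rel V).
Hypotheses (e_sym : symmetric e) (e_irr : irreflexive e).
Implicit Types (a u v x y z : V).

(* A path from a, listed backwards, whose final vertex v1 is adjacent to an
   earlier vertex other than its predecessor. *)
Definition lasso_seq a (s : seq V) : bool :=
  if s is v1 :: v2 :: r then
    [&& path e v1 (v2 :: r), uniq s, last v1 (v2 :: r) == a & has (e v1) r]
  else false.

Fixpoint ball a (i : nat) : {set V} :=
  if i is j.+1 then ball a j :|: [set y | [exists x in ball a j, e x y]]
  else [set a].

Definition sphere a (i : nat) : {set V} :=
  if i is j.+1 then ball a j.+1 :\: ball a j else [set a].

Lemma sphere_ball a i : sphere a i \subset ball a i.
Proof. by case: i => //= i; exact: subsetDl. Qed.

Lemma ball_leq a i j : (i <= j)%N -> ball a i \subset ball a j.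
Proof.
elim: j => [|j IH]; first by rewrite leqn0 => /eqP ->.
rewrite leq_eqVlt => /orP[/eqP -> //|]; rewrite ltnS => /IH h.
by apply: subset_trans h _; exact: subsetUl.
Qed.

Lemma ball_edge a i x y : x \in ball a i -> e x y -> y \in ball a i.+1.
Proof. by move=> xb xy; rewrite !inE; apply/orP; right; apply/existsP; exists x; rewrite xb. Qed.

Lemma ball_sphere a i x : x \in ball a i -> exists2 j, (j <= i)%N & x \in sphere a j.
Proof.
elim: i => [|i IH] xb; first by exists 0%N.
case: (boolP (x \in ball a i)) => [/IH [j ji xj]|nb].
  by exists j => //; exact: leqW.
by exists i.+1 => //; rewrite /sphere in_setD nb.
Qed.

Lemma sphere_disjoint a i j x : x \in sphere a i -> x \in sphere a j -> i = j.
Proof.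
wlog ij : i j / (i <= j)%N => [h|] xi xj.
  by case: (leqP i j) => [/h|/ltnW /h /(_ xj xi)] //; apply.
move: ij; rewrite leq_eqVlt => /orP[/eqP //|].
case: j xj => // j; rewrite /sphere in_setD => /andP[/negP nb _]; rewrite ltnS => ij.
by case: nb; apply: (subsetP (ball_leq a ij)); apply: (subsetP (sphere_ball a i)).
Qed.

Lemma sphere_pred a i y : y \in sphere a i.+1 -> exists2 x, x \in sphere a i & e x y.
Proof.
rewrite {1}/sphere in_setD => /andP[nb]; rewrite /= in_setU (negbTE nb) inE /=.
case/existsP => x /andP[xb xy]; exists x => //.
case: i nb xb => [|i] nb xb //; rewrite /sphere in_setD xb andbT.
by apply: contra nb => xb'; apply: (ball_edge xb' xy).
Qed.

Lemma geodesic a i y : y \in sphere a i -> exists s : seq V,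
  [/\ path e y s, uniq (y :: s), last y s = a, size s = i & {subset y :: s <= ball a i}].
Proof.
elim: i y => [|i IH] y yS.
  move: yS; rewrite inE => /eqP ->; exists [::]; split => // z.
  by rewrite !inE.
have [x xS xy] := sphere_pred yS.
have [s [ps us ls ss sb]] := IH x xS.
exists (x :: s); split.
- by rewrite /= e_sym xy.
- rewrite cons_uniq us andbT; apply/negP => /sb yb.
  by move: yS; rewrite /sphere in_setD yb.
- exact: ls.
- by rewrite /= ss.
- move=> z; rewrite inE => /orP[/eqP ->|/sb zb]; first exact: (subsetP (sphere_ball a i.+1)).
  exact: (subsetP (ball_leq a (leqnSn i))).
Qed.

(** The path is prolonged from [v1] by [x] and then down the spheres towards [a], until the next
    vertex already lies on the path, which happens at [a] at the latest. The level condition on [v1]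
    ensures that the vertex chosen below [x] is not [v1], so the walk never turns back. *)
Lemma extend_to_lasso a d : forall v1 v2 r x, x \in sphere a d -> e v1 x -> x != v2 ->
  (exists2 j, (d <= j)%N & v1 \in sphere a j) ->
  path e v1 (v2 :: r) -> uniq (v1 :: v2 :: r) -> last v2 r = a ->
  exists2 s, lasso_seq a s & (size s <= (size r).+2 + d)%N.
Proof.
elim: d => [|d IH] v1 v2 r x xS v1x xv2 [j dj v1j] pr ur lr.
  exists (v1 :: v2 :: r); last by rewrite addn0.
  rewrite /lasso_seq pr ur /= lr eqxx /=; apply/hasP; exists x => //.
  move: xS; rewrite inE => /eqP xa; have := mem_last v2 r; rewrite lr -xa inE.
  by rewrite (negbTE xv2).
case: (boolP (x \in r)) => xr.
  exists (v1 :: v2 :: r); last exact: leq_addr.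
  by rewrite /lasso_seq pr ur /= lr eqxx /=; apply/hasP; exists x.
have [z zS zx] := sphere_pred xS.
have [||||||s ls ss] := IH x v1 (v2 :: r) z zS.
- by rewrite e_sym.
- apply/eqP => zv1; have v1d : v1 \in sphere a d by rewrite -zv1.
  by move: dj; rewrite (sphere_disjoint v1j v1d) ltnn.
- by exists d.+1.
- by rewrite /= e_sym v1x.
- rewrite cons_uniq ur andbT !inE negb_or negb_or xv2 xr !andbT.
  by apply: contraTneq v1x => ->; rewrite e_irr.
- by [].
by exists s => //; move: ss => /=; rewrite addnS.
Qed.

(** A second edge from [y] into the ball, besides the first edge of a geodesic to [a], would close a
    lasso: [y] and its geodesic contribute at most L + 1 vertices and the descent from the second
    neighbour at most L. Two parents and edges inside a sphere are excluded together. *)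
Lemma tree_ball a (L : nat) :
  (forall s, (size s <= L.*2.+1)%N -> ~~ lasso_seq a s) ->
  forall i y z z', (i <= L)%N -> y \in sphere a i ->
  z \in ball a i -> z' \in ball a i -> e y z -> e y z' -> z = z'.
Proof.
move=> nol [|i] y z z' iL yS zb zb' yz yz'.
  by move: zb zb'; rewrite !inE => /eqP -> /eqP ->.
apply/eqP/negP => /negP zz'.
have [s [ps us ls ss sb]] := geodesic yS.
case: s ps us ls ss sb => // z1 r ps us ls ss sb.
have [t tb [yt tz1]] : exists2 t, t \in ball a i.+1 & e y t /\ t != z1.
  case: (eqVneq z z1) => [zz1|]; last by exists z.
  by exists z' => //; rewrite -zz1 eq_sym.
have [d di tS] := ball_sphere tb.
have [|s' l' s's] := extend_to_lasso tS yt tz1 _ ps us ls.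
- by exists i.+1.
suff /nol : (size s' <= L.*2.+1)%N by rewrite l'.
apply: leq_trans s's _; move: ss di iL => -[->] h1 h2.
by move: h1 h2; clear; lia.
Qed.

Local Arguments sphere : simpl never.

Section Spread.
Variables (R : realType) (a : V) (L dl : nat).
Hypothesis dl3 : (3 <= dl)%N.
Hypothesis nolasso : forall s, (size s <= L.*2.+1)%N -> ~~ lasso_seq a s.

Let dg x := #|[set y | e x y]|.
Hypothesis dg_ge : forall x, (dl <= dg x)%N.

Let kids i x := [set y | e x y && (y \in sphere a i.+1)].
Let c x y : R := if e x y then 1 / (minn (dg x) (dg y))%:R else 0.
Let q : R := (dl.-1)%:R.

Fixpoint spread (i : nat) : V -> R :=
  if i is j.+1 then
    fun y => \sum_x spread j x / #|kids j x|%:R * (y \in kids j x)%:R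
  else fun y => (y == a)%:R.

(** By [tree_ball] the only neighbour of [x] that is not a child is its parent, and the root has
    none. *)
Lemma card_kids i x : (i < L)%N -> x \in sphere a i ->
  #|kids i x| = (dg x - (0 < i))%N.
Proof.
move=> iL xS.
have E : kids i x = [set y | e x y] :\: ball a i.
  apply/setP => y; rewrite in_setD !inE andbC; case xy: (e x y); rewrite ?andbF // !andbT.
  have := ball_edge (subsetP (sphere_ball a i) x xS) xy.
  by rewrite /= !inE => ->; rewrite andbT.
rewrite E cardsD; congr subn.
case: i iL xS {E} => [|i] iL xS.
  apply/eqP; rewrite cards_eq0; apply/eqP/setP => y; rewrite !inE.
  by move: xS; rewrite inE => /eqP ->; case: eqP => [->|_]; rewrite ?e_irr ?andbF.
have [z zS zx] := sphere_pred xS.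
apply/eqP/cards1P; exists z; apply/setP => y; rewrite in_setI in_set1 in_set.
apply/andP/eqP => [[xy yb]|->].
  apply: (@tree_ball a L nolasso i.+1 x) => //; first exact: ltnW.
    exact: (subsetP (ball_leq a (leqnSn i))) (subsetP (sphere_ball a i) _ zS).
  by rewrite e_sym.
rewrite e_sym zx; split=> //.
exact: (subsetP (ball_leq a (leqnSn i))) (subsetP (sphere_ball a i) _ zS).
Qed.

Lemma kids_gt0 i x : (i < L)%N -> x \in sphere a i -> (0 < #|kids i x|)%N.
Proof. by move=> iL xS; rewrite card_kids //; have := dg_ge x; case: (0 < i)%N; lia. Qed.

Lemma spread_ge0 i x : 0 <= spread i x.
Proof.
elim: i x => [|i IH] x /=; first by rewrite ler0n.
by apply: sumr_ge0 => y _; rewrite mulr_ge0 ?ler0n // divr_ge0.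
Qed.

Lemma spread_supp i x : x \notin sphere a i -> spread i x = 0.
Proof.
case: i => [|i] /=; first by rewrite inE => /negbTE ->.
move=> xS; rewrite big1 // => y _; rewrite [x \in _]inE (negbTE xS) andbF mulr0 //.
Qed.

Lemma spread_sum i : (i <= L)%N -> \sum_x spread i x = 1.
Proof.
elim: i => [|i IH] iL /=.
  by rewrite (bigD1 a) //= eqxx big1 ?addr0 // => x /negbTE ->.
rewrite exchange_big /= -[in RHS](IH (ltnW iL)); apply: eq_bigr => x _.
rewrite -mulr_sumr -natr_sum -sum1_card.
have -> : (\sum_y (y \in kids i x) = \sum_(y in kids i x) 1)%N.
  by rewrite [RHS]big_mkcond; apply: eq_bigr => y _; case: ifP.
case: (boolP (x \in sphere a i)) => xS; last by rewrite spread_supp // !mul0r.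
rewrite mulfVK // sum1_card pnatr_eq0 -lt0n; exact: kids_gt0.
Qed.

Lemma q_gt1 : 1 < q.
Proof. by rewrite /q ltr1n; lia. Qed.

Lemma spread_parent i x y : (i < L)%N -> x \in sphere a i -> y \in kids i x ->
  spread i.+1 y = spread i x / #|kids i x|%:R.
Proof.
move=> iL xS yk; rewrite /= (bigD1 x) //= yk mulr1 big1 ?addr0 // => z zx.
case: (boolP (y \in kids i z)) => [yz|]; last by rewrite mulr0.
case: (boolP (z \in sphere a i)) => zS; last by rewrite spread_supp // !mul0r.
move: yk yz; rewrite in_set => /andP[xy yS]; rewrite in_set => /andP[zy _].
have bb u : u \in sphere a i -> u \in ball a i.+1.
  by move=> uS; apply: (subsetP (ball_leq a (leqnSn i))) (subsetP (sphere_ball a i) _ uS).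
case/eqP: zx; apply: (@tree_ball a L nolasso i.+1 y) => //; try exact: bb.

- by rewrite e_sym.
- by rewrite e_sym.
Qed.

Lemma spread_kid i y : y \in sphere a i.+1 ->
  exists2 x, x \in sphere a i & y \in kids i x.
Proof.
move=> yS; have [x xS xy] := sphere_pred yS.
by exists x => //; rewrite in_set xy.
Qed.

(** This invariant is what makes unequal degrees harmless; it is an equality in a regular tree. A
    child x of z receives at most [q ^- i] / [dg z] <= [q ^- i] / [dl], and dg x / dl <= (dg x - 1)
    / q amounts to dl <= dg x. *)
Lemma spread_dg i x : (i < L)%N ->
  spread i x * (dg x)%:R <= q ^- i * #|kids i x|%:R.
Proof.
have q1 := q_gt1.
have q0 : 0 < q by lra.
have out j z : z \notin sphere a j ->
    spread j z * (dg z)%:R <= q ^- j * #|kids j z|%:R.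
  by move=> zS; rewrite spread_supp // mul0r mulr_ge0 // invr_ge0 exprn_ge0 // ltW.
elim: i x => [|i IH] x iL.
  case: (boolP (x \in sphere a 0)) => [xS|/out //].
  by rewrite expr0 invr1 mul1r card_kids // subn0 ler_piMl //= lern1 leq_b1.
case: (boolP (x \in sphere a i.+1)) => [xS|/out //].
have [z zS xk] := spread_kid xS.
have iL' := ltnW iL.
have kz : 0 < #|kids i z|%:R :> R by rewrite ltr0n kids_gt0.
have dz : 0 < (dg z)%:R :> R by rewrite ltr0n; have := dg_ge z; lia.
rewrite (spread_parent iL' zS xk).
have h : spread i z / #|kids i z|%:R <= q ^- i / dl%:R.
  rewrite ler_pdivrMr // mulrAC ler_pdivlMr ?ltr0n; last by lia.
  apply: le_trans (IH z iL'); rewrite ler_wpM2l ?spread_ge0 // ler_nat //.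
apply: (@le_trans _ _ (q ^- i / dl%:R * (dg x)%:R)); first by rewrite ler_wpM2r.
rewrite exprSr invfM -!mulrA ler_pM2l ?invr_gt0 ?exprn_gt0 // card_kids //=.
rewrite ler_pdivrMl ?ltr0n; last by lia.
rewrite mulrCA ler_pdivlMl // /q -!natrM ler_nat subn1.
have := dg_ge x; case: (dg x) => [|k]; first by lia.
by case: (dl) dl3 => // m _ mk /=; rewrite ltnS in mk; rewrite !(mulnS, mulSn); lia.
Qed.

Lemma spread_sq i : (i < L)%N -> \sum_y spread i.+1 y ^+ 2 <= (2 ^+ i.+1)^-1.
Proof.
move=> iL.
have h y : spread i.+1 y <= (2 ^+ i.+1)^-1.
  have q1 := q_gt1.
  case: (boolP (y \in sphere a i.+1)) => yS; last first.
    by rewrite spread_supp // invr_ge0 exprn_ge0.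
  have [z zS yk] := spread_kid yS.
  have kz : 0 < #|kids i z|%:R :> R by rewrite ltr0n kids_gt0.
  rewrite (spread_parent iL zS yk) ler_pdivrMr //.
  have dz : 2 <= (dg z)%:R :> R by rewrite ler_nat; have := dg_ge z; lia.
  apply: (@le_trans _ _ (spread i z * (dg z)%:R / 2)).
    by rewrite -mulrA ler_peMr ?spread_ge0 // ler_pdivlMr // mul1r.
  rewrite ler_pdivrMr //; apply: le_trans (spread_dg z iL) _.
  rewrite mulrAC ler_wpM2r // exprS invfM mulrAC mulVf // mul1r.
  rewrite lef_pV2 ?posrE ?exprn_gt0 //; try lra.
  apply: lerXn2r; rewrite ?nnegrE //; try lra.
  by rewrite /q ler_nat; lia.
apply: (@le_trans _ _ (\sum_y spread i.+1 y * (2 ^+ i.+1)^-1)).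
  by apply: ler_sum => y _; rewrite expr2 ler_wpM2l ?spread_ge0.
by rewrite -mulr_suml spread_sum // mul1r.
Qed.

Let shell g i : R := \sum_x \sum_y
  ((x \in sphere a i) && (y \in sphere a i.+1))%:R * (c x y * (g x - g y) ^+ 2).

(** Cauchy-Schwarz over the edges of one layer, with flow [m] and resistances [r]. As
    [r x y <= dg x], the energy leaving x is at most the square of [spread i x] times [dg x] divided
    by the number of children, hence at most [q ^- i * spread i x] by [spread_dg]; the masses add up
    to 1. *)
Lemma spread_step (g : V -> R) i : (i < L)%N ->
  (\sum_x spread i x * g x - \sum_y spread i.+1 y * g y) ^+ 2 <=
  q ^- i * shell g i.
Proof.
move=> iL.
pose m x y : R := spread i x / #|kids i x|%:R * (y \in kids i x)%:R.
have dg0 x : 0 < (dg x)%:R :> R by rewrite ltr0n; have := dg_ge x; lia.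
pose r x y : R := (minn (dg x) (dg y))%:R.
have r0 x y : 0 < r x y.
  by rewrite /r ltr0n; have := dg_ge x; have := dg_ge y; lia.
have -> : \sum_x spread i x * g x - \sum_y spread i.+1 y * g y =
    \sum_p (m p.1 p.2 * Num.sqrt (r p.1 p.2)) *
     (((p.1 \in sphere a i) && (p.2 \in kids i p.1))%:R
        * (g p.1 - g p.2) / Num.sqrt (r p.1 p.2)).
  rewrite -(pair_big predT predT (fun x y => (m x y * Num.sqrt (r x y)) *
     (((x \in sphere a i) && (y \in kids i x))%:R
        * (g x - g y) / Num.sqrt (r x y)))) /=.
  have -> : \sum_y (\sum_x m x y) * g y = \sum_x \sum_y m x y * g y.
    by rewrite exchange_big; apply: eq_bigr => y _; rewrite mulr_suml.
  rewrite -sumrB; apply: eq_bigr => x _.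
  have -> : spread i x = \sum_y m x y.
    rewrite /m -mulr_sumr -natr_sum.
    have -> : (\sum_y (y \in kids i x) = #|kids i x|)%N.
      by rewrite -sum1_card [RHS]big_mkcond; apply: eq_bigr => y _; case: ifP.
    case: (boolP (x \in sphere a i)) => xS; last by rewrite spread_supp // !mul0r.
    rewrite mulfVK // pnatr_eq0 -lt0n; exact: kids_gt0.
  rewrite mulr_suml -sumrB; apply: eq_bigr => y _.
  have s0 : Num.sqrt (r x y) != 0 by rewrite gt_eqF // sqrtr_gt0.
  case: (boolP (x \in sphere a i)) => xS; last first.
    by rewrite /m spread_supp // !mul0r subrr.
  case: (boolP (y \in kids i x)) => yk; last first.
    by rewrite /m (negbTE yk) !mulr0 !mul0r subrr.
  by rewrite mul1r; field.
apply: le_trans (cauchy_schwarz_sum _ _) _.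
apply: ler_pM.
- by apply: sumr_ge0 => *; exact: sqr_ge0.
- by apply: sumr_ge0 => *; exact: sqr_ge0.
- rewrite -(pair_big predT predT (fun x y => (m x y * Num.sqrt (r x y)) ^+ 2)) /=.
  apply: (@le_trans _ _ (\sum_x spread i x * q ^- i)); last first.
    by rewrite -mulr_suml spread_sum ?mul1r // ltnW.
  apply: ler_sum => x _.
  case: (boolP (x \in sphere a i)) => xS; last first.
    by rewrite spread_supp // mul0r big1 // => y _; rewrite /m spread_supp // !mul0r expr0n.
  have kx : 0 < #|kids i x|%:R :> R by rewrite ltr0n kids_gt0.
  apply: (@le_trans _ _ (\sum_y (spread i x / #|kids i x|%:R) ^+ 2 * (dg x)%:R
      * (y \in kids i x)%:R)).
    apply: ler_sum => y _; rewrite exprMn sqr_sqrtr; last exact: ltW.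
    rewrite /m; case: (y \in kids i x); rewrite ?mulr0 ?mulr1 ?expr0n ?mul0r //.
    by rewrite ler_wpM2l ?sqr_ge0 // /r ler_nat geq_minl.
  rewrite -mulr_sumr -natr_sum.
  have -> : (\sum_y (y \in kids i x) = #|kids i x|)%N.
    by rewrite -sum1_card [RHS]big_mkcond; apply: eq_bigr => y _; case: ifP.
  have -> : (spread i x / #|kids i x|%:R) ^+ 2 * (dg x)%:R * #|kids i x|%:R
     = spread i x * (spread i x * (dg x)%:R / #|kids i x|%:R).
    by field; rewrite gt_eqF.
  by rewrite ler_wpM2l ?spread_ge0 // ler_pdivrMr // spread_dg.
rewrite -(pair_big predT predT (fun x y => (((x \in sphere a i) && (y \in kids i x))%:R
        * (g x - g y) / Num.sqrt (r x y)) ^+ 2)) /=.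
apply: ler_sum => x _; apply: ler_sum => y _.
rewrite /kids in_set /c; case: (boolP (x \in sphere a i)) => xS; last first.
  by rewrite /= !mul0r expr0n.
case: (e x y); rewrite /= ?mul0r ?mulr0 ?expr0n //.
case: (boolP (y \in _)) => _; rewrite ?mul0r ?mulr0 ?expr0n // !mul1r.
rewrite expr_div_n sqr_sqrtr; last exact: ltW.
by rewrite mulrC.
Qed.

Lemma shell_sum g : (\sum_(i < L) shell g i) *+ 2 <= dirichlet c g.
Proof.
have c_sym x y : c x y = c y x by rewrite /c e_sym minnC.
have c_ge0 x y : 0 <= c x y by rewrite /c; case: ifP => // _; rewrite divr_ge0.
have sh i : shell g i = \sum_x \sum_y
  ((y \in sphere a i) && (x \in sphere a i.+1))%:R * (c x y * (g x - g y) ^+ 2).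
  rewrite /shell exchange_big; apply: eq_bigr => x _; apply: eq_bigr => y _.
  by rewrite c_sym -sqrrN opprB.
rewrite mulr2n {2}(eq_bigr _ (fun i _ => sh (nat_of_ord i))) -big_split /=.
rewrite /shell.
under eq_bigr => i _ do (rewrite -big_split /=; under eq_bigr => x _ do rewrite -big_split /=).
rewrite exchange_big /=; apply: ler_sum => x _.
rewrite exchange_big /=; apply: ler_sum => y _.
under eq_bigr => i _ do rewrite -mulrDl.
rewrite -mulr_suml -[leRHS]mul1r; apply: ler_wpM2r.
  by rewrite mulr_ge0 // sqr_ge0.
case: (pickP [pred i : 'I_L | ((x \in sphere a i) && (y \in sphere a i.+1)) ||
  ((y \in sphere a i) && (x \in sphere a i.+1))]) => [i /= hi|no]; last first.
  rewrite big1 // => i _; move: (no i) => /= /negbT.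
  by rewrite negb_or => /andP[/negbTE -> /negbTE ->]; rewrite addr0.
rewrite (bigD1 i) //= big1 ?addr0.
  case/orP: hi => /andP[h1 h2]; rewrite h1 h2 /=.
    case: (boolP (_ \in _)) => h3; rewrite ?addr0 //=.
    by have := sphere_disjoint h2 h3 => /eqP; rewrite eqn_leq ltnn.
  case: (boolP (_ \in _)) => h3; rewrite ?add0r //=.
  by have := sphere_disjoint h2 h3 => /eqP; rewrite eqn_leq ltnn.
move=> j ji; have nat_ji : nat_of_ord j <> i by move/val_inj => ij; rewrite ij eqxx in ji.

case/orP: hi => /andP[h1 h2].
  case: (boolP (x \in sphere a j)) => hx; first by case: nat_ji; exact: (sphere_disjoint hx h1).
  case: (boolP (x \in sphere a j.+1)) => hx'; rewrite ?andbF ?addr0 //= andbT.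
  case: (boolP (y \in sphere a j)) => hy; rewrite ?addr0 //.
  by have := sphere_disjoint h1 hx'; have := sphere_disjoint h2 hy; lia.
case: (boolP (y \in sphere a j)) => hx; first by case: nat_ji; exact: (sphere_disjoint hx h1).
case: (boolP (y \in sphere a j.+1)) => hx'; rewrite ?andbF ?addr0 //= andbT.
case: (boolP (x \in sphere a j)) => hy; rewrite ?addr0 //.
by have := sphere_disjoint h1 hx'; have := sphere_disjoint h2 hy; lia.
Qed.

Lemma shell_ge0 g i : 0 <= shell g i.
Proof.
apply: sumr_ge0 => x _; apply: sumr_ge0 => y _; rewrite mulr_ge0 // mulr_ge0 ?sqr_ge0 //.
by rewrite /c; case: ifP => // _; rewrite divr_ge0.
Qed.

(** The layers act as resistors in series: x^2 <= r s and y^2 <= t u imply (x + y)^2 <= (r + t)(s +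
    u), the cross term being handled by the arithmetic-geometric mean inequality. *)
Lemma spread_resistance (g : V -> R) i : (i <= L)%N ->
  (g a - \sum_x spread i x * g x) ^+ 2 <=
  (\sum_(j < i) q ^- j) * (\sum_(j < i) shell g j).
Proof.
have q1 := q_gt1.
elim: i => [|i IH] iL.
  rewrite !big_ord0 mul0r (bigD1 a) //= eqxx mul1r big1 ?addr0 ?subrr ?expr0n //.
  by move=> x /negbTE ->; rewrite mul0r.
rewrite !big_ord_recr.
have := IH (ltnW iL); have := spread_step g iL.
set A := \sum_x spread i x * g x; set A' := \sum_x spread i.+1 x * g x.
set r := \sum_(j < i) _; set s := \sum_(j < i) _; move=> h1 h2.
have r0 : 0 <= r by apply: sumr_ge0 => j _; rewrite invr_ge0 exprn_ge0 //; lra.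
have s0 : 0 <= s by apply: sumr_ge0 => j _; exact: shell_ge0.
have r1 : 0 <= q ^- i by rewrite invr_ge0 exprn_ge0 //; lra.
have s1 := shell_ge0 g i.
have -> : g a - A' = (g a - A) + (A - A') by ring.
move: (g a - A) (A - A') (q ^- i) (shell g i) h1 h2 r1 s1 => x y t u h1 h2 t0 u0.
rewrite [leRHS]/=.
have cross : (x * y *+ 2) <= r * u + t * s.
  apply: le_trans (ler_norm _) _; apply: ler_sqr_norm.
    by rewrite addr_ge0 // mulr_ge0.
  have : (x * y) ^+ 2 <= (r * s) * (t * u).
    by rewrite exprMn ler_pM // sqr_ge0.
  by have := sqr_ge0 (r * u - t * s); rewrite !expr2; nra.
by rewrite expr2; nra.
Qed.

(** The layer resistances [q ^- j] form a geometric series with sum at most q / (q - 1), which is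
    (delta - 1) / (delta - 2) for q = delta - 1. The factor 2 in [shell_sum] matches the one in
    [spread_source]. *)
Lemma spread_source_lasso_free : (0 < L)%N ->
  spread_source c (q / (q - 1)) (2 ^+ L)^-1 a.
Proof.
have q1 := q_gt1.
move=> L0; exists (spread L); split.
- exact: spread_sum.
- by case: (L) L0 (@spread_sq L.-1) => // l _; apply.
move=> g.
have h := spread_resistance g (leqnn L).
have geo i : \sum_(j < i) q ^- j <= q / (q - 1).
  have E : \sum_(j < i) q ^- j = (q - q ^- i * q) / (q - 1).
    elim: i => [|i IH]; first by rewrite big_ord0 expr0 invr1 mul1r subrr mul0r.
    rewrite big_ord_recr /= IH exprS invfM; field.
    by rewrite expf_neq0 ?subr_eq0 ?gt_eqF //; lra.
  rewrite E ler_pM2r ?invr_gt0 ?subr_gt0 // gerBl mulr_ge0 ?invr_ge0 ?exprn_ge0 //; lra.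
apply: (@le_trans _ _ ((q / (q - 1)) * ((\sum_(j < L) shell g j) *+ 2))).
  rewrite mulrnAr lerMn2r /=; apply: le_trans h _; apply: ler_wpM2r => //.
  by apply: sumr_ge0 => j _; exact: shell_ge0.
apply: ler_wpM2l; last exact: shell_sum.
by rewrite divr_ge0 //; lra.
Qed.

End Spread.
End Layers.

(** * Switchings and local structure *)

Section DoubleCounting.
Variables (T Q : finType) (A B : {set T}) (ok rev : T -> pred Q) (sw : T -> Q -> T).

(** The image of (G, t) keeps the label t, so a switching has to be injective only for a fixed
    label, and reversals are counted by the labels admissible for the switched graph. *)
Lemma double_count (al be : nat) :
  (forall G, G \in A -> (al <= \sum_t ok G t)%N) ->
  (forall G t, G \in A -> ok G t -> sw G t \in B /\ rev (sw G t) t) ->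
  (forall t G1 G2, G1 \in A -> G2 \in A -> ok G1 t -> ok G2 t ->
     sw G1 t = sw G2 t -> G1 = G2) ->
  (forall G, G \in B -> (\sum_t rev G t <= be)%N) ->
  (#|A| * al <= #|B| * be)%N.
Proof.
move=> hal hsw hinj hbe.
pose P := [set p : T * Q | (p.1 \in A) && ok p.1 p.2].
pose P' := [set p : T * Q | (p.1 \in B) && rev p.1 p.2].
have cardP (C : {set T}) (r : T -> pred Q) :
    #|[set p : T * Q | (p.1 \in C) && r p.1 p.2]| = (\sum_(G in C) \sum_t r G t)%N.
  rewrite -sum1_card (eq_bigl (fun p => (p.1 \in C) && r p.1 p.2)); last first.
    by move=> p; rewrite inE.
  rewrite -(pair_big_dep (mem C) (fun G t => r G t) (fun _ _ => 1%N)) /=.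
  by apply: eq_bigr => G _; rewrite [LHS]big_mkcond; apply: eq_bigr => t _; case: (r G t).
have le1 : (#|A| * al <= #|P|)%N.
  by rewrite cardP -sum_nat_const; apply: leq_sum => G; apply: hal.
have le2 : (#|P'| <= #|B| * be)%N.
  by rewrite cardP -sum_nat_const; apply: leq_sum => G; apply: hbe.
apply: leq_trans le1 _; apply: leq_trans le2.
pose f (p : T * Q) := (sw p.1 p.2, p.2).
have finj : {in P &, injective f}.
  move=> [G1 t1] [G2 t2]; rewrite !inE /= => /andP[A1 o1] /andP[A2 o2] [es et].
  by subst t2; rewrite (hinj t1 G1 G2).
rewrite -(card_in_imset finj); apply: subset_leq_card; apply/subsetP => p.
case/imsetP => -[G t]; rewrite inE /= => /andP[GA Gt] ->.
by have [h1 h2] := hsw G t GA Gt; rewrite inE /= h1 h2.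
Qed.

End DoubleCounting.

Lemma eq_set2 (V : finType) (a b x y : V) :
  ([set a; b] == [set x; y]) = (a == x) && (b == y) || (a == y) && (b == x).
Proof.
apply/eqP/idP => [/setP E|/orP[/andP[/eqP-> /eqP->]|/andP[/eqP-> /eqP->]]] //.
  have := E a; have := E b; have := E x; have := E y; rewrite !inE !eqxx ?orbT /=.
  rewrite ![x == _]eq_sym ![y == _]eq_sym.
  by case: (a == x); case: (b == x); case: (a == y); case: (b == y).
exact: setUC.
Qed.

Lemma card_pairs_in (V : finType) (es : seq {set V}) :
  (\sum_x \sum_y ([set x; y] \in es) <= 2 * size es)%N.
Proof.
have one (e : {set V}) : (\sum_x \sum_y ([set x; y] == e) <= 2)%N.
  case: (pickP [pred p : V * V | [set p.1; p.2] == e]) => [[a b] /= /eqP <-|no]; last first.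
    by rewrite big1 // => x _; rewrite big1 // => y _; have /= -> := no (x, y).
  apply: (@leq_trans (\sum_x \sum_y (((x == a) && (y == b)) + ((x == b) && (y == a))))%N).
    apply: leq_sum => x _; apply: leq_sum => y _; rewrite eq_set2.
    by case: (_ && _); case: (_ && _).
  under eq_bigr => x _ do rewrite big_split /=.
  have pt c d : (\sum_x \sum_y ((x == c) && (y == d)) = 1)%N.
    rewrite (bigD1 c) //= (bigD1 d) //= !eqxx /= !big1 // => x /negbTE xc.
      by rewrite big1 // => y _; rewrite xc.
    by rewrite xc.
  by rewrite big_split /= !pt.
elim: es => [|e es IH]; first by rewrite big1 // => x _; rewrite big1.
apply: (@leq_trans (\sum_x \sum_y (([set x; y] == e) + ([set x; y] \in es)))%N).
  apply: leq_sum => x _; apply: leq_sum => y _; rewrite inE.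
  by case: (_ == _); case: (_ \in _).
under eq_bigr => x _ do rewrite big_split /=.
by rewrite big_split /= mulnS leq_add.
Qed.

(** * Switching two edges of a simple graph *)

Section Switch.
Variable V : finType.
Implicit Types (G : {set {set V}}) (a b u v x y : V).

Lemma adj_sym G : symmetric (adj G).
Proof. by move=> u v; rewrite /adj setUC. Qed.

Lemma adj_irr G : simple_graph G -> irreflexive (adj G).
Proof.
move=> /forall_inP sG u; apply/negP => /sG; by rewrite setUid cards1.
Qed.

Lemma adj_neq G u v : simple_graph G -> adj G u v -> u != v.
Proof. by move=> sG; apply: contraTneq => ->; rewrite adj_irr. Qed.

Definition switch G u v x y : {set {set V}} :=
  [set e | (e == [set u; x]) || (e == [set v; y]) ||
     (e \in G) && (e != [set u; v]) && (e != [set x; y])].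

Definition switchable G u v x y : bool :=
  [&& adj G u v, adj G x y, ~~ adj G u x, ~~ adj G v y, u != x & v != y].

Lemma switchable_distinct G u v x y : simple_graph G -> switchable G u v x y ->
  [/\ u != v, x != y, u != y & v != x].
Proof.
move=> sG /and5P[uv xy nux nvy /andP[ux vy]]; split.
- exact: adj_neq uv.
- exact: adj_neq xy.
- by apply: contraNneq nvy => <-; rewrite adj_sym.
- by apply: contraNneq nux => <-.
Qed.

Lemma switch_swap G u v x y : switch G u v x y = switch G v u y x.
Proof.
apply/setP => e; rewrite !inE [[set u; v]]setUC [[set x; y]]setUC.
by congr (_ || _); rewrite orbC.
Qed.

Lemma switch_flip G u v x y : switch G u v x y = switch G x y u v.
Proof.
apply/setP => e; rewrite !inE [[set u; x]]setUC [[set v; y]]setUC -!andbA.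
by congr (_ || (_ && _)); rewrite andbC.
Qed.

Lemma switchable_swap G u v x y : switchable G u v x y = switchable G v u y x.
Proof.
rewrite /switchable ![adj G u v]adj_sym ![adj G x y]adj_sym.
by congr [&& _, _ & _]; do ![case: (_ == _) | case: (adj _ _ _)].
Qed.

Lemma switchable_flip G u v x y : switchable G u v x y = switchable G x y u v.
Proof.
rewrite /switchable ![adj G u x]adj_sym ![adj G v y]adj_sym [x == u]eq_sym [y == v]eq_sym.
by case: (adj G u v); case: (adj G x y).
Qed.

Lemma switch_simple G u v x y : simple_graph G -> switchable G u v x y ->
  simple_graph (switch G u v x y).
Proof.
move=> /forall_inP sG /and5P[_ _ _ _ /andP[ux vy]]; apply/forall_inP => e.
rewrite inE => /orP[/orP[/eqP ->|/eqP ->]|/andP[/andP[/sG //]]].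
  by rewrite cards2 ux.
by rewrite cards2 vy.
Qed.

Lemma switch_switch G u v x y : simple_graph G -> switchable G u v x y ->
  switch (switch G u v x y) u x v y = G.
Proof.
move=> sG sw; have [uv xy uy vx] := switchable_distinct sG sw.
move/and5P: sw => [auv axy nux nvy /andP[ux vy]].
apply/setP => e; rewrite !inE.
case: (eqVneq e [set u; v]) => [->|euv] /=; first exact: esym auv.
case: (eqVneq e [set x; y]) => [->|exy] /=; first exact: esym axy.
case: (eqVneq e [set u; x]) => [->|eux] /=.
  by rewrite ?andbF; apply/esym/negbTE.
case: (eqVneq e [set v; y]) => [->|evy] /=; first by apply/esym/negbTE.
by rewrite !andbT.
Qed.

Lemma switch_vdeg1 G u v x y : simple_graph G -> switchable G u v x y ->
  vdeg (switch G u v x y) u = vdeg G u.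
Proof.
move=> sG sw; have [uv xy uy vx] := switchable_distinct sG sw.
move/and5P: sw => [auv axy nux nvy /andP[ux vy]].
rewrite /vdeg.
have -> : [set b | adj (switch G u v x y) u b] = x |: ([set b | adj G u b] :\ v).
  apply/setP => b; rewrite !inE /adj !inE !eq_set2 eqxx (negbTE uv) (negbTE uy) (negbTE ux) /=.
  rewrite !orbF andbT /adj [(b != v) && _]andbC.
  case: (eqVneq b x) => //= bx.
rewrite cardsU1 !inE negb_and negbK nux orbT add1n.
by rewrite [RHS](cardsD1 v) inE auv.
Qed.

Lemma switch_vdeg G u v x y a : simple_graph G -> switchable G u v x y ->
  vdeg (switch G u v x y) a = vdeg G a.
Proof.
move=> sG sw.
case: (eqVneq a u) => [->|au]; first exact: switch_vdeg1.
case: (eqVneq a v) => [->|av].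
  by rewrite switch_swap switch_vdeg1 // -switchable_swap.
case: (eqVneq a x) => [->|ax].
  by rewrite switch_flip switch_vdeg1 // -switchable_flip.
case: (eqVneq a y) => [->|ay].
  by rewrite switch_flip switch_swap switch_vdeg1 // -switchable_swap -switchable_flip.
rewrite /vdeg; congr #|pred_of_set _|; apply/setP => b.
rewrite !inE /adj !inE !eq_set2 (negbTE au) (negbTE av) (negbTE ax) (negbTE ay) /=.
by rewrite !andbT.
Qed.

Lemma adj_switch_new G u v x y : adj (switch G u v x y) u x /\ adj (switch G u v x y) v y.
Proof. by rewrite /adj !inE !eqxx orbT. Qed.

End Switch.

Section GraphsWith.
Variables (n : nat) (ds : 'I_n -> nat).
Local Notation V := 'I_n.
Implicit Types (G : {set {set V}}) (a b u v x y : V) (X : {set V}).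
Local Notation GS := (graphs_with ds).
Let Dl := max_deg ds.

Lemma graphs_with_simple G : G \in GS -> simple_graph G.
Proof. by rewrite inE => /andP[]. Qed.

Lemma graphs_with_vdeg G u : G \in GS -> vdeg G u = ds u.
Proof. by rewrite inE => /andP[_ /forallP /(_ u) /eqP]. Qed.

Lemma switch_graphs_with G u v x y : G \in GS -> switchable G u v x y ->
  switch G u v x y \in GS.
Proof.
move=> GG sw; have sG := graphs_with_simple GG.
rewrite inE switch_simple //=; apply/forallP => a.
by rewrite switch_vdeg // (graphs_with_vdeg a GG).
Qed.

Lemma ds_max u : (ds u <= Dl)%N.
Proof. exact: (leq_bigmax u). Qed.

Lemma sum_adj G u : G \in GS -> (\sum_v adj G u v = ds u)%N.
Proof.
move=> GG; rewrite -(graphs_with_vdeg u GG) /vdeg -sum1_card.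
by rewrite [RHS]big_mkcond; apply: eq_bigr => v _; rewrite inE; case: (adj _ _ _).
Qed.

Lemma sum_adj_le G u : G \in GS -> (\sum_v adj G u v <= Dl)%N.
Proof. by move=> GG; rewrite sum_adj // ds_max. Qed.

Definition with_edges (es : seq {set V}) : {set {set {set V}}} :=
  [set G in GS | all (mem G) es].

(* Switching e with a random edge destroys e; the switched graph is recovered
   from the new neighbours of the two endpoints. *)
Lemma with_edges_cons u v (es : seq {set V}) :
  [set u; v] \notin es ->
  (n + 2 * size es + 4 * Dl ^ 2 <= \sum_i ds i)%N ->
  (#|with_edges ([set u; v] :: es)| * n <= #|with_edges es| * Dl ^ 2)%N.
Proof.
move=> ees hn.
pose ok G (t : V * V) := switchable G u v t.1 t.2 && ([set t.1; t.2] \notin es).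
pose rev G (t : V * V) := adj G u t.1 && adj G v t.2.
have hsw G t : G \in with_edges ([set u; v] :: es) -> ok G t ->
    switch G u v t.1 t.2 \in with_edges es /\ rev (switch G u v t.1 t.2) t.
  move=> + /andP[sw tes]; rewrite inE /= => /and3P[GG _ /allP hes]; split.
    rewrite inE switch_graphs_with //=; apply/allP => e ees'.
    have eG := hes e ees'; rewrite !inE -andbA; apply/orP; right.
    apply/and3P; split => //; first by apply: contraNneq ees => <-.
    by apply: contraNneq tes => <-.
  by have [h1 h2] := adj_switch_new G u v t.1 t.2; rewrite /rev h1 h2.
apply: (double_count (ok := ok) (rev := rev) (sw := fun G t => switch G u v t.1 t.2)) => //.
- move=> G; rewrite inE /= => /and3P[GG auv _].
  have sG := graphs_with_simple GG.
  (* Among the oriented edges (x, y), at most [2 * size es] lie in [es], at most [Dl] start at [u]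
     or end at [v] in each case, and at most [Dl ^ 2] start next to [u] or end next to [v] in each
     case. Since [Dl <= Dl ^ 2], at least [n] admissible ones remain. *)
  have h1 : (\sum_x \sum_y adj G x y = \sum_i ds i)%N.
    by apply: eq_bigr => x _; exact: sum_adj.
  have h2 := card_pairs_in es.
  have h3 : (\sum_x \sum_y (adj G x y && (u == x)) <= Dl)%N.
    rewrite (bigD1 u) //= [X in (_ + X)%N]big1 => [|x xu]; last first.
      by rewrite big1 // => y _; rewrite eq_sym (negbTE xu) andbF.
    rewrite addn0; apply: leq_trans (sum_adj_le u GG); apply: leq_sum => y _.
    by case: (adj _ _ _); rewrite //= leq_b1.
  have h4 : (\sum_x \sum_y (adj G x y && (v == y)) <= Dl)%N.
    rewrite exchange_big (bigD1 v) //= [X in (_ + X)%N]big1 => [|x xu]; last first.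
      by rewrite big1 // => y _; rewrite eq_sym (negbTE xu) andbF.
    rewrite addn0; apply: leq_trans (sum_adj_le v GG); apply: leq_sum => y _.
    by rewrite adj_sym; case: (adj _ _ _); rewrite //= leq_b1.
  have h5 : (\sum_x \sum_y (adj G x y && adj G u x) <= Dl ^ 2)%N.
    apply: (@leq_trans (\sum_x adj G u x * Dl)).
      apply: leq_sum => x _; case: (adj G u x); last first.
        by rewrite big1 // => y _; rewrite andbF.
      rewrite mul1n; apply: leq_trans (sum_adj_le x GG); apply: leq_sum => y _.
      by rewrite andbT.
    by rewrite -big_distrl /= expnS expn1 leq_mul2r sum_adj_le ?orbT.
  have h6 : (\sum_x \sum_y (adj G x y && adj G v y) <= Dl ^ 2)%N.
    rewrite exchange_big /=.
    apply: (@leq_trans (\sum_x adj G v x * Dl)).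
      apply: leq_sum => x _; case: (adj G v x); last first.
        by rewrite big1 // => y _; rewrite andbF.
      rewrite mul1n; apply: leq_trans (sum_adj_le x GG); apply: leq_sum => y _.
      by rewrite andbT adj_sym.
    by rewrite -big_distrl /= expnS expn1 leq_mul2r sum_adj_le ?orbT.
  have h7 : (\sum_x \sum_y adj G x y <= \sum_x \sum_y ok G (x, y)
     + \sum_x \sum_y ([set x; y] \in es)
     + \sum_x \sum_y (adj G x y && (u == x))
     + \sum_x \sum_y (adj G x y && (v == y))
     + \sum_x \sum_y (adj G x y && adj G u x)
     + \sum_x \sum_y (adj G x y && adj G v y))%N.
    rewrite -!big_split; apply: leq_sum => x _; rewrite -!big_split /=; apply: leq_sum => y _.
    rewrite /ok /switchable /= (auv : adj G u v).
    by case: (adj G x y) => //; case: (u == x); case: (v == y);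
       case: (adj G u x); case: (adj G v y); case: (_ \in es).
  rewrite -(pair_big predT predT (fun x y => ok G (x, y) : nat)) /=.
  have : (Dl <= Dl ^ 2)%N by rewrite expnS expn1; case: (Dl) => // k; rewrite leq_pmulr.
  have aux (S o b1 b2 b3 b4 b5 s D D2 N : nat) :
      (S <= o + b1 + b2 + b3 + b4 + b5 -> b1 <= 2 * s -> b2 <= D -> b3 <= D ->
       b4 <= D2 -> b5 <= D2 -> N + 2 * s + 4 * D2 <= S -> D <= D2 -> N <= o)%N by lia.
  by apply: (aux _ _ _ _ _ _ _ _ _ _ _ h7 h2 h3 h4 h5 h6); rewrite h1.
- move=> [x y] G1 G2; rewrite ![_ \in with_edges _]in_set /= => /andP[G1G _] /andP[G2G _] /andP[sw1 _] /andP[sw2 _] E.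
  rewrite -(switch_switch (graphs_with_simple G1G) sw1) E.
  by rewrite (switch_switch (graphs_with_simple G2G) sw2).
- move=> G; rewrite inE => /andP[GG _].
  rewrite -(pair_big predT predT (fun x y => rev G (x, y) : nat)) /rev /=.
  have -> : (\sum_x \sum_y (adj G u x && adj G v y) =
      (\sum_x adj G u x) * (\sum_y adj G v y))%N.
    rewrite big_distrl; apply: eq_bigr => x _ /=; rewrite big_distrr /=.
    by apply: eq_bigr => y _; rewrite mulnb.
  by rewrite expnS expn1 leq_mul // sum_adj_le.
Qed.

End GraphsWith.

(** * Expected number of vertices that start a short lasso *)

Fixpoint path_edges (V : finType) (v : V) (s : seq V) : seq {set V} :=
  if s is w :: s' then [set v; w] :: path_edges w s' else [::].

(** The first edge closes the lasso at [x], so that a lasso on j vertices has as many edges as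
    vertices. *)
Definition lasso_edges (V : finType) (s : seq V) (x : V) : seq {set V} :=
  if s is v :: s' then [set v; x] :: path_edges v s' else [::].

Lemma size_path_edges (V : finType) (v : V) s : size (path_edges v s) = size s.
Proof. by elim: s v => //= w s IH v; rewrite IH. Qed.

Lemma path_edges_sub (V : finType) (v u : V) s e :
  e \in path_edges v s -> u \in e -> u \in v :: s.
Proof.
elim: s v => //= w s IH v; rewrite inE => /orP[/eqP ->|/IH h].
  by rewrite !inE => /orP[->|->]; rewrite ?orbT.
by move=> /h us; rewrite inE us orbT.
Qed.

Lemma uniq_path_edges (V : finType) (v : V) s : uniq (v :: s) -> uniq (path_edges v s).
Proof.
elim: s v => //= w s IH v /andP[vws ws]; rewrite IH // andbT.
apply/negP => /path_edges_sub /(_ (set21 v w)) h.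
by rewrite h in vws.
Qed.

Lemma all_path_edges (V : finType) (G : {set {set V}}) (v : V) s :
  all (mem G) (path_edges v s) = path (adj G) v s.
Proof. by elim: s v => //= w s IH v; rewrite IH. Qed.

Lemma uniq_lasso_edges (V : finType) (v w x : V) s :
  uniq [:: v, w & s] -> x \in s -> uniq (lasso_edges [:: v, w & s] x).
Proof.
move=> us xs; rewrite /lasso_edges cons_uniq uniq_path_edges // andbT /=.
move: us; rewrite !cons_uniq !inE negb_or => /andP[/andP[vw vs] /andP[ws _]].
have vx : v != x by apply: contraNneq vs => ->.
apply/negP => /orP[|/path_edges_sub /(_ (set21 v x))].
  by rewrite eq_set2 eqxx (negbTE vw) /= orbF => /eqP xw; rewrite -xw xs in ws.
by rewrite inE (negbTE vw) (negbTE vs).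
Qed.

Section LassoCount.
Variables (n : nat) (ds : 'I_n -> nat).
Local Notation V := 'I_n.
Local Notation GS := (graphs_with ds).
Let Dl := max_deg ds.

(** The edges are imposed one at a time, each at the cost of a factor [Dl ^ 2 / n]. *)
Lemma card_with_edges (es : seq {set V}) :
  uniq es -> (forall e, e \in es -> exists u v, e = [set u; v]) ->
  (n + 2 * size es + 4 * Dl ^ 2 <= \sum_i ds i)%N ->
  (#|with_edges ds es| * n ^ size es <= #|GS| * (Dl ^ 2) ^ size es)%N.
Proof.
elim: es => [|e es IH] /= ues hes hn.
  rewrite !expn0 !muln1; apply: subset_leq_card; apply/subsetP => G.
  by rewrite inE => /andP[].
move: ues => /andP[ees ues].
have [u [v E]] : exists u v, e = [set u; v] by apply: hes; rewrite mem_head.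
rewrite E in ees *.
have {}hn : (n + 2 * size es + 4 * Dl ^ 2 <= \sum_i ds i)%N.
  by apply: leq_trans hn; rewrite leq_add2r leq_add2l leq_mul2l leqnSn.
have h1 : (#|with_edges ds ([set u; v] :: es)| * n <= #|with_edges ds es| * Dl ^ 2)%N.
  exact: with_edges_cons.
have h2 : (#|with_edges ds es| * n ^ size es <= #|GS| * (Dl ^ 2) ^ size es)%N.
  by apply: IH => // e' e's; apply: hes; rewrite inE e's orbT.
rewrite (expnS n) (expnS (Dl ^ 2)) [leqLHS]mulnA [leqRHS]mulnCA.
apply: leq_trans (leq_mul h1 (leqnn _)) _.
by rewrite mulnAC mulnC leq_mul.
Qed.

Definition lasso_starts (G : {set {set V}}) (k : nat) : {set V} :=
  [set a | [exists j : 'I_k.+1, [exists s : j.-tuple V, lasso_seq (adj G) a s]]].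

(** The j distinct edges of a lasso on j vertices occur together with probability at most (Dl^2 /
    n)^j, which cancels the n^j choices of the vertices. What remains does not depend on n. *)
Lemma sum_lasso_starts (k : nat) :
  (n + 2 * k + 4 * Dl ^ 2 <= \sum_i ds i)%N -> (0 < Dl)%N -> (0 < n)%N ->
  (\sum_(G in GS) #|lasso_starts G k| <= #|GS| * (k.+1 * k * Dl ^ (2 * k)))%N.
Proof.
move=> hn D0 n0.
(* The repeated vertex is recorded by its index in [s], so it costs a factor j instead of n; the
   start of the lasso costs nothing, being the last entry of [s]. *)
pose conf (s : seq V) (i : nat) := 
  if s is [:: v, w & r] then uniq s && (nth v s i \in r) else false.
pose x0 : V := Ordinal n0.
have hB G : (#|lasso_starts G k| <=
    \sum_(j < k.+1) \sum_(s : j.-tuple V) \sum_(i < j)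
      (conf s i && all (mem G) (lasso_edges s (nth (head x0 s) s i))))%N.
  rewrite -sum1_card.
  apply: (@leq_trans (\sum_a \sum_(j < k.+1) \sum_(s : j.-tuple V) \sum_(i < j)
      ((conf s i && all (mem G) (lasso_edges s (nth (head x0 s) s i))) &&
       (last x0 s == a)))).
    rewrite [leqLHS]big_mkcond; apply: leq_sum => a _; case: ifP => //.
    rewrite inE => /existsP[j /existsP[s ls]].
    rewrite (bigD1 j) //= (bigD1 s) //=; apply: leq_trans (leq_addr _ _).
    apply: leq_trans (leq_addr _ _).
    move: ls; case: s => -[|v [|w r]] //= sj /and4P[/andP[vw pr] ur lr /hasP[x xr vx]].
    have ix : (index x [:: v, w & r] < j)%N.
      by move/eqP: sj => <-; rewrite index_mem !inE xr !orbT.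
    rewrite (bigD1 (Ordinal ix)) //=; apply: leq_trans (leq_addr _ _).
    rewrite -[(if v == x then _ else _)]/(index x [:: v, w & r]) lr andbT.
    have nx : nth v [:: v, w & r] (index x [:: v, w & r]) = x.
      by rewrite nth_index // !inE xr !orbT.
    rewrite /conf -/(nth v [:: v, w & r] (index x [:: v, w & r])) nx ur xr /=.
    by rewrite all_path_edges pr andbT lt0b; apply/andP; split; [exact: vx | exact: vw].
  rewrite exchange_big; apply: leq_sum => j _ /=.
  rewrite exchange_big; apply: leq_sum => s _ /=.
  rewrite exchange_big; apply: leq_sum => i _ /=.
  rewrite (bigD1 (last x0 s)) //= eqxx andbT big1 ?addn0 // => a.
  by rewrite eq_sym => /negbTE ->; rewrite andbF.
apply: (@leq_trans (\sum_(G in GS) \sum_(j < k.+1) \sum_(s : j.-tuple V) \sum_(i < j)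
      (conf s i && all (mem G) (lasso_edges s (nth (head x0 s) s i))))).
  by apply: leq_sum => G _; apply: hB.
rewrite exchange_big /=.
apply: (@leq_trans (\sum_(j < k.+1) #|GS| * (k * Dl ^ (2 * k)))%N); last first.
  by rewrite sum_nat_const card_ord mulnCA -(mulnA k.+1).
apply: leq_sum => j _; rewrite exchange_big /=.
have jk : (j <= k)%N by rewrite -ltnS.
rewrite -(leq_pmul2r (_ : 0 < n ^ j)%N); last by rewrite expn_gt0 n0.
have one (s : j.-tuple V) (i : 'I_j) : (\sum_(G in GS)
   (conf s i && all (mem G) (lasso_edges s (nth (head x0 s) s i))) * n ^ j <=
   #|GS| * Dl ^ (2 * k))%N.
  rewrite -big_distrl /=.
  case: (boolP (conf s i)) => /= cs; last by rewrite big1.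
  have -> : (\sum_(G in GS) all (mem G) (lasso_edges s (nth (head x0 s) s i)) =
      #|with_edges ds (lasso_edges s (nth (head x0 s) s i))|)%N.
    rewrite -sum1_card big_mkcond [RHS]big_mkcond; apply: eq_bigr => G _.
    by rewrite [in RHS]inE; case: (G \in GS); case: (all _ _).
  move: cs; case: s => -[|v [|w r]] //= sj /andP[us xr].
  move: (nth v [:: v, w & r] i) xr => x xr.
  have ss : size (lasso_edges [:: v, w & r] x) = j.
    by rewrite /= size_path_edges; apply/eqP.
  have h := @card_with_edges (lasso_edges [:: v, w & r] x).
  rewrite ss in h; apply: leq_trans (h _ _ _) _.
  - exact: uniq_lasso_edges.
  - move=> e; rewrite inE => /orP[/eqP ->|]; first by exists v, x.
    elim: (w :: r) (v) => //= y t IH z; rewrite inE => /orP[/eqP ->|/IH //].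
    by exists z, y.
  - by apply: leq_trans hn; rewrite leq_add2r leq_add2l leq_mul2l jk.
  by rewrite -expnM leq_mul2l leq_pexp2l ?orbT // leq_mul2l jk orbT.
apply: (@leq_trans (\sum_(s : j.-tuple V) \sum_(i < j) #|GS| * Dl ^ (2 * k))%N).
  rewrite big_distrl /=; apply: leq_sum => s _.
  rewrite exchange_big big_distrl /=; apply: leq_sum => i _.
  by rewrite big_distrl /=; apply: one.
rewrite !sum_nat_const card_tuple !card_ord [leqRHS]mulnC.
apply: leq_mul => //; rewrite mulnCA; apply: leq_mul => //; exact: leq_mul.
Qed.

End LassoCount.

(** * Sparse cuts *)

Section CutSwitch.
Variables (n : nat) (ds : 'I_n -> nat).
Local Notation V := 'I_n.
Implicit Types (G : {set {set V}}) (X : {set V}).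
Local Notation GS := (graphs_with ds).
Let Dl := max_deg ds.

Definition cutset G X : {set V * V} :=
  [set p | [&& p.1 \in X, p.2 \notin X & adj G p.1 p.2]].

Definition cut_graphs X k : {set {set {set V}}} :=
  [set G in GS | #|cutset G X| == k].

Definition dvol X : nat := (\sum_(x in X) ds x)%N.

Lemma sum_cutset G X : (\sum_x \sum_u ((x, u) \in cutset G X) = #|cutset G X|)%N.
Proof.
rewrite pair_big /= -sum1_card [RHS]big_mkcond; apply: eq_bigr => -[x u] _ /=.
by case: (_ \in _).
Qed.

Lemma sum_inside G X : G \in GS ->
  (\sum_x \sum_y [&& x \in X, y \in X & adj G x y] + #|cutset G X| = dvol X)%N.
Proof.
move=> GG; rewrite -sum_cutset -big_split /dvol [RHS]big_mkcond /=.
apply: eq_bigr => x _; rewrite -big_split /=.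
case: ifP => xX; last by rewrite big1 // => y _; rewrite inE /= xX.
rewrite -(sum_adj x GG); apply: eq_bigr => y _; rewrite inE /= xX /=.
by case: (y \in X); rewrite ?addn0 ?add0n.
Qed.

Lemma cutsetC G X : #|cutset G (~: X)| = #|cutset G X|.
Proof.
rewrite -!sum_cutset exchange_big; apply: eq_bigr => x _; apply: eq_bigr => u _.
by rewrite !inE /= negbK adj_sym andbCA.
Qed.

Lemma even_sym_sum (f : V -> V -> bool) : (forall x y, f x y = f y x) ->
  (forall x, ~~ f x x) -> ~~ odd (\sum_x \sum_y f x y)%N.
Proof.
move=> fs f0.
have E : (\sum_x \sum_y f x y = \sum_x \sum_y (f x y && (x < y)%N) +
    \sum_x \sum_y (f x y && (y < x)%N))%N.
  rewrite -big_split; apply: eq_bigr => x _; rewrite -big_split; apply: eq_bigr => y _ /=.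
  case: ltngtP => [||/val_inj ->]; rewrite ?andbT ?andbF ?addn0 ?add0n //.
  by rewrite (negbTE (f0 y)).
rewrite E [X in (_ + X)%N]exchange_big /=.
have -> : (\sum_y \sum_x (f x y && (y < x)) = \sum_x \sum_y (f x y && (x < y)))%N.
  by apply: eq_bigr => x _; apply: eq_bigr => y _; rewrite fs.
by rewrite addnn odd_double.
Qed.

(** Edges inside [X] use up an even part of the degree sum of [X]. Since switchings change the cut
    size by 2, the comparison with pairings sees only one parity class; the other class contains no
    graph. *)
Lemma cut_parity G X : G \in GS -> odd (dvol X) = odd #|cutset G X|.
Proof.
move=> GG; rewrite -(sum_inside X GG) oddD.
rewrite (negbTE (even_sym_sum _ _)) // => [x y|x].
  by rewrite adj_sym andbCA.
by rewrite adj_irr ?andbF // (graphs_with_simple GG).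
Qed.

Lemma switch_cutset G X x y u v : x \in X -> y \in X -> u \notin X -> v \notin X ->
  switchable G x y u v ->
  cutset (switch G x y u v) X = (x, u) |: ((y, v) |: cutset G X).
Proof.
move=> xX yX uX vX sw; apply/setP => -[a b].
rewrite !inE /= /adj !inE !eq_set2 -!pair_eqE /=.
case: (boolP (a \in X)) => aX; last first.
  rewrite /=; case: (eqVneq a x) => [ax|_]; first by rewrite ax xX in aX.
  by case: (eqVneq a y) => [ay|_] //=; rewrite ay yX in aX.
case: (boolP (b \in X)) => bX /=.
  case: (eqVneq b u) => [bu|_]; first by rewrite bu (negbTE uX) in bX.
  case: (eqVneq b v) => [bv|_]; first by rewrite bv (negbTE vX) in bX.
  by rewrite !andbF.
have -> : (a == u) = false by apply: contraNF uX => /eqP <-.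
have -> : (a == v) = false by apply: contraNF vX => /eqP <-.
have -> : (b == x) = false by apply: contraNF bX => /eqP ->.
have -> : (b == y) = false by apply: contraNF bX => /eqP ->.
by rewrite !andbF /= !orbF !andbT orbA.
Qed.

(* Trading an edge inside X and an edge outside X for two edges across. *)
Lemma cut_switch X k :
  (#|cut_graphs X k| * ((dvol X - k) * (dvol (~: X) - k) - 2 * k * Dl ^ 2) <=
   #|cut_graphs X k.+2| * (k.+2 * k.+1))%N.
Proof.
pose ok G (t : (V * V) * (V * V)) :=
  [&& t.1.1 \in X, t.1.2 \in X, t.2.1 \notin X, t.2.2 \notin X &
      switchable G t.1.1 t.1.2 t.2.1 t.2.2].
pose rev G (t : (V * V) * (V * V)) :=
  [&& (t.1.1, t.2.1) \in cutset G X, (t.1.2, t.2.2) \in cutset G X &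
      (t.1.1, t.2.1) != (t.1.2, t.2.2)].
apply: (double_count (ok := ok) (rev := rev)
  (sw := fun G t => switch G t.1.1 t.1.2 t.2.1 t.2.2)) => //.
- move=> G; rewrite inE => /andP[GG /eqP ck].
  have c1 : (\sum_x \sum_y [&& x \in X, y \in X & adj G x y] = dvol X - k)%N.
    by rewrite -(sum_inside X GG) ck addnK.
  have c2 : (\sum_u \sum_v [&& u \in ~: X, v \in ~: X & adj G u v] = dvol (~: X) - k)%N.
    by rewrite -(sum_inside (~: X) GG) cutsetC ck addnK.
  rewrite leq_subLR -c1 -c2.
  rewrite -(pair_big predT predT (fun p q => ok G (p, q) : nat)) /=.
  rewrite -(pair_big predT predT (fun x y => \sum_q ok G ((x, y), q))%N) /=.
  under [X in (_ <= _ + X)%N]eq_bigr => x _ do under eq_bigr => y _ do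
    rewrite -(pair_big predT predT (fun u v => ok G ((x, y), (u, v)) : nat)) /=.
  have b1 : (\sum_x \sum_y \sum_u \sum_v
     [&& (x, u) \in cutset G X, adj G x y & adj G u v] <= k * Dl ^ 2)%N.
    rewrite -ck -sum_cutset big_distrl; apply: leq_sum => x _ /=.
    rewrite exchange_big big_distrl; apply: leq_sum => u _ /=.
    case: (_ \in _) => /=; last by rewrite big1 // => y _; rewrite big1.
    apply: (@leq_trans (\sum_y adj G x y * Dl)).
      apply: leq_sum => y _; case: (adj G x y) => /=; last by rewrite big1.
      by rewrite mul1n sum_adj_le.
    by rewrite -big_distrl mul1n expnS expn1 leq_mul2r sum_adj_le ?orbT.
  have b2 : (\sum_x \sum_y \sum_u \sum_v
     [&& (y, v) \in cutset G X, adj G x y & adj G u v] <= k * Dl ^ 2)%N.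
    rewrite exchange_big -ck -sum_cutset big_distrl; apply: leq_sum => y _ /=.
    under eq_bigr => x _ do rewrite exchange_big.
    rewrite exchange_big big_distrl; apply: leq_sum => v _ /=.
    case: (_ \in _) => /=; last by rewrite big1 // => x _; rewrite big1.
    apply: (@leq_trans (\sum_x adj G y x * Dl)).
      apply: leq_sum => x _; rewrite adj_sym; case: (adj G y x) => /=; last by rewrite big1.
      rewrite mul1n; under eq_bigr => u _ do rewrite adj_sym.
      exact: sum_adj_le.
    by rewrite -big_distrl mul1n expnS expn1 leq_mul2r sum_adj_le ?orbT.
  have -> : ((\sum_x \sum_y [&& x \in X, y \in X & adj G x y]) *
    (\sum_u \sum_v [&& u \in ~: X, v \in ~: X & adj G u v]) =
    \sum_x \sum_y \sum_u \sum_v ([&& x \in X, y \in X & adj G x y] &&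
       [&& u \in ~: X, v \in ~: X & adj G u v]))%N.
    rewrite big_distrl; apply: eq_bigr => x _; rewrite big_distrl; apply: eq_bigr => y _.
    rewrite big_distrr; apply: eq_bigr => u _; rewrite big_distrr; apply: eq_bigr => v _ /=.
    by rewrite mulnb.
  have -> : (2 * k * Dl ^ 2 = k * Dl ^ 2 + k * Dl ^ 2)%N by lia.
  apply: leq_trans (leq_add (leq_add b1 b2) (leqnn _)).
  rewrite -!big_split; apply: leq_sum => x _ /=; rewrite -!big_split; apply: leq_sum => y _ /=.
  rewrite -!big_split; apply: leq_sum => u _ /=; rewrite -!big_split; apply: leq_sum => v _ /=.
  rewrite /ok /switchable /= !inE /=.
  case: (boolP (x \in X)) => //= xX; case: (boolP (y \in X)) => //= yX.
  case: (boolP (u \in X)) => uX; rewrite ?andbF //= ; case: (boolP (v \in X)) => vX; rewrite ?andbF //=.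
  have -> : x != u by apply: contraNneq uX => <-.
  have -> : y != v by apply: contraNneq vX => <-.
  by case: (adj G x y); case: (adj G u v); case: (adj G x u); case: (adj G y v).
- move=> G [[x y] [u v]]; rewrite inE => /andP[GG /eqP ck] /and5P[/= xX yX uX vX sw].
  have sG := graphs_with_simple GG.
  have [xy uv xv yu] := switchable_distinct sG sw.
  have E := switch_cutset xX yX uX vX sw.
  have nxu : (x, u) \notin (y, v) |: cutset G X.
    rewrite !inE /= negb_or xpair_eqE (negbTE xy) /=.
    by move/and5P: sw => [_ _ /negbTE -> _ _]; rewrite !andbF.
  have nyv : (y, v) \notin cutset G X.
    by rewrite !inE /=; move/and5P: sw => [_ _ _ /negbTE -> _]; rewrite !andbF.
  split.
    rewrite inE switch_graphs_with //= E cardsU1 nxu cardsU1 nyv ck.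
    by [].
  by rewrite /rev /= E !inE !eqxx /= orbT xpair_eqE (negbTE xy).
- move=> t G1 G2; rewrite ![_ \in cut_graphs _ _]in_set => /andP[G1G _] /andP[G2G _].
  move=> /and5P[_ _ _ _ sw1] /and5P[_ _ _ _ sw2] E.
  rewrite -(switch_switch (graphs_with_simple G1G) sw1) E.
  by rewrite (switch_switch (graphs_with_simple G2G) sw2).
- move=> G; rewrite inE => /andP[GG /eqP ck].
  have -> : (\sum_t rev G t = \sum_(p : V * V) \sum_(q : V * V)
      [&& p \in cutset G X, q \in cutset G X & p != q])%N.
    rewrite pair_big /=.
    pose f (t : (V * V) * (V * V)) := ((t.1.1, t.2.1), (t.1.2, t.2.2)).
    rewrite (reindex_inj (h := f)) /=; first by apply: eq_bigr => -[[x y] [u v]].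
    by apply: can_inj (f) _ => -[[x y] [u v]].
  rewrite -ck.
  apply: (@leq_trans (\sum_(p in cutset G X) k.+1)%N); last first.
    by rewrite sum_nat_const ck.
  rewrite [leqRHS]big_mkcond; apply: leq_sum => p _; case: ifP => pC /=; last by rewrite big1.
  have : (\sum_q ((q \in cutset G X) && (p != q)) = #|cutset G X :\ p|)%N.
    rewrite -sum1_card [RHS]big_mkcond; apply: eq_bigr => q _.
    by rewrite in_setD1 andbC eq_sym; case: (_ && _).
  by move=> ->; move: ck; rewrite (cardsD1 p) pC add1n => -[->].
Qed.

End CutSwitch.

(** * Inequalities between binomial coefficients *)

Lemma bin_le_half (n i j : nat) : (i <= j)%N -> (2 * j <= n)%N -> ('C(n, i) <= 'C(n, j))%N.
Proof.
elim: j => [|j IH]; first by rewrite leqn0 => /eqP ->.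
rewrite leq_eqVlt => /orP[/eqP -> //|]; rewrite ltnS => ij jn.
apply: (@leq_trans 'C(n, j)); first by apply: IH => //; lia.
rewrite -(leq_pmul2l (ltn0Sn j)) mul_bin_left leq_mul2r; apply/orP; right; lia.
Qed.

Lemma bin_le_middle (n i j : nat) : (i <= j)%N -> (i + j <= n)%N -> ('C(n, i) <= 'C(n, j))%N.
Proof.
move=> ij ijn; case: (leqP (2 * j) n) => h; first exact: bin_le_half.
by rewrite -(@bin_sub n j) ?bin_le_half; lia.
Qed.

Lemma bin_mul_le (n m i j : nat) : ('C(n, i) * 'C(m, j) <= 'C(n + m, i + j))%N.
Proof.
have h : (i < (i + j).+1)%N by rewrite ltnS leq_addr.
rewrite -binomial.Vandermonde (bigD1 (Ordinal h)) //= addKn; exact: leq_addr.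
Qed.

(** * Cut sizes in random graphs compared with random pairings *)

Section Chain.
Variables (R : realType) (m D Q S Tot : nat) (N : nat -> nat).
Hypothesis Dm : (D <= m)%N.
Hypothesis S0 : (0 < S)%N.
Hypothesis N_le : forall k, (N k <= Tot)%N.
Hypothesis N_step : forall k,
  (N k * ((D - k) * (2 * m - D - k) - Q * k) <= N k.+2 * (k.+2 * k.+1))%N.
Hypothesis Q_ge2 : (2 <= Q)%N.
Hypothesis m_large : ((Q * S.+1) ^ 2 <= m)%N.

(* Proportional to the number of ways to pair off 2m points of which D are
   marked, with D - 2j pairs joining a marked point to an unmarked one. *)
Let f (j : nat) : R :=
  2 ^+ (D - 2 * j) * (m`!)%:R / ((D - 2 * j)`! * j`! * (m - D + j)`!)%:R.

Let st : R := S.+1%:R / S%:R.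

Let f_gt0 j : 0 < f j.
Proof. by rewrite /f divr_gt0 ?mulr_gt0 ?exprn_gt0 // ltr0n ?muln_gt0 ?fact_gt0. Qed.

Let f_rec j : (2 * j.+1 <= D)%N ->
  f j * (((D - 2 * j.+1).+1 * (D - 2 * j.+1).+2)%N)%:R =
  f j.+1 * ((4 * j.+1 * (m - D + j.+1))%N)%:R.
Proof.
move=> jD; rewrite /f.
have -> : (D - 2 * j = (D - 2 * j.+1).+2)%N by lia.
set k := (D - 2 * j.+1)%N; rewrite !factS addnS factS !exprS !natrM.
have h i : i.+1%:R != 0 :> R by rewrite pnatr_eq0.
have g i : (i`!)%:R != 0 :> R by rewrite pnatr_eq0 -lt0n fact_gt0.
have p i : 0 <= i%:R :> R by exact: ler0n.
by field; rewrite !g /=; repeat (apply/andP; split) => //;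
  apply: lt0r_neq0; have := p j; have := p k; have := p (m - D)%N; lra.
Qed.

(** By [f_rec] this says [f j <= f j.-1]: the mode of [f] has been passed. *)
Let good j : bool := ((D - 2 * j).+1 * (D - 2 * j).+2 <= 4 * j * (m - D + j))%N.

(** The loss [Q * k] in [N_step] is at most the fraction 1/(S+1) of the main term P. For k >= Q(S+1)
    this is because [good] gives P >= (k+1)(k+2), for smaller k because [m] is large. *)
Let N_good j : (2 * j.+1 <= D)%N -> good j.+1 ->
  (S * (N (D - 2 * j.+1) * (4 * j.+1 * (m - D + j.+1))) <=
   S.+1 * (N (D - 2 * j) * ((D - 2 * j.+1).+1 * (D - 2 * j.+1).+2)))%N.
Proof.
move=> jD; rewrite /good => gj.
have -> : (D - 2 * j = (D - 2 * j.+1).+2)%N by lia.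
have h := N_step (D - 2 * j.+1).
move: gj h; set k := (D - 2 * j.+1)%N; set P := (4 * j.+1 * _)%N => gj h.
have E : ((D - k) * (2 * m - D - k) = P)%N.
  have -> : (D - k = 2 * j.+1)%N by rewrite /k; lia.
  have -> : (2 * m - D - k = 2 * (m - D + j.+1))%N by rewrite /k; lia.
  by rewrite /P; lia.
rewrite E in h.
have hZ : (Q * S.+1 * k <= P)%N.
  have Z2 : (2 <= Q * S.+1)%N by apply: leq_trans Q_ge2 _; rewrite leq_pmulr.
  have := m_large; move: (Q * S.+1)%N Z2 => Z Z2 mZ.
  case: (leqP Z k) => Zk.
    by apply: leq_trans gj; apply: leq_mul; lia.
  apply: (@leq_trans (Z * Z)); first by rewrite leq_mul2l ltnW // orbT.
  rewrite -E; apply: (@leq_trans (2 * (m - Z))).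
    have zz : (2 * Z <= Z * Z)%N by rewrite leq_mul2r Z2 orbT.
    by move: mZ; rewrite expnS expn1; lia.
  by apply: leq_mul; rewrite /k in Zk *; lia.
have hS : (S * P <= S.+1 * (P - Q * k))%N.
  have : (S.+1 * (Q * k) <= P)%N by rewrite mulnCA mulnA.
  rewrite mulnBr [(S.+1 * P)%N]mulSn; move: (S.+1 * (Q * k))%N (S * P)%N => w1 w2.
  by move: P {gj h E hZ} => P; lia.
apply: (@leq_trans (S.+1 * (N k * (P - Q * k)))).
  by rewrite mulnCA [leqRHS]mulnCA leq_mul2l hS orbT.
by rewrite leq_mul2l; apply/orP; right; apply: leq_trans h _; rewrite [(k.+2 * _)%N]mulnC.
Qed.

Let st_ge1 : 1 <= st.
Proof. by rewrite /st ler_pdivlMr ?ltr0n // mul1r ler_nat. Qed.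

Let not_good j : (2 * j.+1 <= D)%N -> ~~ good j.+1 -> ~~ good j.
Proof.
rewrite /good -!ltnNge => jD h.
apply: leq_trans (_ : (4 * j.+1 * (m - D + j.+1)).+1 <= _)%N; first by nia.
by apply: leq_trans h _; apply: leq_mul; lia.
Qed.

Let f_not_good j i : (2 * j <= D)%N -> ~~ good j -> (i <= j)%N -> f i <= f j.
Proof.
elim: j => [|j IH] jD gj; first by rewrite leqn0 => /eqP ->.
rewrite leq_eqVlt => /orP[/eqP -> //|]; rewrite ltnS => ij.
apply: (@le_trans _ _ (f j)); first by apply: IH => //; [lia | exact: not_good].
have h := f_rec jD.
have P0 : 0 < (((D - 2 * j.+1).+1 * (D - 2 * j.+1).+2)%N)%:R :> R.
  by rewrite ltr0n.
rewrite -(ler_pM2r P0) h ler_pM2l ?f_gt0 // ler_nat.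
by move: gj; rewrite /good -ltnNge => /ltnW.
Qed.

(** Past the mode, every switching reproduces the ratio of consecutive values of [f] up to the
    factor [st]. Before the mode the switching estimate may be too weak, but there [f i <= f j] and
    the trivial bound by [Tot] suffices. *)
Lemma chain_le j i : (2 * j <= D)%N -> (i <= j)%N ->
  (N (D - 2 * j))%:R * f i <= st ^+ j * f j * Tot%:R.
Proof.
have triv l k x : 0 <= x -> (N k)%:R * x <= st ^+ l * x * Tot%:R.
  move=> x0; rewrite mulrAC; apply: ler_wpM2r => //; rewrite -[leLHS]mul1r.
  by apply: ler_pM => //; [exact: exprn_ege1 | rewrite ler_nat].
elim: j i => [|j IH] i jD.
  by rewrite leqn0 => /eqP ->; apply: triv; apply: ltW.
rewrite leq_eqVlt => /orP[/eqP ->|]; first by apply: triv; apply: ltW.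
rewrite ltnS => ij.
case: (boolP (good j.+1)) => gj; last first.
  apply: le_trans (triv j.+1 (D - 2 * j.+1)%N _ (ltW (f_gt0 j.+1))).
  by rewrite ler_wpM2l // f_not_good // leqW.
have h := N_good jD gj.
have P0 : 0 < (((D - 2 * j.+1).+1 * (D - 2 * j.+1).+2)%N)%:R :> R.
  by rewrite ltr0n.
have hr : (N (D - 2 * j.+1))%:R * f j <= st * ((N (D - 2 * j))%:R * f j.+1).
  rewrite -(ler_pM2r P0) -mulrA f_rec //.
  set p := (((D - 2 * j.+1).+1 * _)%N)%:R.
  have -> : st * ((N (D - 2 * j))%:R * f j.+1) * p =
      S.+1%:R * ((N (D - 2 * j))%:R * f j.+1) * p / S%:R.
    by rewrite /st; ring.
  rewrite ler_pdivlMr ?ltr0n // /p.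
  have -> : (N (D - 2 * j.+1))%:R * (f j.+1 * ((4 * j.+1 * (m - D + j.+1))%N)%:R) * S%:R
     = f j.+1 * ((S * (N (D - 2 * j.+1) * (4 * j.+1 * (m - D + j.+1))))%N)%:R.
    by rewrite !natrM; ring.
  rewrite [leRHS](_ : _ = f j.+1 * ((S.+1 * (N (D - 2 * j) *
     ((D - 2 * j.+1).+1 * (D - 2 * j.+1).+2)))%N)%:R); last by rewrite !natrM; ring.
  by rewrite ler_pM2l ?f_gt0 // ler_nat.
rewrite -(ler_pM2r (f_gt0 j)) mulrAC.
apply: (@le_trans _ _ (st * ((N (D - 2 * j))%:R * f j.+1) * f i)).
  by rewrite ler_wpM2r // ltW.
have IHj : (N (D - 2 * j))%:R * f i <= st ^+ j * f j * Tot%:R by apply: IH => //; lia.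
have -> : st * ((N (D - 2 * j))%:R * f j.+1) * f i =
  (st * f j.+1) * ((N (D - 2 * j))%:R * f i) by ring.
have -> : st ^+ j.+1 * f j.+1 * Tot%:R * f j = (st * f j.+1) * (st ^+ j * f j * Tot%:R).
  by rewrite exprS; ring.
by apply: ler_wpM2l => //; rewrite mulr_ge0 ?ltW // (lt_le_trans ltr01).
Qed.

Lemma f_incr j i : (j <= i)%N -> (2 * i <= D)%N -> (2 * (D - 2 * j) <= D)%N ->
  f i <= f j.
Proof.
elim: i => [|i IH]; first by rewrite leqn0 => /eqP ->.
rewrite leq_eqVlt => /orP[/eqP -> //|]; rewrite ltnS => ji iD jD.
apply: le_trans (IH ji _ jD); last by lia.
have P0 : 0 < ((4 * i.+1 * (m - D + i.+1))%N)%:R :> R by rewrite ltr0n !muln_gt0 addn_gt0 orbT.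
rewrite -(ler_pM2r P0) -f_rec // ler_pM2l ?f_gt0 // ler_nat.
apply: (@leq_trans ((2 * i.+1) * (2 * (m - D + i.+1)))); last by rewrite mulnACA mulnA.
by apply: leq_mul; lia.
Qed.

(** Read the other way round, [f j] counts the ways to mark D points in m fixed pairs with exactly j
    pairs fully marked. Two sets of pairs of sizes [D./2] and [D - D./2] that share j pairs give
    such a marking: first points from one set, second points from the other. Vandermonde's identity
    sorts these choices by j, and [2 ^ (D - 2 * j)] absorbs the binomial coefficient left over. *)
Lemma f_sum : ('C(m, D./2) * 'C(m, D - D./2))%:R <= \sum_(i < (D./2).+1) f i.
Proof.
set a := D./2; set b := (D - a)%N.
have a2 : (2 * a <= D)%N by rewrite /a; lia.
have ab : (a <= b)%N by rewrite /b; lia.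
have bm : (b <= m)%N by rewrite /b; lia.
have am : (a <= m)%N by lia.
have -> : 'C(m, b) = (\sum_(j < a.+1) 'C(a, j) * 'C(m - a, b - j))%N.
  rewrite -[in LHS](subnKC am) -binomial.Vandermonde.
  rewrite [RHS](big_ord_widen b.+1 (fun j => 'C(a, j) * 'C(m - a, b - j))%N) //.
  rewrite [RHS]big_mkcond; apply: eq_bigr => j _.
  by case: ifP => // /negbT; rewrite -leqNgt => ja; rewrite bin_small.
rewrite big_distrr natr_sum /=; apply: ler_sum => j _.
have ja : (j <= a)%N by rewrite -ltnS.
rewrite /f ler_pdivlMr ?ltr0n ?muln_gt0 ?fact_gt0 //.
have -> : (2 ^+ (D - 2 * j) * (m`!)%:R = ((2 ^ (D - 2 * j) * m`!)%N)%:R :> R).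
  by rewrite natrM natrX.
rewrite -natrM ler_nat.
have E1 := bin_fact am.
have E2 := bin_fact ja.
have jb : (b - j <= m - a)%N by rewrite /b; lia.
have E3 := bin_fact jb.
have E4 : (m - a - (b - j) = m - D + j)%N by rewrite /b; lia.
have kE : (D - 2 * j = (a - j) + (b - j))%N by rewrite /b; lia.
have E5' : ('C(D - 2 * j, a - j) * ((a - j)`! * (b - j)`!) = (D - 2 * j)`!)%N.
  have -> : (b - j = D - 2 * j - (a - j))%N by lia.
  by apply: bin_fact; lia.
have h2 : ('C(D - 2 * j, a - j) <= 2 ^ (D - 2 * j))%N.
  have l : (a - j < (D - 2 * j).+1)%N by lia.
  have -> : (2 ^ (D - 2 * j) = (1 + 1) ^ (D - 2 * j))%N by [].
  rewrite expnDn (bigD1 (Ordinal l)) //= !exp1n !muln1; exact: leq_addr.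
rewrite -E5' -E1 -E2 -E3 E4.
set x1 := 'C(m, a); set x2 := 'C(a, j); set x3 := 'C(m - a, b - j).
set x5 := 'C(D - 2 * j, a - j) in h2 *.
apply: (@leq_trans (x5 * (x1 * (x2 * (j`! * (a - j)`!) * (x3 * ((b - j)`! * (m - D + j)`!))))%N)).
  by rewrite eq_leq //; ring.
by rewrite leq_mul2r h2 orbT.
Qed.

(** For k <= D/2 the bound of N k times [f i] by [st ^+ D * f j * Tot] holds for every i: by
    [chain_le] if i <= j, and since [f] decreases beyond j otherwise. Summing over i brings in
    [f_sum], and a common factor ['C(m, D./2)] cancels. *)
Lemma chain_bin k : odd D = odd k -> (2 * k <= D)%N ->
  (N k * 'C(m, D - D./2))%:R <=
    D.+1%:R * st ^+ D * 2 ^+ k * ('C(m, k) * Tot)%:R.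
Proof.
move=> odk kD.
pose j := ((D - k)./2)%N.
have jE : (D - 2 * j = k)%N.
  have : ~~ odd (D - k) by rewrite oddB ?odk ?addbb //; lia.
  by rewrite /j; lia.
have jD : (2 * j <= D)%N by rewrite /j; lia.
have fle i : (i < (D./2).+1)%N -> (N k)%:R * f i <= st ^+ D * f j * Tot%:R.
  move=> ia.
  have stj : st ^+ j * f j * Tot%:R <= st ^+ D * f j * Tot%:R.
    apply: ler_wpM2r => //; apply: ler_wpM2r; first exact: ltW.
    by apply: ler_weXn2l => //; lia.
  apply: le_trans stj.
  case: (leqP i j) => ij; first by rewrite -{1}jE; apply: chain_le.
  apply: (@le_trans _ _ ((N k)%:R * f j)).
    by rewrite ler_wpM2l // f_incr //; lia.
  by rewrite -{1}jE; apply: chain_le.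
have fj : f j <= 2 ^+ k * ('C(m, k))%:R * ('C(m, D./2))%:R.
  have E1 := @bin_fact m k _.
  have E2 := @bin_fact (m - k) j _.
  have E3 : (m - k - j = m - D + j)%N by lia.
  have -> : f j = 2 ^+ k * ('C(m, k))%:R * ('C(m - k, j))%:R.
    rewrite /f jE -E1; last by lia.
    rewrite -E2; last by lia.
    rewrite E3 !natrM.
    have g i : (i`!)%:R != 0 :> R by rewrite pnatr_eq0 -lt0n fact_gt0.
    by field; rewrite !g.
  rewrite ler_wpM2l ?mulr_ge0 ?exprn_ge0 // ler_nat.
  apply: (@leq_trans 'C(m, j)); first by apply: leq_bin2l; lia.
  by apply: bin_le_half; lia.
have C0 : 0 < ('C(m, D./2))%:R :> R by rewrite ltr0n bin_gt0; lia.
rewrite -(ler_pM2r C0).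
apply: (@le_trans _ _ ((N k)%:R * \sum_(i < (D./2).+1) f i)).
  rewrite natrM -mulrA; apply: ler_wpM2l => //.
  by rewrite -natrM mulnC; exact: f_sum.
rewrite mulr_sumr.
apply: (@le_trans _ _ (\sum_(i < (D./2).+1) st ^+ D * f j * Tot%:R)).
  by apply: ler_sum => i _; apply: fle.
rewrite sumr_const card_ord -[leLHS]mulr_natl.
have hD : (D./2).+1%:R <= D.+1%:R :> R by rewrite ler_nat; lia.
apply: (@le_trans _ _ (D.+1%:R * (st ^+ D * (2 ^+ k * ('C(m, k))%:R * ('C(m, D./2))%:R) * Tot%:R))).
  apply: ler_pM => //.
    by rewrite !mulr_ge0 // ?exprn_ge0 ?ltW // (lt_le_trans ltr01).
  by rewrite ler_wpM2r // ler_wpM2l // exprn_ge0 // (le_trans ler01).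
by rewrite natrM le_eqVlt; apply/orP; left; apply/eqP; ring.
Qed.

End Chain.

Lemma exp_le_bin (M J : nat) : (J <= M)%N -> (M ^ J <= J ^ J * 'C(M, J))%N.
Proof.
elim: J M => [|J IH] [|M] //; rewrite ltnS => JM.
have h : (J.+1 * 'C(M.+1, J.+1) = M.+1 * 'C(M, J))%N by rewrite -mul_bin_diag.
rewrite expnS expnSr -mulnA h mulnCA leq_mul2l /=.
case: (posnP J) => [->|J0]; first by rewrite !expn0 bin0.
rewrite -(leq_pmul2l (_ : 0 < J ^ J)%N) ?expn_gt0 ?J0 //.
apply: (@leq_trans ((J.+1 * M) ^ J)).
  by rewrite -expnMn leq_exp2r //; nia.
by rewrite expnMn mulnCA leq_mul2l IH ?orbT.
Qed.

(** The product of ['C(m, k)] and [x ^+ k] is one term of (1 + x)^m, which is at most e^(mx). *)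
Lemma bin_exp_le (R : realType) (m k : nat) (x : R) : 0 < x ->
  ('C(m, k))%:R <= expR (m%:R * x) / x ^+ k.
Proof.
move=> x0; rewrite ler_pdivlMr ?exprn_gt0 //.
apply: (@le_trans _ _ ((1 + x) ^+ m)).
  case: (leqP k m) => km; last first.
    by rewrite bin_small // mul0r exprn_ge0 // addr_ge0 // ltW.
  rewrite exprDn (bigD1 (Ordinal (km : k < m.+1)%N)) //= expr1n mul1r mulr_natl.
  rewrite lerDl; apply: sumr_ge0 => i _.
  by rewrite expr1n mul1r mulrn_wge0 // exprn_ge0 // ltW.
rewrite expRM_natl.
apply: lerXn2r; rewrite ?nnegrE ?expR_ge0 //; last exact: expR_ge1Dx.
by rewrite addr_ge0 // ltW.
Qed.

Lemma bernoulli_ineq (R : realDomainType) (a : R) n : 0 <= a ->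
  1 + n%:R * a <= (1 + a) ^+ n.
Proof.
move=> a0; elim: n => [|n IH]; first by rewrite mul0r addr0 expr0.
rewrite exprS; apply: le_trans (_ : (1 + a) * (1 + n%:R * a) <= _).
  have : 0 <= n%:R * a by rewrite mulr_ge0.
  by rewrite -natr1; nra.
by apply: ler_wpM2l => //; rewrite addr_ge0.
Qed.

(** * Numerical estimate for cuts with few edges *)

Section TailTerm.
Variable R : realType.
Variables (m M D J k : nat).
Hypotheses (m3M : (m <= 3 * M)%N) (Dm : (D <= m)%N) (DJ : (D <= 8 * J)%N)
  (JD : (8 * J <= D + 7)%N) (kD : (1024 * k < D)%N) (m33 : (33 <= m)%N) (JM : (J <= M)%N).

(** The factor 50^5 comes from J^5 <= 50^5 (51/50)^(5J), and 18 is 9 from D + 1 <= 9J times 2 from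
    the comparison [hT]. *)
Definition tail_const : R := 18 * 50 ^+ 5.

(** For z = M/J >= 2 the binomial on the right is at least z^J. One factor z pays for M; the powers
    of J, the error (101/100)^D and the exponential from [bin_exp_le] amount to constants close to 1
    raised to the power J, with product at most (13/10)^J; and 8k is so small compared with J that
    (13/10)^J z^(8k) <= 2 z^(J-1). *)
Lemma tail_term :
  M%:R * J%:R ^+ 3 * (D.+1%:R * (101 / 100) ^+ D * 2 ^+ k * ('C(m, k))%:R)
  <= tail_const * ('C(M, J))%:R.
Proof.
have J0 : (0 < J)%N by lia.
have J0R : 0 < J%:R :> R by rewrite ltr0n.
have M0 : (0 < M)%N by lia.
have M0R : 0 < M%:R :> R by rewrite ltr0n.
pose z : R := M%:R / J%:R.
have z2 : 2 <= z.
  by rewrite /z ler_pdivlMr // -natrM ler_nat; lia.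
have z0 : 0 < z by lra.
have zJ : z ^+ J <= ('C(M, J))%:R.
  rewrite /z expr_div_n ler_pdivrMr ?exprn_gt0 // -!natrX -natrM ler_nat mulnC.
  exact: exp_le_bin.
have D0R : 0 < D%:R :> R by rewrite ltr0n; lia.
have m0R : 0 < m%:R :> R by rewrite ltr0n; lia.
have hk : 2 ^+ k * ('C(m, k))%:R <= (16 / 15) ^+ J * z ^+ (8 * k).
  (* This choice makes e^(mx) = e^(D/128) at most (16/15)^J, while 2/x = 128 (2m/D) is at most 128 z
     <= z^8. *)
  pose x : R := D%:R / (128 * m%:R).
  have x0 : 0 < x by rewrite divr_gt0 // mulr_gt0.
  have hx := bin_exp_le m k x0.
  have e1 : m%:R * x = D%:R / 128 by rewrite /x; field; rewrite gt_eqF.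
  have e2 : expR (D%:R / 128) <= (16 / 15) ^+ J :> R.
    apply: (@le_trans _ _ (expR (J%:R * (1 / 16)))).
      rewrite ler_expR; have : D%:R <= 8 * J%:R :> R by rewrite -natrM ler_nat.
      lra.
    rewrite expRM_natl; apply: lerXn2r; rewrite ?nnegrE ?expR_ge0 //.
    have := expR_ge1Dx (- (1 / 16) : R); rewrite expRN => h.
    by rewrite -[(expR _)^-1]div1r ler_pdivlMr ?expR_gt0 // in h; lra.
  have e3 : 2 ^+ k / x ^+ k <= z ^+ (8 * k).
    case: (posnP k) => [->|k0]; first by rewrite muln0 !expr0 divr1.
    have h2x : 2 / x <= z ^+ 8.
      have -> : 2 / x = 256 * m%:R / D%:R.
        by rewrite /x; field; rewrite !gt_eqF.
      have yz : 2 * m%:R / D%:R <= z.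
        rewrite /z ler_pdivrMr // mulrAC ler_pdivlMr // -!natrM ler_nat.
        have J6 : (6 * J <= D)%N by move: k0 kD JD; clear; lia.
        apply: (@leq_trans (2 * (3 * M) * J)); first by apply: leq_mul => //; apply: leq_mul.
        apply: (@leq_trans (M * (6 * J))); last by rewrite leq_mul2l J6 orbT.
        by clear; lia.
      apply: (@le_trans _ _ (128 * z)).
        have -> : 256 * m%:R / D%:R = 128 * (2 * m%:R / D%:R) :> R.
          by ring.
        by rewrite ler_pM2l.
      rewrite exprSr ler_wpM2r ?(ltW z0) //.
      have -> : 128 = 2 ^+ 7 :> R by ring.
      by apply: lerXn2r; rewrite ?nnegrE // ltW.
    rewrite -expr_div_n exprM; apply: lerXn2r => //; rewrite nnegrE ?exprn_ge0 ?ltW //.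
    by rewrite divr_gt0.
  apply: (@le_trans _ _ (expR (m%:R * x) * (2 ^+ k / x ^+ k))).
    by rewrite mulrCA ler_wpM2l ?exprn_ge0.
  rewrite e1; apply: ler_pM => //.
  by rewrite divr_ge0 ?exprn_ge0 // ltW.
have hst : (101 / 100) ^+ D <= ((101 / 100) ^+ 8) ^+ J :> R.
  by rewrite -exprM; apply: ler_weXn2l => //; lra.
have hD : D.+1%:R <= 9 * J%:R :> R by rewrite -natrM ler_nat; move: DJ J0; clear; lia.
have hB : J%:R ^+ 5 <= 50 ^+ 5 * ((51 / 50) ^+ 5) ^+ J :> R.
  rewrite -exprM mulnC exprM -exprMn; apply: lerXn2r; rewrite ?nnegrE //.
  have h50 : 0 <= 1 / 50 :> R by lra.
  have := bernoulli_ineq J h50.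
  have -> : 1 + 1 / 50 = 51 / 50 :> R by field.
  lra.
have hT : (13 / 10) ^+ J * z ^+ (8 * k) <= 2 * z ^+ J.-1.
  (* The square of 13/10 is below 2 <= z, and T is at least half of [J.-1]. *)
  pose T := (J.-1 - 8 * k)%N.
  have -> : J.-1 = (8 * k + T)%N.
    by rewrite /T; move: J0 DJ kD; clear; lia.
  have -> : J = J.-1.+1 by rewrite prednK.
  rewrite exprS exprD.
  have h1 : (13 / 10) ^+ J.-1 <= z ^+ T.
    apply: (@le_trans _ _ ((13 / 10) ^+ (2 * T))).
      apply: ler_weXn2l; first lra.
      by rewrite /T; move: J0 DJ kD; clear; lia.
    by rewrite exprM; apply: lerXn2r; rewrite ?nnegrE ?exprn_ge0 ?ltW //; lra.
  have zk : 0 < z ^+ (8 * k) by exact: exprn_gt0.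
  have zT : 0 < z ^+ T by exact: exprn_gt0.
  have p0 : 0 <= (13 / 10) ^+ J.-1 :> R by apply: exprn_ge0; lra.
  nra.
apply: le_trans (_ : tail_const * z ^+ J <= _); last first.
  by apply: ler_wpM2l => //; apply: mulr_ge0 => //; exact: exprn_ge0.
have zJE : z ^+ J = M%:R / J%:R * z ^+ J.-1 by rewrite -[in LHS](prednK J0) exprS.
rewrite zJE.
apply: (@le_trans _ _ (M%:R * J%:R ^+ 3 * (9 * J%:R * ((101 / 100) ^+ 8) ^+ J *
   ((16 / 15) ^+ J * z ^+ (8 * k))))).
  apply: ler_wpM2l; first by rewrite mulr_ge0 ?exprn_ge0.
  have p1 : 0 <= (101 / 100) ^+ D :> R by apply: exprn_ge0; lra.
  have p2 : 0 <= 2 ^+ k :> R by exact: exprn_ge0.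
  rewrite -[_ * 2 ^+ k * _]mulrA.
  by apply: ler_pM; [exact: mulr_ge0 | exact: mulr_ge0 | apply: ler_pM | exact: hk].
have -> : M%:R * J%:R ^+ 3 * (9 * J%:R * ((101 / 100) ^+ 8) ^+ J *
   ((16 / 15) ^+ J * z ^+ (8 * k))) =
   (9 * (M%:R / J%:R)) * (J%:R ^+ 5 * (((101 / 100) ^+ 8 * (16 / 15)) ^+ J * z ^+ (8 * k))) :> R.
  rewrite [(_ * (16 / 15)) ^+ J]exprMn.
  move: (((101 / 100) ^+ 8) ^+ J) ((16 / 15) ^+ J) (z ^+ (8 * k)) => x y t.
  by field; rewrite gt_eqF.
have -> : tail_const * (M%:R / J%:R * z ^+ J.-1) =
   (9 * (M%:R / J%:R)) * (50 ^+ 5 * (2 * z ^+ J.-1)) by rewrite /tail_const; ring.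
apply: ler_wpM2l; first by rewrite mulr_ge0 // divr_ge0.
apply: (@le_trans _ _ (50 ^+ 5 * ((51 / 50) ^+ 5) ^+ J *
   (((101 / 100) ^+ 8 * (16 / 15)) ^+ J * z ^+ (8 * k)))).
  apply: ler_wpM2r => //; apply: mulr_ge0; last exact: exprn_ge0 (ltW z0).
  by apply: exprn_ge0; apply: mulr_ge0; [apply: exprn_ge0 |]; lra.
rewrite -mulrA; apply: ler_wpM2l; first by rewrite exprn_ge0.
apply: le_trans hT; rewrite mulrA -exprMn; apply: ler_wpM2r.
  exact: exprn_ge0 (ltW z0).
have base : (51 / 50) ^+ 5 * ((101 / 100) ^+ 8 * (16 / 15)) <= 13 / 10 :> R by lra.
apply: lerXn2r => //; rewrite nnegrE; last by lra.
by apply: mulr_ge0; [apply: exprn_ge0 | apply: mulr_ge0; [apply: exprn_ge0 |]]; lra.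
Qed.
End TailTerm.

Lemma mul_succ_le (s J : nat) : (0 < J)%N -> (3 * s <= 8 * J)%N ->
  (s * s.+1 <= 10 * J ^ 2)%N.
Proof.
move=> J0 sJ; rewrite -(leq_pmul2l (isT : 0 < 9)%N) expnS expn1.
have h : (3 * s * (3 * s.+1) <= 8 * J * (11 * J))%N by apply: leq_mul; lia.
rewrite mulnACA [leqRHS]mulnACA in h.
by move: (s * s.+1)%N (J * J)%N h => x y; clear; lia.
Qed.

(** * Union bound over sparse cuts *)

Section SparseCut.
Variables (R : realType) (n : nat) (ds : 'I_n -> nat).
Local Notation V := 'I_n.
Implicit Types (G : {set {set V}}) (X : {set V}).
Local Notation GS := (graphs_with ds).
Let Dl := max_deg ds.
Let m := ((\sum_i ds i)./2)%N.
Hypothesis ds_even : ~~ odd (\sum_i ds i)%N.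
Hypothesis ds3 : forall i, (3 <= ds i)%N.
Hypothesis n0 : (0 < n)%N.
Hypothesis m_large : ((2 * Dl ^ 2 * 101) ^ 2 <= m)%N.

Let m2 : (\sum_i ds i = 2 * m)%N.
Proof. by rewrite mul2n /m -[LHS]odd_double_half (negbTE ds_even). Qed.

Let Dl0 : (0 < Dl)%N.
Proof. by apply: leq_trans (ds_max ds (Ordinal n0)); apply: leq_trans (ds3 _). Qed.

Let m33 : (33 <= m)%N.
Proof. by apply: leq_trans m_large; apply: leq_trans (_ : (2 * 1 ^ 2 * 101) ^ 2 <= _)%N; rewrite // leq_exp2r // leq_mul2r /= leq_mul2l leq_exp2r. Qed.

Let sum_dvol X : (dvol ds X + dvol ds (~: X) = 2 * m)%N.
Proof.
rewrite -m2 /dvol [RHS](bigID (mem X)) /=; congr addn; apply: eq_bigl => x.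
by rewrite inE.
Qed.

Let card_dvol X : (3 * #|X| <= dvol ds X)%N.
Proof. by rewrite mulnC -sum_nat_const /dvol; apply: leq_sum. Qed.

Let nm : (3 * n <= 2 * m)%N.
Proof.
have := card_dvol setT; rewrite cardsT card_ord; move/leq_trans; apply.
by have := sum_dvol setT; rewrite -m2 => <-; exact: leq_addr.
Qed.

Definition sparse_graphs X : {set {set {set V}}} :=
  [set G in GS | 1024 * #|cutset G X| < dvol ds X]%N.

Definition sparse_const : R := 10 * tail_const R.

(** By [chain_bin] a cut of size k has probability about 2^k C(m,k) / C(m,b) with b = D/2 rounded
    up. Degrees at least 3 make b - s at least D/8 rounded up, that is J, so C(m,b) >= C(n,s)
    C(m-n,J). The first factor pays for the choice of [X]; the second absorbs the rest and, through
    J^3 in [tail_term], leaves one J for the sum over k and J^2 for s(s+1). *)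
Lemma card_sparse_graphs X : X != set0 -> (dvol ds X <= m)%N ->
  (#|sparse_graphs X| * 'C(n, #|X|) * ((m - n) * (#|X| * #|X|.+1)))%:R <=
  sparse_const * #|GS|%:R.
Proof.
move=> X0 Dm.
set D := dvol ds X in Dm *; set s := #|X|; set M := (m - n)%N.
have s0 : (0 < s)%N by rewrite card_gt0.
have s3 : (3 * s <= D)%N := card_dvol X.
have s3' : (3 * (n - s) <= 2 * m - D)%N.
  have := card_dvol (~: X); rewrite cardsCs setCK card_ord.
  by have := sum_dvol X; rewrite -/D -/s; lia.
have sn : (s <= n)%N by rewrite -[X in (_ <= X)%N](card_ord n) max_card.
pose J := ((D + 7) %/ 8)%N.
have JD : (8 * J <= D + 7)%N by rewrite /J; lia.
have DJ : (D <= 8 * J)%N by rewrite /J; lia.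
set b := (D - D./2)%N.
have bE : (D <= 2 * b)%N by rewrite /b; lia.
have bE' : (2 * b <= D + 1)%N by rewrite /b; lia.
have mM : (m <= 3 * M)%N by rewrite /M; lia.
have Jb : (J <= b - s)%N by lia.
have JbM : (J + (b - s) <= M)%N by rewrite /M; lia.
have sb : (s <= b)%N by lia.
have J0 : (0 < J)%N by lia.
have CC : ('C(n, s) * 'C(M, J) <= 'C(m, b))%N.
  have -> : m = (n + M)%N by rewrite /M; lia.
  have -> : b = (s + (b - s))%N by lia.
  apply: leq_trans (bin_mul_le _ _ _ _).
  by rewrite leq_mul2l; apply/orP; right; apply: bin_le_middle => //; lia.
have C0 : 0 < ('C(M, J))%:R :> R by rewrite ltr0n bin_gt0; lia.
have one k : (1024 * k < D)%N ->
    (#|cut_graphs ds X k| * 'C(n, s))%:R * (M%:R * J%:R ^+ 3) <= tail_const R * #|GS|%:R.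
  move=> kD.
  case: (boolP (odd D == odd k)) => odk; last first.
    suff -> : cut_graphs ds X k = set0.
      by rewrite cards0 mul0n mul0r mulr_ge0 // mulr_ge0 // exprn_ge0.
    apply/setP => G; rewrite [RHS]inE; apply/negP; rewrite in_set => /andP[GG /eqP ck].
    by move: odk; rewrite -ck -(cut_parity X GG) eqxx.
  (* The loss in [cut_switch] dictates [2 * Dl ^ 2], and the value 100 fixes the error per switching
     at 101/100. *)
  have h := @chain_bin R m D (2 * Dl ^ 2) 100 #|GS| (fun k => #|cut_graphs ds X k|)
     Dm isT _ _ _ m_large k (eqP odk) _.
  have {}h : (#|cut_graphs ds X k| * 'C(m, b))%:R <=
      D.+1%:R * (101 / 100) ^+ D * 2 ^+ k * ('C(m, k) * #|GS|)%:R :> R.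
    apply: h; last by lia.
    - move=> l; apply: subset_leq_card; apply/subsetP => G.
      by rewrite inE => /andP[].
    - move=> l; have -> : (2 * m - D = dvol ds (~: X))%N by have := sum_dvol X; rewrite -/D; lia.
      by have := cut_switch ds X l; rewrite -/D -/Dl mulnAC.
    - by apply: leq_pmulr; rewrite expn_gt0 Dl0.
  have t := @tail_term R m M D J k mM Dm DJ JD kD m33 _.
  have {}t := t (leq_trans (leq_addr _ _) JbM).
  rewrite -(ler_pM2r C0).
  apply: (@le_trans _ _ ((#|cut_graphs ds X k| * 'C(m, b))%:R * (M%:R * J%:R ^+ 3))).
    rewrite mulrAC; apply: ler_wpM2r; first by rewrite mulr_ge0 // exprn_ge0.
    by rewrite -natrM ler_nat -mulnA leq_mul2l CC orbT.
  apply: (@le_trans _ _ ((D.+1%:R * (101 / 100) ^+ D * 2 ^+ k * ('C(m, k) * #|GS|)%:R) *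
      (M%:R * J%:R ^+ 3))).
    by apply: ler_wpM2r => //; rewrite mulr_ge0 // exprn_ge0.
  have -> : (D.+1%:R * (101 / 100) ^+ D * 2 ^+ k * ('C(m, k) * #|GS|)%:R) *
      (M%:R * J%:R ^+ 3) = M%:R * J%:R ^+ 3 * (D.+1%:R * (101 / 100) ^+ D * 2 ^+ k * ('C(m, k))%:R)
       * #|GS|%:R :> R.
    rewrite natrM; move: ((101 / 100) ^+ D) (2 ^+ k) => x y; ring.
  by rewrite [leRHS]mulrAC; apply: ler_wpM2r.
have split : (#|sparse_graphs X| <= \sum_(k < J | 1024 * k < D) #|cut_graphs ds X k|)%N.
  rewrite -sum1_card.
  have -> : (\sum_(k < J | (1024 * k < D)%N) #|cut_graphs ds X k| =
     \sum_G \sum_(k < J | (1024 * k < D)%N) (G \in cut_graphs ds X k))%N.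
    rewrite exchange_big; apply: eq_bigr => k _; rewrite -sum1_card big_mkcond.
    by apply: eq_bigr => G _; case: ifP.
  rewrite big_mkcond; apply: leq_sum => G _; case: ifP => //.
  rewrite inE => /andP[GG cG].
  have kJ : (#|cutset G X| < J)%N by move: cG; rewrite -/D; lia.
  by rewrite (bigD1 (Ordinal kJ)) //= inE GG eqxx.
have M0 : 0 <= M%:R :> R by [].
have J0R : 0 < J%:R :> R by rewrite ltr0n.
have hs : (#|sparse_graphs X| * 'C(n, s))%:R * (M%:R * J%:R ^+ 2) <= tail_const R * #|GS|%:R.
  rewrite -(ler_pM2r J0R).
  have -> : (#|sparse_graphs X| * 'C(n, s))%:R * (M%:R * J%:R ^+ 2) * J%:R =
    (#|sparse_graphs X| * 'C(n, s))%:R * (M%:R * J%:R ^+ 3) :> R by ring.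
  apply: (@le_trans _ _ (\sum_(k < J | (1024 * k < D)%N)
      (#|cut_graphs ds X k| * 'C(n, s))%:R * (M%:R * J%:R ^+ 3))).
    rewrite -mulr_suml; apply: ler_wpM2r; first by rewrite mulr_ge0 // exprn_ge0.
    by rewrite -natr_sum ler_nat -big_distrl leq_mul2r split orbT.
  apply: (@le_trans _ _ (\sum_(k < J) tail_const R * #|GS|%:R)).
    rewrite big_mkcond; apply: ler_sum => k _; case: ifP => [/one //|_].
    by rewrite mulr_ge0 // /tail_const mulr_ge0 // exprn_ge0.
  by rewrite sumr_const card_ord -[leLHS]mulr_natr.
have sJ : (s * s.+1 <= 10 * J ^ 2)%N.
  by apply: mul_succ_le => //; move: s3 DJ; clear; lia.
apply: (@le_trans _ _ (10 * ((#|sparse_graphs X| * 'C(n, s))%:R * (M%:R * J%:R ^+ 2)))).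
  rewrite -natrX -!natrM ler_nat [leqRHS]mulnCA leq_mul2l; apply/orP; right.
  by rewrite [leqRHS]mulnCA leq_mul2l sJ orbT.
by rewrite /sparse_const -mulrA ler_pM2l.
Qed.

Definition sparse_some : {set {set {set V}}} :=
  [set G in GS | [exists X : {set V}, [&& X != set0, (dvol ds X <= m)%N
     & G \in sparse_graphs X]]].

(** Summing 1 / (C(n,s) s (s+1)) over all nonempty sets leaves the telescoping sum of 1 / (s (s+1)),
    at most 1, and [m - n] is at least n/2. *)
Lemma card_sparse_some : n%:R * #|sparse_some|%:R <= 2 * sparse_const * #|GS|%:R.
Proof.
have M0 : (0 < m - n)%N by have := m33; have := nm; lia.
have M0R : 0 < (m - n)%:R :> R by rewrite ltr0n.
have K0 : 0 <= sparse_const * #|GS|%:R.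
  by rewrite mulr_ge0 // /sparse_const mulr_ge0 // /tail_const mulr_ge0 // exprn_ge0.
pose P X := (X != set0) && (dvol ds X <= m)%N.
have h1 : #|sparse_some|%:R <= \sum_(X | P X) #|sparse_graphs X|%:R :> R.
  rewrite -natr_sum ler_nat -sum1_card.
  have -> : (\sum_(X | P X) #|sparse_graphs X| =
     \sum_G \sum_(X | P X) (G \in sparse_graphs X))%N.
    rewrite exchange_big; apply: eq_bigr => X _; rewrite -sum1_card big_mkcond.
    by apply: eq_bigr => G _; case: ifP.
  rewrite big_mkcond; apply: leq_sum => G _; case: ifP => //.
  rewrite inE => /andP[_ /existsP[X /and3P[X0 Dm XG]]].
  by rewrite (bigD1 X) /P ?X0 //= XG.
have h2 : (m - n)%:R * #|sparse_some|%:R <= sparse_const * #|GS|%:R.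
  apply: (@le_trans _ _ ((m - n)%:R * \sum_(X | P X) #|sparse_graphs X|%:R)).
    by apply: ler_wpM2l.
  rewrite mulr_sumr.
  apply: (@le_trans _ _ (\sum_(X : {set V} | X != set0) sparse_const * #|GS|%:R *
      ('C(n, #|X|) * (#|X| * #|X|.+1))%:R^-1)).
    rewrite big_mkcond [leRHS]big_mkcond; apply: ler_sum => X _; rewrite /P.
    case: (boolP (X != set0)) => //= X0.
    have pos : 0 < ('C(n, #|X|) * (#|X| * #|X|.+1))%:R :> R.
      rewrite ltr0n !muln_gt0 bin_gt0 card_gt0 X0 /= andbT.
      by rewrite -[X in (_ <= X)%N](card_ord n) max_card.
    case: ifP => Dm; last by rewrite mulr_ge0 // invr_ge0 ltW.
    rewrite ler_pdivlMr //; apply: le_trans (card_sparse_graphs X0 Dm).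
    by rewrite -!natrM ler_nat eq_leq //; ring.
  rewrite -mulr_sumr -[leRHS]mulr1; apply: ler_wpM2l => //.
  have -> : \sum_(X : {set V} | X != set0) (('C(n, #|X|) * (#|X| * #|X|.+1))%:R^-1 : R) =
      \sum_(s < n) (s.+1 * s.+2)%:R^-1.
    have inX (X : {set V}) : nat_of_ord (inord #|X| : 'I_n.+1) = #|X|.
      by rewrite inordK // ltnS -[X in (_ <= X)%N](card_ord n) max_card.
    have eX (X : {set V}) (i : 'I_n.+1) : (inord #|X| == i) = (#|X| == i).
      by rewrite -(inj_eq val_inj) /= inX.
    rewrite (partition_big (fun X : {set V} => inord #|X| : 'I_n.+1) (fun s => s != ord0)) /=; last first.
      by move=> X X0; rewrite eX cards_eq0.
    rewrite big_mkcond big_ord_recl /= add0r; apply: eq_bigr => s _.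
    have sn : (s.+1 <= n)%N by [].
    have -> : \sum_(X : {set V} | (X != set0) && (inord #|X| == lift ord0 s))
        (('C(n, #|X|) * (#|X| * #|X|.+1))%:R^-1 : R) =
        \sum_(X in [set X : {set V} | #|X| == s.+1]) ('C(n, s.+1) * (s.+1 * s.+2))%:R^-1.
      apply: eq_big => [X|X /andP[_]].
        by rewrite [RHS]in_set eX lift0 -cards_eq0; case: eqP => [->|].
      by rewrite eX lift0 => /eqP ->.
    rewrite sumr_const.
    have -> : #|[set X : {set V} | #|X| == s.+1]| = 'C(n, s.+1).
      by rewrite card_draws card_ord.
    rewrite -[LHS]mulr_natl natrM invfM mulrA divff ?mul1r // pnatr_eq0 -lt0n bin_gt0 //.
  have tele k : \sum_(s < k) (s.+1 * s.+2)%:R^-1 = 1 - k.+1%:R^-1 :> R.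
    elim: k => [|k IH]; first by rewrite big_ord0 invr1 subrr.
    rewrite big_ord_recr /= IH natrM.
    have -> : k.+2%:R = k.+1%:R + 1 :> R by rewrite natr1.
    have : 0 < k.+1%:R :> R by rewrite ltr0n.
    move: (k.+1%:R) => y y0.
    by field; apply/andP; split; apply: lt0r_neq0; lra.
  by rewrite tele gerBl invr_ge0.
apply: (@le_trans _ _ (2 * ((m - n)%:R * #|sparse_some|%:R))); last first.
  by rewrite -mulrA ler_pM2l.
by rewrite mulrA ler_wpM2r // -natrM ler_nat; have := nm; lia.
Qed.

End SparseCut.

(** * Existence of a graph with given degrees *)

Lemma sum_adjE (V : finType) (G : {set {set V}}) u : (\sum_v adj G u v = vdeg G u)%N.
Proof.
rewrite /vdeg -sum1_card [RHS]big_mkcond; apply: eq_bigr => v _; rewrite inE.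
by case: (adj _ _ _).
Qed.

Lemma sum_set2_eq (V : finType) (a c d : V) : c != d ->
  (\sum_b ([set a; b] == [set c; d]) = (a == c) + (a == d))%N.
Proof.
move=> cd; under eq_bigr => b _ do rewrite eq_set2.
have one (x y : V) : (\sum_b ((a == x) && (b == y)) = (a == x))%N.
  by rewrite (bigD1 y) //= eqxx andbT big1 ?addn0 // => b /negbTE ->; rewrite andbF.
rewrite -(one c d) -(one d c) -big_split; apply: eq_bigr => b _ /=.
case: (eqVneq a c) => [->|_] /=; last by rewrite add0n.
by rewrite (negbTE cd) orbF addn0.
Qed.

Section Existence.
Variables (n : nat) (ds : 'I_n -> nat).
Local Notation V := 'I_n.
Let Dl := max_deg ds.
Hypothesis ds_even : ~~ odd (\sum_i ds i)%N.
Hypothesis ds_gt0 : forall i, (0 < ds i)%N.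
Hypothesis n_large : (2 * Dl * (Dl + 2) + Dl + 2 <= n)%N.

Let subgraphs : {set {set {set V}}} :=
  [set G | simple_graph G && [forall i, (vdeg G i <= ds i)%N]].

Lemma add_edge (G : {set {set V}}) u v : simple_graph G -> u != v -> ~~ adj G u v ->
  let G' := [set u; v] |: G in
  [/\ simple_graph G', #|G'| = #|G|.+1 &
      forall a, vdeg G' a = (vdeg G a + (a == u) + (a == v))%N].
Proof.
move=> /forall_inP sG uv auv G'; split.
- apply/forall_inP => e; rewrite !inE => /orP[/eqP ->|/sG //].
  by rewrite cards2 uv.
- by rewrite cardsU1 (negbTE auv : [set u; v] \in G = false).
move=> a; rewrite -!sum_adjE -addnA -(sum_set2_eq a uv) -big_split.
apply: eq_bigr => b _; rewrite /adj !inE /=.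
case: eqP => [->|] /=; last by rewrite addn0.
by rewrite (negbTE auv : [set u; v] \in G = false).
Qed.

Lemma replace_edge (G : {set {set V}}) u v x y : simple_graph G -> adj G x y ->
  ~~ adj G u x -> ~~ adj G v y -> u != x -> v != y -> x != v ->
  let G' := [set e | [|| e == [set u; x], e == [set v; y] | (e \in G) && (e != [set x; y])]] in
  [/\ simple_graph G', #|G'| = #|G|.+1 &
      forall a, vdeg G' a = (vdeg G a + (a == u) + (a == v))%N].
Proof.
move=> sG axy aux avy ux vy xv G'; have xy := adj_neq sG axy.
move/forall_inP: (sG) => sG'.
have nux : [set u; x] \in G = false by exact: negbTE aux.
have nvy : [set v; y] \in G = false by exact: negbTE avy.
have ixy : [set x; y] \in G by [].
have d1 : [set u; x] == [set v; y] = false.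
  by rewrite eq_set2 (negbTE xy) (negbTE xv) !andbF.
(* One identity between indicators yields both counts: it is summed over all [e], and over the pairs
   containing a given vertex. *)
have E (e : {set V}) : ((e \in G') + (e == [set x; y]) =
    (e \in G) + (e == [set u; x]) + (e == [set v; y]))%N.
  rewrite inE; case: (eqVneq e [set u; x]) => [->|eux] /=.
    rewrite nux d1; case: eqP => // h; by rewrite h ixy in nux.
  case: (eqVneq e [set v; y]) => [->|evy] /=.
    rewrite nvy; case: eqP => // h; by rewrite h ixy in nvy.
  by case: (eqVneq e [set x; y]) => [->|_] /=; rewrite ?ixy ?andbT ?addn0.
split.
- apply/forall_inP => e; rewrite inE => /or3P[/eqP ->|/eqP ->|/andP[/sG' //]].
    by rewrite cards2 ux.
  by rewrite cards2 vy.
- have cardE (H : {set {set V}}) : #|H| = (\sum_e (e \in H))%N.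
    by rewrite -sum1_card big_mkcond; apply: eq_bigr => e _; case: ifP.
  have one (f : {set V}) : (\sum_e (e == f) = 1)%N.
    by rewrite (bigD1 f) //= eqxx big1 ?addn0 // => e /negbTE ->.
  have : (#|G'| + 1 = #|G| + 1 + 1)%N.
    rewrite !cardE -{1}(one [set x; y]) -{2}(one [set v; y]) -{1}(one [set u; x]).
    by rewrite -!big_split; apply: eq_bigr => e _; exact: E.
  by clear; lia.
move=> a.
have : (vdeg G' a + ((a == x) + (a == y)) =
    vdeg G a + ((a == u) + (a == x)) + ((a == v) + (a == y)))%N.
  rewrite -!sum_adjE -(sum_set2_eq a xy) -(sum_set2_eq a ux) -(sum_set2_eq a vy).
  by rewrite -!big_split; apply: eq_bigr => b _; exact: E.
by move: (vdeg G' a) (nat_of_bool _) (nat_of_bool _) => p b1 b2; clear; lia.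
Qed.

(** A graph with the most edges among those of degrees at most [ds] has the exact degrees. Otherwise
    some u is deficient, and parity provides a second deficiency at some v, possibly v = u.
    Deficient vertices other than u are neighbours of u, or an edge could be added; so almost all
    vertices have full degree, and there is an edge xy far enough from u and v to be replaced by ux
    and vy, a gain of one edge. *)
Lemma graphs_with_neq0 : graphs_with ds != set0.
Proof.
have s0 : set0 \in subgraphs.
  rewrite inE; apply/andP; split; first by apply/forall_inP => e; rewrite inE.
  apply/forallP => i; rewrite /vdeg.
  rewrite (_ : [set v | _] = set0) ?cards0 //.
  by apply/setP => v; rewrite !inE /adj inE.
have [G GS Gmax] : exists2 G, G \in subgraphs & forall H, H \in subgraphs -> (#|H| <= #|G|)%N.
  by exists [arg max_(G > set0 in subgraphs) #|G|]; case: arg_maxnP.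
move: (GS); rewrite inE => /andP[sG /forallP dG].
have noext (H : {set {set V}}) u v : (vdeg G u + (u == v) < ds u)%N -> (vdeg G v < ds v)%N ->
    [/\ simple_graph H, #|H| = #|G|.+1 &
      forall a, vdeg H a = (vdeg G a + (a == u) + (a == v))%N] -> False.
  move=> du dv [sH cH dH].
  suff : (#|H| <= #|G|)%N by rewrite cH ltnn.
  apply: Gmax; rewrite inE sH; apply/forallP => a; rewrite dH.
  case: (eqVneq a u) du => [->|au] du.
    by case: (u == v) du; rewrite ?addn0 ?addn1 //; lia.
  case: (eqVneq a v) => [->|av]; first by rewrite addn0 addn1.
  by rewrite !addn0.
case: (boolP [forall i, vdeg G i == ds i]) => [h|].
  by apply/set0Pn; exists G; rewrite inE sG.
rewrite negb_forall => /existsP[u du0].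
have du : (vdeg G u < ds u)%N by rewrite ltn_neqAle du0 dG.
have sym : symmetric (adj G) := @adj_sym _ G.
have ev : ~~ odd (\sum_i vdeg G i).
  under eq_bigr => i _ do rewrite -sum_adjE.
  by apply: even_sym_sum => // x; rewrite adj_irr.
have vle a : (vdeg G a <= Dl)%N by apply: leq_trans (dG a) (ds_max ds a).
have [v [dv dv2]] : exists v, (vdeg G u + (u == v) < ds u)%N /\ (vdeg G v < ds v)%N.
  case: (pickP [pred v | (v != u) && (vdeg G v < ds v)%N]) => [v /= /andP[vu dv]|no].
    by exists v; rewrite eq_sym (negbTE vu) addn0.
  exists u; split => //; rewrite eqxx addn1 ltn_neqAle du andbT.
  apply: contraNneq ds_even => h.
  have -> : (\sum_i ds i = (\sum_i vdeg G i).+1)%N.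
    rewrite (bigD1 u) //= [in RHS](bigD1 u) //= -h addSn; congr (_ + _).+1.
    apply: eq_bigr => i iu; move: (no i) => /=; rewrite iu /= ltnNge => /negbFE h'.
    by apply/eqP; rewrite eqn_leq h' dG.
  by rewrite /= ev.
exfalso.
have clash w : (vdeg G w < ds w)%N -> w != u -> adj G u w.
  move=> dw wu; apply/negP => /negP na.
  have uw : u != w by rewrite eq_sym.
  apply: (noext ([set u; w] |: G) u w) => //; first by rewrite (negbTE uw) addn0.
  exact: add_edge.
have full : (n <= \sum_i vdeg G i + Dl + 1)%N.
  apply: (@leq_trans (\sum_i (vdeg G i + adj G u i + (i == u)))%N).
    rewrite -[X in (X <= _)%N](card_ord n) -sum1_card; apply: leq_sum => i _.
    case: (eqVneq i u) => [|iu]; first by rewrite addn1.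
    case: (ltnP (vdeg G i) (ds i)) => [/clash ->//|h]; first by rewrite addn0 addn1.
    by have := ds_gt0 i; lia.
  rewrite !big_split /= sum_adjE.
  have -> : (\sum_i (i == u) = 1)%N.
    by rewrite (bigD1 u) //= eqxx big1 ?addn0 // => i /negbTE ->.
  by rewrite leq_add2r leq_add2l.
pose okp x y := [&& adj G x y, ~~ adj G u x, ~~ adj G v y, u != x, v != y & x != v].
have [x [y xy]] : exists x y, okp x y.
  case: (pickP [pred p | okp p.1 p.2]) => [[x y] /= h|no]; first by exists x, y.
  exfalso.
  have b1 (w : V) : (\sum_x \sum_y (adj G x y && (x == w)) <= Dl)%N.
    rewrite (bigD1 w) //= [X in (_ + X)%N]big1 => [|x xw]; last first.
      by rewrite big1 // => y _; rewrite (negbTE xw) andbF.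
    rewrite addn0; apply: leq_trans (vle w); rewrite -sum_adjE; apply: leq_sum => y _.
    by case: (adj _ _ _); rewrite //= leq_b1.
  have b2 (w : V) : (\sum_x \sum_y (adj G x y && adj G w x) <= Dl * Dl)%N.
    apply: (@leq_trans (\sum_x adj G w x * Dl)).
      apply: leq_sum => x _; case: (adj G w x); last first.
        by rewrite big1 // => y _; rewrite andbF.
      rewrite mul1n; apply: leq_trans (vle x); rewrite -sum_adjE; apply: leq_sum => y _.
      by rewrite andbT.
    by rewrite -big_distrl /= leq_mul2r sum_adjE vle orbT.
  have b1' (w : V) : (\sum_x \sum_y (adj G x y && (y == w)) <= Dl)%N.
    rewrite exchange_big; apply: leq_trans (b1 w); apply: leq_sum => y _; apply: leq_sum => x _.
    by rewrite sym.
  have b2' (w : V) : (\sum_x \sum_y (adj G x y && adj G w y) <= Dl * Dl)%N.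
    rewrite exchange_big; apply: leq_trans (b2 w); apply: leq_sum => y _; apply: leq_sum => x _.
    by rewrite sym.
  have tot : (\sum_i vdeg G i <= \sum_x \sum_y (adj G x y && (x == u)) +
     \sum_x \sum_y (adj G x y && (x == v)) + \sum_x \sum_y (adj G x y && (y == v)) +
     \sum_x \sum_y (adj G x y && adj G u x) + \sum_x \sum_y (adj G x y && adj G v y))%N.
    rewrite -!big_split; apply: leq_sum => x _; rewrite -sum_adjE -!big_split /=.
    apply: leq_sum => y _; move: (no (x, y)); rewrite /okp /=.
    rewrite [u == x]eq_sym [v == y]eq_sym.
    by case: (adj G x y) => //; case: (adj G u x); case: (adj G v y);
      case: (x == u); case: (y == v); case: (x == v).
  have aux (s c1 c2 c3 c4 c5 D D2 : nat) : (s <= c1 + c2 + c3 + c4 + c5 ->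
      c1 <= D -> c2 <= D -> c3 <= D -> c4 <= D2 -> c5 <= D2 ->
      n <= s + D + 1 -> 2 * D2 + 4 * D + D + 2 <= n -> False)%N by clear; lia.
  apply: (aux _ _ _ _ _ _ _ _ tot (b1 u) (b1 v) (b1' v) (b2 u) (b2' v) full).
  by move: n_large; rewrite mulnDr -mulnA mulnAC.
move/and5P: xy => [axy aux avy ux /andP[vy xv]].
exact: (noext _ _ _ dv dv2 (replace_edge sG axy aux avy ux vy xv)).
Qed.

End Existence.

(** * Cover time of a typical graph *)

Lemma harmonic_sum_le (R : realType) k : harmonic_sum R k <= 1 + ln k%:R.
Proof.
case: k => [|k]; first by rewrite /harmonic_sum big_ord0 ln0 // addr0.
elim: k => [|k IH]; first by rewrite /harmonic_sum big_ord1 invr1 ln1 addr0.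
rewrite harmonic_sumS; apply: le_trans (lerD IH (lexx _)) _.
rewrite -addrA lerD2l.
have k0 : 0 < k.+1%:R :> R by rewrite ltr0n.
have k1 : 0 < k.+2%:R :> R by rewrite ltr0n.
have h : ln (k.+1%:R / k.+2%:R) <= k.+1%:R / k.+2%:R - 1 :> R.
  have : 0 < k.+1%:R / k.+2%:R :> R by rewrite divr_gt0.
  move: (k.+1%:R / k.+2%:R) => r r0.
  have := @le_ln1Dx R (r - 1).
  have -> : 1 + (r - 1) = r by ring.
  by apply; lra.
rewrite ln_div ?posrE // in h.
have E : k.+1%:R / k.+2%:R - 1 = - k.+2%:R^-1 :> R.
  have -> : k.+2%:R = k.+1%:R + 1 :> R by rewrite natr1.
  by move: (k.+1%:R) k0 => y y0; field; apply: lt0r_neq0; lra.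
move: h; rewrite E; move: (ln k.+1%:R) (ln k.+2%:R) (k.+2%:R^-1) => x y z.
lra.
Qed.

Section GraphBound.
Variables (R : realType) (n : nat) (ds : 'I_n -> nat) (G : {set {set 'I_n}}).
Local Notation V := 'I_n.
Local Notation GS := (graphs_with ds).
Let Dl := max_deg ds.
Let dl := min_deg ds.
Let w := min_deg_weight R G.
Let c u v : R := if adj G u v then w u v else 0.
Hypothesis GG : G \in GS.
Hypothesis dl3 : (3 <= dl)%N.
Hypothesis n0 : (0 < n)%N.

Lemma min_deg_le i : (dl <= ds i)%N.
Proof.
rewrite /dl /min_deg; elim: (index_enum _) (mem_index_enum i) => // j r IH.
rewrite inE big_cons => /orP[/eqP <-|/IH h]; first exact: geq_minl.
exact: leq_trans (geq_minr _ _) h.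
Qed.

Let ds_gt0 i : (0 < ds i)%N.
Proof. by apply: leq_trans (min_deg_le i); apply: leq_trans dl3. Qed.

Let Dl_gt0 : (0 < Dl)%N.
Proof. exact: leq_trans (ds_gt0 (Ordinal n0)) (ds_max _ _). Qed.

Let sG : simple_graph G := graphs_with_simple GG.

Let vd u : vdeg G u = ds u := graphs_with_vdeg u GG.

Let min_gt0 u v : (0 < minn (vdeg G u) (vdeg G v))%N.
Proof. by rewrite !vd leq_min !ds_gt0. Qed.

Let c_ge0 u v : 0 <= c u v.
Proof. by rewrite /c; case: ifP => // _; rewrite divr_ge0. Qed.

Let c_sym u v : c u v = c v u.
Proof. by rewrite /c adj_sym /w /min_deg_weight minnC. Qed.

Let wt_le u : wt c u <= Dl%:R.
Proof.
apply: (@le_trans _ _ ((\sum_v adj G u v)%N%:R)); last by rewrite ler_nat sum_adj_le.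
rewrite natr_sum; apply: ler_sum => v _; rewrite /c; case: ifP => // _.
by rewrite /w /min_deg_weight ler_pdivrMr ?ltr0n // mul1r ler1n.
Qed.

(** Here the weighting scheme enters: 1/min(a, b) <= 1/a + 1/b, and the terms 1/d(u) over the
    neighbours of u add up to 1. *)
Let sum_wt_le : \sum_u wt c u <= 2 * n%:R.
Proof.
have one (u : V) : \sum_v (adj G u v)%:R * (ds u)%:R^-1 = 1 :> R.
  rewrite -mulr_suml -natr_sum (sum_adj u GG) divff // pnatr_eq0 -lt0n; exact: ds_gt0.
apply: (@le_trans _ _ (\sum_u (\sum_v (adj G u v)%:R * (ds u)%:R^-1)
    + \sum_v (\sum_u (adj G v u)%:R * (ds v)%:R^-1))).
  rewrite [X in _ <= _ + X]exchange_big -big_split; apply: ler_sum => u _ /=.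
  rewrite -big_split; apply: ler_sum => v _ /=.
  rewrite /c /w /min_deg_weight !vd adj_sym; case: (adj G v u); last by rewrite !mul0r addr0.
  rewrite !mul1r; case: (leqP (ds u) (ds v)) => _.
    by rewrite lerDl invr_ge0.
  by rewrite lerDr invr_ge0.
under eq_bigr => u _ do rewrite one.
by rewrite sumr_const card_ord -mulr2n -[X in X *+ 2 <= _]mulr_natl mulr1 mulr_natl.
Qed.

Let wt_gt0 u : 0 < wt c u.
Proof.
have : (0 < #|[set v | adj G u v]|)%N by rewrite -/(vdeg G u) vd.
rewrite card_gt0 => /set0Pn[v]; rewrite inE => uv.
rewrite /wt (bigD1 v) //= ltr_pwDl //; last by apply: sumr_ge0 => *; exact: c_ge0.
by rewrite /c uv /w /min_deg_weight divr_gt0 // ltr0n.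
Qed.

Let trans_probE : trans_prob G w = fun u v => c u v / wt c u.
Proof.
apply/funext => u; apply/funext => v; rewrite /trans_prob /c.
case: ifP => uv; last by rewrite mul0r.
by congr (_ / _); rewrite /wt big_mkcond.
Qed.

Variables (L b : nat).
Hypothesis L0 : (0 < L)%N.
Let B := lasso_starts G L.*2.+1.
Hypothesis hB : (#|B| <= b)%N.
Hypothesis not_sparse : forall X, X != set0 -> (dvol ds X <= (\sum_i ds i)./2)%N ->
  (dvol ds X <= 1024 * #|cutset G X|)%N.

Let lam : R := (1024 ^+ 2 * Dl%:R)^-1.

Let volE X : vol (adj G) X = dvol ds X.
Proof. by apply: eq_bigr => u _; rewrite (sum_adj u GG). Qed.

Let cutE X : cut (adj G) X = #|cutset G X|.
Proof.
rewrite -sum_cutset /cut big_mkcond; apply: eq_bigr => u _.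
case: (boolP (u \in X)) => uX; last first.
  by rewrite big1 // => v _; rewrite inE /= (negbTE uX).
rewrite big_mkcond; apply: eq_bigr => v _; rewrite !inE /= uX /=.
by case: (v \in X); case: (adj G u v).
Qed.

Let poincareG : poincare c lam.
Proof.
have := @cheeger R V (adj G) (@adj_sym _ G) 1024 _ c Dl%:R; apply => //.
- move=> X; rewrite !volE cutE => h.
  have [->|X0] := eqVneq X set0; first by rewrite /dvol big_set0.
  apply: not_sparse => //.
  have E : (dvol ds setT = \sum_i ds i)%N by apply: eq_bigl => i; rewrite inE.
  by rewrite E in h; rewrite geq_half_double -mul2n.
- by rewrite ltr0n.
- move=> u v; rewrite /c; case: (adj G u v); last by rewrite mulr0.
  rewrite /w /min_deg_weight mulrA mulr1 ler_pdivlMr ?ltr0n // mul1r ler_nat !vd.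
  by apply: leq_trans (geq_minl _ _) (ds_max _ _).
- by move=> u; rewrite (sum_adj u GG).
Qed.

Let q : R := dl.-1%:R.
Let Rs : R := q / (q - 1).

Let spread_off_lasso a : a \notin B -> spread_source c Rs (2 ^+ L)^-1 a.
Proof.
move=> aB; apply: (@spread_source_lasso_free V (adj G) (@adj_sym _ G) (adj_irr sG) R a L dl) => //.
- move=> s sL; apply: contra aB => ls.
  rewrite inE; apply/existsP; exists (Ordinal (sL : size s < L.*2.+2)%N).
  by apply/existsP; exists (in_tuple s).
- by move=> u; rewrite -/(vdeg G u) vd min_deg_le.
Qed.

Variable tau2 : R.
Hypothesis tau2E : tau2 = 2 * (1024 ^+ 2 * Dl%:R).
Let tau : R := Num.sqrt tau2.
Let rho : R := Num.sqrt Rs + Num.sqrt (2 ^+ L)^-1 * tau.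

Lemma COV_good : (0 < b)%N ->
  (COV G w <= ((2 * rho * (2 * rho * (2 * n%:R) + (rho + tau) * (b%:R * Dl%:R))
     + 4 * tau2 * (b%:R * Dl%:R)) * (1 + ln n%:R)
     + 4 * tau2 * (2 * n%:R) * (1 + ln b%:R))%:E)%E.
Proof.
move=> b0; apply: COV_le; rewrite trans_probE.
- by move=> u v; rewrite divr_ge0 // ltW.
- by move=> u; rewrite -mulr_suml divff // gt_eqF // wt_gt0.
move=> u t.
have q2 : 2 <= q by rewrite /q ler_nat; lia.
have Rs0 : 0 <= Rs by rewrite /Rs divr_ge0 //; lra.
have ep0 : 0 <= (2 ^+ L)^-1 :> R by rewrite invr_ge0 exprn_ge0.
have K0 : 0 < 1024 ^+ 2 :> R by apply: exprn_gt0; rewrite ltr0n.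
have lam0 : 0 < lam by rewrite /lam invr_gt0; apply: mulr_gt0; last by rewrite ltr0n.
have uA : u \notin ~: [set u] by rewrite !inE eqxx.
apply: le_trans (trunc_cover_bound c_ge0 c_sym lam0 poincareG Rs0 ep0 spread_off_lasso wt_gt0 t uA) _.
have tE : 2 / lam = tau2 by rewrite /lam invrK tau2E.
have tau20 : 0 <= tau2 by rewrite -tE; apply: divr_ge0; [lra | exact: ltW].
have tau0 : 0 <= tau by exact: sqrtr_ge0.
have rho0 : 0 <= rho by rewrite addr_ge0 ?mulr_ge0 ?sqrtr_ge0.
rewrite /fast_hit tE -/tau -/rho sqr_sqrtr //.
have wB : \sum_(z in B) wt c z <= b%:R * Dl%:R.
  apply: (@le_trans _ _ (\sum_(z in B) Dl%:R)); first by apply: ler_sum => z _.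
  by rewrite sumr_const -[leLHS]mulr_natl ler_wpM2r // ler_nat.
have wB0 : 0 <= \sum_(z in B) wt c z by apply: sumr_ge0 => z _; exact: wt_ge0.
have W0 : 0 <= \sum_z wt c z by apply: sumr_ge0 => z _; exact: wt_ge0.
have h0 k : 0 <= harmonic_sum R k by apply: sumr_ge0 => *; rewrite invr_ge0.
have lnb : harmonic_sum R #|B| <= 1 + ln b%:R.
  case: (posnP #|B|) => [->|B0].
    by rewrite /harmonic_sum big_ord0 addr_ge0 // ln_ge0 // ler1n.
  apply: le_trans (harmonic_sum_le _ _) _; rewrite lerD2l.
  by rewrite ler_ln ?posrE ?ltr0n // ler_nat.
apply: lerD.
  apply: ler_pM => //.
  - by rewrite !(addr_ge0, mulr_ge0).
  - apply: lerD; last by rewrite ler_wpM2l // mulr_ge0.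
    apply: ler_wpM2l; first by rewrite mulr_ge0.
    apply: lerD; first by rewrite ler_wpM2l // mulr_ge0.
    by rewrite ler_wpM2l // addr_ge0.
  - by rewrite card_ord; exact: harmonic_sum_le.
apply: ler_pM => //; first by rewrite !mulr_ge0.
by rewrite ler_wpM2l // mulr_ge0.
Qed.

End GraphBound.

(** * Asymptotics of the error terms *)

Section Asymptotics.
Variable R : realType.

Definition tau_const : R := 2 * 1024 ^+ 2.

(** Bounds the part of [rho] due to the spread of the flow, [Num.sqrt (2 ^+ L)^-1 * tau], when the
    maximum degree is at most [L]. *)
Definition error_sqrt (L : nat) : R := Num.sqrt (tau_const * (L%:R / 2 ^+ L)).

(** The product comes from the square of [rho] and from replacing 1 + ln n by ln n. The last term
    collects the exceptional vertices: multiplied by 8 it has the constant 96, which covers 58 +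
    32. *)
Definition error_term (L : nat) : R :=
  (1 + error_sqrt L) ^+ 2 * (1 + 2 * (1 / 2) ^+ L) - 1 +
  12 * tau_const * (L%:R ^+ 4 / 2 ^+ L).

Lemma tau_const_ge1 : 1 <= tau_const.
Proof.
have : 1 <= 1024 ^+ 2 :> R by apply: exprn_ege1; rewrite ler1n.
by rewrite /tau_const; lra.
Qed.

Lemma cvg_pow_div_exp k : (k <= 4)%N ->
  ((L%:R ^+ k / 2 ^+ L : R) @[L --> \oo] --> (0 : R))%classic.
Proof.
(* Bernoulli's inequality gives L <= 50 (51/50)^L, and (51/50)^4 is less than 2. *)
move=> k4; pose r : R := (51 / 50) ^+ 4 / 2.
have r0 : 0 <= r by rewrite /r; lra.
have r1 : `|r| < 1 by rewrite ger0_norm // /r; lra.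
apply: (@squeeze_cvgr _ _ _ _ (fun=> 0) (fun L => 50 ^+ 4 * r ^+ L)).
- near=> L.
  have L0 : (0 < L)%N by near: L; exact: nbhs_infty_gt.
  have p0 : 0 < 2 ^+ L :> R by apply: exprn_gt0.
  apply/andP; split; first by apply: divr_ge0; [exact: exprn_ge0 | exact: ltW].
  rewrite /r expr_div_n mulrA ler_pM2r ?invr_gt0 //.
  apply: (@le_trans _ _ (L%:R ^+ 4)); first by apply: ler_weXn2l => //; rewrite ler1n.
  rewrite -exprM mulnC exprM -exprMn; apply: lerXn2r; rewrite ?nnegrE //.
  have h50 : 0 <= 1 / 50 :> R by lra.
  have := bernoulli_ineq L h50.
  have -> : 1 + 1 / 50 = 51 / 50 :> R by field.
  lra.
- exact: cvg_cst.
- rewrite -(mulr0 (50 ^+ 4)); apply: cvgMr; exact: cvg_expr.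
Unshelve. all: by end_near.
Qed.

Lemma cvg_error_sqrt : (error_sqrt L @[L --> \oo] --> (0 : R))%classic.
Proof.
have h : ((tau_const * (L%:R / 2 ^+ L)) @[L --> \oo] --> (0 : R))%classic.
  rewrite -(mulr0 tau_const); apply: cvgMr.
  have := @cvg_pow_div_exp 1 isT; apply: cvg_trans; apply: near_eq_cvg.
  by near=> L; rewrite expr1.
have := cvg_comp _ _ h (@sqrt_continuous R 0).
by rewrite sqrtr0.
Unshelve. all: by end_near.
Qed.

Lemma cvg_error_term : (error_term L @[L --> \oo] --> (0 : R))%classic.
Proof.
have -> : (0 : R) = (1 + 0) ^+ 2 * (1 + 2 * 0) - 1 + 12 * tau_const * 0 by ring.
apply: cvgD; last by apply: cvgMr; exact: cvg_pow_div_exp.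
apply: cvgB; last exact: cvg_cst.
apply: cvgM; last first.
  apply: cvgD; first exact: cvg_cst.
  apply: cvgMr; apply: cvg_expr; rewrite ger0_norm; lra.
have h : ((1 + error_sqrt L) @[L --> \oo] --> (1 + 0 : R))%classic.
  by apply: cvgD; [exact: cvg_cst | exact: cvg_error_sqrt].
by rewrite expr2; apply: cvg_trans (cvgM h h); apply: near_eq_cvg; near=> L; rewrite expr2.
Unshelve. all: by end_near.
Qed.

Lemma hitting_bound (n lnn lnb bD Rs rho tau tau2 : R) (L : nat) :
  (10 <= L)%N -> 0 < n -> 1 <= Rs -> Rs <= 2 -> 0 <= tau2 -> tau = Num.sqrt tau2 ->
  tau2 <= tau_const * L%:R ->
  rho = Num.sqrt Rs + Num.sqrt (2 ^+ L)^-1 * tau ->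
  0 <= bD -> bD <= n * (L%:R / 2 ^+ L) -> 2 ^+ L <= 2 * lnn -> lnb <= L%:R ^+ 3 ->
  (2 * rho * (2 * rho * (2 * n) + (rho + tau) * bD) + 4 * tau2 * bD) * (1 + lnn)
    + 4 * tau2 * (2 * n) * (1 + lnb)
  <= (1 + error_term L) * Rs * (8 * n * lnn).
Proof.
move=> L10 n0 Rs1 Rs2 tau20 tauE tau2L rhoE bD0 bDL lnnX lnbL.
have T1 := tau_const_ge1.
have [T TE] : exists T, T = tau_const by exists tau_const.
rewrite -TE in T1 tau2L.
have X0 : 0 < 2 ^+ L :> R by apply: exprn_gt0.
have Ll : 10 <= L%:R :> R by rewrite (ler_nat R 10).
have LX : L%:R <= 2 ^+ L :> R.
  by rewrite -natrX ler_nat ltnW // ltn_expl.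
have [X XE] : exists X : R, X = 2 ^+ L by exists (2 ^+ L).
rewrite -XE in X0 bDL lnnX LX rhoE.
have [l lE] : exists l : R, l = L%:R by exists L%:R.
rewrite -lE in tau2L bDL lnbL Ll LX.
have [x xdef] : exists x, x = error_sqrt L by exists (error_sqrt L).
have xE : x ^+ 2 = T * (l / X).
  rewrite xdef /error_sqrt -TE -XE -lE sqr_sqrtr //; apply: mulr_ge0; first exact: le_trans ler01 T1.
  by apply: divr_ge0; [lra | exact: ltW].
have x0 : 0 <= x by rewrite xdef; exact: sqrtr_ge0.
have tau0 : 0 <= tau by rewrite tauE; exact: sqrtr_ge0.
have tauSq : tau ^+ 2 = tau2 by rewrite tauE sqr_sqrtr.
have lX1 : l / X <= 1 by rewrite ler_pdivrMr // mul1r.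
have lX0 : 0 <= l / X by apply: divr_ge0; [lra | exact: ltW].
have sR0 : 1 <= Num.sqrt Rs by rewrite -[X in X <= _]sqrtr1 ler_sqrt //; lra.
have sRsq : Num.sqrt Rs ^+ 2 = Rs by rewrite sqr_sqrtr //; lra.
have st : Num.sqrt X^-1 * tau <= x.
  have iX : 0 <= X^-1 by rewrite invr_ge0 ltW.
  rewrite tauE -sqrtrM // xdef /error_sqrt -TE -XE -lE; apply: ler_wsqrtr.
  by rewrite mulrC mulrA; apply: ler_wpM2r.
have rho1 : rho <= Num.sqrt Rs * (1 + x).
  rewrite rhoE; nra.
have rho0 : 0 <= rho.
  by rewrite rhoE addr_ge0 // mulr_ge0 // sqrtr_ge0.
have rhoSq : rho ^+ 2 <= Rs * (1 + x) ^+ 2.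
  rewrite -sRsq -exprMn; apply: lerXn2r; rewrite ?nnegrE // mulr_ge0 //; lra.
have rhoT : rho ^+ 2 <= 4 + 4 * T.
  apply: le_trans rhoSq _.
  have h1 : (1 + x) ^+ 2 <= 2 + 2 * x ^+ 2 by have := sqr_ge0 (1 - x); rewrite !expr2; lra.
  have h2 : x ^+ 2 <= T by rewrite xE; apply: ler_piMr => //; lra.
  apply: (@le_trans _ _ (2 * (2 + 2 * T))); last by lra.
  by apply: ler_pM => //; [lra | exact: sqr_ge0 | lra].
have lnn1 : 1 <= lnn by lra.
have [T0 l0 n0' lnn0 Rs0] : [/\ 0 <= T, 0 <= l, 0 <= n, 0 <= lnn & 0 <= Rs] by split; lra.
have iX : 0 <= X^-1 by rewrite invr_ge0 ltW.
have l40 : 0 <= l ^+ 4 by exact: exprn_ge0.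
have l30 : 0 <= l ^+ 3 by exact: exprn_ge0.
(* Trades every term without [lnn] for one with [lnn] and the small factor 2/X. *)
have y1 : 1 <= lnn * (2 / X).
  by rewrite mulrA ler_pdivlMr // mul1r mulrC.
have Tl : T <= T * l by apply: ler_peMr; lra.
have Tl10 : 10 <= T * l by nra.
have term1 : 8 * n * rho ^+ 2 * (1 + lnn) <=
    (1 + x) ^+ 2 * (1 + 2 * (1 / 2) ^+ L) * Rs * (8 * n * lnn).
  have -> : (1 / 2) ^+ L = X^-1 by rewrite div1r exprVn XE.
  have -> : (1 + x) ^+ 2 * (1 + 2 * X^-1) * Rs * (8 * n * lnn) =
     8 * n * (Rs * (1 + x) ^+ 2) * (lnn + lnn * (2 / X)) by ring.
  apply: ler_pM.
  - by rewrite mulr_ge0 ?sqr_ge0 // mulr_ge0 //; lra.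
  - lra.
  - by apply: ler_wpM2l => //; rewrite mulr_ge0 //; lra.
  - lra.
have term2 : (2 * rho * ((rho + tau) * bD) + 4 * tau2 * bD) * (1 + lnn) <=
    58 * T * l * (n * (l / X)) * lnn.
  have -> : 2 * rho * ((rho + tau) * bD) + 4 * tau2 * bD =
    (2 * rho ^+ 2 + 2 * (rho * tau) + 4 * tau2) * bD by ring.
  (* The left side is at most 3 rho^2 + 5 tau2 <= 12 + 12 T + 5 T l, and both 1 and T are at most T
     l, so 29 = 12 + 12 + 5. *)
  have h : 2 * rho ^+ 2 + 2 * (rho * tau) + 4 * tau2 <= 29 * (T * l).
    have : 2 * (rho * tau) <= rho ^+ 2 + tau2.
      by rewrite -tauSq; have := sqr_ge0 (rho - tau); rewrite !expr2; lra.
    by lra.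
  have h0 : 0 <= 2 * rho ^+ 2 + 2 * (rho * tau) + 4 * tau2.
    have := sqr_ge0 rho; have := mulr_ge0 rho0 tau0; lra.
  apply: (@le_trans _ _ (29 * (T * l) * (n * (l / X)) * (2 * lnn))); last first.
    by rewrite le_eqVlt; apply/orP; left; apply/eqP; ring.
  apply: ler_pM; [exact: mulr_ge0 | lra | exact: ler_pM | lra].
have term3 : 4 * tau2 * (2 * n) * (1 + lnb) <= 32 * T * l ^+ 4 / X * n * lnn.
  have l3 : 1 <= l ^+ 3 by apply: exprn_ege1; lra.
  apply: (@le_trans _ _ (8 * (T * l) * n * (2 * l ^+ 3))).
    apply: (@le_trans _ _ (4 * tau2 * (2 * n) * (2 * l ^+ 3))).
      by apply: ler_wpM2l; [do !apply: mulr_ge0 => // | lra].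
    apply: ler_wpM2r; first lra.
    have -> : 4 * tau2 * (2 * n) = 8 * tau2 * n by ring.
    by rewrite ler_pM2r // ler_pM2l.
  have -> : 32 * T * l ^+ 4 / X * n * lnn = 8 * (T * l) * n * (2 * l ^+ 3) * (lnn * (2 / X)).
    by ring.
  by apply: ler_peMr => //; do !apply: mulr_ge0 => //.
have l4 : l * l <= l ^+ 4.
  by rewrite -expr2; apply: ler_weXn2l; [lra |].
have term23 : 58 * T * l * (n * (l / X)) * lnn <= 58 * T * l ^+ 4 / X * n * lnn.
  have -> : 58 * T * l * (n * (l / X)) * lnn = (58 * T / X * n * lnn) * (l * l) by ring.
  have -> : 58 * T * l ^+ 4 / X * n * lnn = (58 * T / X * n * lnn) * l ^+ 4 by ring.
  by apply: ler_wpM2l => //; do !apply: mulr_ge0 => //.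
have -> : (2 * rho * (2 * rho * (2 * n) + (rho + tau) * bD) + 4 * tau2 * bD) * (1 + lnn)
   = 8 * n * rho ^+ 2 * (1 + lnn) +
     (2 * rho * ((rho + tau) * bD) + 4 * tau2 * bD) * (1 + lnn) by ring.
have -> : (1 + error_term L) * Rs * (8 * n * lnn) =
   (1 + x) ^+ 2 * (1 + 2 * (1 / 2) ^+ L) * Rs * (8 * n * lnn)
   + Rs * (96 * T * l ^+ 4 / X * n * lnn).
  by rewrite /error_term -xdef -TE -lE -XE; ring.
have last : 96 * T * l ^+ 4 / X * n * lnn <= Rs * (96 * T * l ^+ 4 / X * n * lnn).
  by apply: ler_peMl => //; do !apply: mulr_ge0 => //.
have e : 58 * T * l ^+ 4 / X * n * lnn + 32 * T * l ^+ 4 / X * n * lnn <=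
   96 * T * l ^+ 4 / X * n * lnn.
  have p : 0 <= T * l ^+ 4 / X * n * lnn by do !apply: mulr_ge0 => //.
  have -> : 58 * T * l ^+ 4 / X * n * lnn = 58 * (T * l ^+ 4 / X * n * lnn) by ring.
  have -> : 32 * T * l ^+ 4 / X * n * lnn = 32 * (T * l ^+ 4 / X * n * lnn) by ring.
  have -> : 96 * T * l ^+ 4 / X * n * lnn = 96 * (T * l ^+ 4 / X * n * lnn) by ring.
  lra.
rewrite -addrA; apply: lerD => //; apply: le_trans last; apply: le_trans e.
by apply: lerD => //; apply: le_trans term2 term23.
Qed.

End Asymptotics.

(** The induction starts at 1010 <= 1024. The inequality turns 2^(2^L) <= n into 2^(L^3) 2^L <= n,
    which makes up to 2^(L^3) exceptional vertices negligible. *)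
Lemma cube_le_exp2 L : (10 <= L)%N -> (L ^ 3 + L <= 2 ^ L)%N.
Proof.
move=> L10; rewrite -(subnKC L10); elim: (L - 10)%N => [|k IH]; first by [].
rewrite addnS expnS; apply: leq_trans (_ : 2 * ((10 + k) ^ 3 + (10 + k)) <= _)%N; last first.
  by rewrite leq_mul2l IH.
by rewrite !expnS !expn0; nia.
Qed.

(** * Probability that both bad events fail *)

Section Final.
Variables (R : realType) (n : nat) (ds : 'I_n -> nat) (L : nat).
Local Notation V := 'I_n.
Local Notation GS := (graphs_with ds).
Let Dl := max_deg ds.
Hypothesis ds_even : ~~ odd (\sum_i ds i)%N.
Hypothesis dl3 : (3 <= min_deg ds)%N.
Hypothesis DL : (Dl <= L)%N.
Hypothesis L10 : (10 <= L)%N.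
Hypothesis nL : (2 ^ (2 ^ L) <= n)%N.

Let nL3 : (2 ^ (L ^ 3 + L) <= n)%N.
Proof. by apply: leq_trans nL; rewrite leq_exp2l // cube_le_exp2. Qed.

Let n0 : (0 < n)%N.
Proof. by apply: leq_trans nL; rewrite expn_gt0. Qed.

Let ds3 i : (3 <= ds i)%N.
Proof. exact: leq_trans dl3 (min_deg_le _ i). Qed.

Let L2 : (L < 2 ^ L)%N.
Proof. exact: ltn_expl. Qed.

Let poly_n : ((2 * L ^ 2 * 101) ^ 2 <= n)%N.
Proof.
apply: leq_trans nL3.
have h : (2 * L ^ 2 * 101 <= 2 ^ (8 + 2 * L))%N.
  rewrite expnD mulnAC; apply: leq_mul => //.
  by rewrite mulnC expnM leq_exp2r // ltnW.
apply: (@leq_trans ((2 ^ (8 + 2 * L)) ^ 2)); first by rewrite leq_exp2r.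
rewrite -expnM leq_exp2l //.
have : (100 * L <= L ^ 3)%N by rewrite 2!expnS expn1 mulnA leq_mul2r; apply/orP; right; nia.
lia.
Qed.

Let poly_n' : (202 * L ^ 2 <= n)%N.
Proof.
apply: leq_trans poly_n; rewrite -[X in (X <= _)%N]expn1 mulnAC.
have : (0 < 2 * 101 * L ^ 2)%N by rewrite muln_gt0 expn_gt0; lia.
by move: (2 * 101 * L ^ 2)%N => y y0; rewrite leq_pexp2l.
Qed.

Let sum_ds : (3 * n <= \sum_i ds i)%N.
Proof.
rewrite -[X in (3 * X)%N](card_ord n) mulnC -sum_nat_const; exact: leq_sum.
Qed.

Let Dl2 : (Dl ^ 2 <= L ^ 2)%N.
Proof. by rewrite leq_exp2r. Qed.

Let Dl0 : (0 < Dl)%N.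
Proof. by apply: leq_trans (ds_max ds (Ordinal n0)); apply: leq_trans (ds3 _). Qed.

Let k := L.*2.+1.

Let many_lasso : {set {set {set V}}} :=
  [set G in GS | 2 ^ (L ^ 3) < #|lasso_starts G k|]%N.

(** Markov's inequality. The mean number of lasso starts has a binary logarithm of order L^2, at
    most 4L^2 + 4L <= L^3 - L, against the threshold 2^(L^3). *)
Lemma card_many_lasso : (#|many_lasso| * 2 ^ L <= #|GS|)%N.
Proof.
have h : (\sum_(G in GS) #|lasso_starts G k| <= #|GS| * (k.+1 * k * Dl ^ (2 * k)))%N.
  apply: sum_lasso_starts => //.
  apply: leq_trans sum_ds.
  have := poly_n'; have := Dl2; rewrite /k -/Dl.
  have : (L <= L ^ 2)%N by rewrite expnS expn1 leq_pmulr //; lia.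
  by move: (L ^ 2)%N (Dl ^ 2)%N => y z; lia.
have h2 : (#|many_lasso| * 2 ^ (L ^ 3) <= \sum_(G in GS) #|lasso_starts G k|)%N.
  rewrite -sum_nat_const big_mkcond [leqRHS]big_mkcond; apply: leq_sum => G _.
  case: ifP => // /[!inE] /andP[]; rewrite -in_set; move=> GG /ltnW h'.
  by move: GG; rewrite inE => ->.
have h3 : (k.+1 * k * Dl ^ (2 * k) <= 2 ^ (L ^ 3 - L))%N.
  apply: (@leq_trans (2 ^ L * 2 ^ L * (2 ^ L) ^ (2 * k))).
    have kL : (k.+1 <= 2 ^ L)%N.
      apply: leq_trans (cube_le_exp2 L10); rewrite /k !expnS expn0; nia.
    apply: leq_mul; first by apply: leq_mul => //; exact: ltnW.
    by rewrite leq_exp2r // ltnW // (leq_ltn_trans DL).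
  rewrite -!expnD -expnM -expnD leq_exp2l // /k.
  have : (10 * (L * L) <= L ^ 3)%N by rewrite !expnS expn0 muln1 leq_mul2r L10 orbT.
  have : (10 * L <= L * L)%N by rewrite leq_mul2r L10 orbT.
  have -> : (L + L + L * (2 * L.*2.+1) = 4 * L + 4 * (L * L))%N.
    by rewrite -mul2n; ring.
  by move: (L ^ 3)%N (L * L)%N => y z; lia.
have p : (0 < 2 ^ (L ^ 3 - L))%N by rewrite expn_gt0.
rewrite -(leq_pmul2r p) -mulnA -expnD subnKC; last first.
  by rewrite -[X in (X <= _)%N]expn1 leq_pexp2l //; lia.
apply: leq_trans h2 _; apply: leq_trans h _.
by rewrite leq_mul2l h3 orbT.
Qed.

Let bnd : \bar R := ((1 + error_term R L)
              * (((min_deg ds)%:R - 1) / ((min_deg ds)%:R - 2))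
              * (8 * n%:R * ln n%:R))%:E.

Lemma ln2_bounds : 1 / 2 <= ln 2 :> R /\ ln 2 <= 1 :> R.
Proof.
split.
  have := @le_ln1Dx R (- (1 / 2)).
  have -> : 1 + - (1 / 2) = 2^-1 :> R by field.
  have h12 : -1 < - (1 / 2) :> R by lra.
  rewrite lnV ?posrE // => /(_ h12) h; lra.
have := @le_ln1Dx R 1; have -> : 1 + 1 = 2 :> R by ring.
by apply; lra.
Qed.

Lemma COV_final G : G \in GS -> G \notin many_lasso -> G \notin sparse_some ds ->
  (COV G (min_deg_weight R G) <= bnd)%E.
Proof.
move=> GG nl ns.
have hB : (#|lasso_starts G k| <= 2 ^ (L ^ 3))%N.
  by move: nl; rewrite inE GG /= -leqNgt.
have hS X : X != set0 -> (dvol ds X <= (\sum_i ds i)./2)%N ->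
    (dvol ds X <= 1024 * #|cutset G X|)%N.
  move=> X0 Xm; rewrite leqNgt; apply: contra ns => Xc.
  by rewrite in_set GG /=; apply/existsP; exists X; rewrite X0 Xm in_set GG.
have L0 : (0 < L)%N by lia.
have b0 : (0 < 2 ^ (L ^ 3))%N by rewrite expn_gt0.
have [t2 t2E] : exists t2 : R, t2 = 2 * (1024 ^+ 2 * (max_deg ds)%:R) by eexists.
apply: le_trans (COV_good GG dl3 n0 L0 hB hS t2E b0) _.
rewrite lee_fin.
have q2 : 2 <= (min_deg ds).-1%:R :> R by rewrite ler_nat; lia.
have qE : (min_deg ds).-1%:R = (min_deg ds)%:R - 1 :> R.
  by rewrite -[in RHS](prednK (ltnW (ltnW dl3))) -natr1 addrK.
have RsE : ((min_deg ds)%:R - 1) / ((min_deg ds)%:R - 2) =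
    (min_deg ds).-1%:R / ((min_deg ds).-1%:R - 1) :> R.
  by rewrite qE; congr (_ / _); ring.
rewrite RsE; move: ((min_deg ds).-1%:R) q2 => q q2.
have [lnl lnu] := ln2_bounds.
have lnn : 2 ^+ L <= 2 * ln n%:R :> R.
  have h : ln ((2 ^ (2 ^ L))%N%:R) <= ln n%:R :> R.
    by rewrite ler_ln ?posrE ?ltr0n ?expn_gt0 // ler_nat.
  rewrite natrX lnXn // in h.
  rewrite -[ln 2 *+ _]mulr_natl natrX in h.
  apply: (@le_trans _ _ (2 * (2 ^+ L * ln 2))); last by rewrite ler_pM2l.
  have : 0 <= 2 ^+ L :> R by apply: exprn_ge0.
  by nra.
have K0 : 0 <= 2 * 1024 ^+ 2 :> R.
  by apply: mulr_ge0; [exact: ler0n | apply: exprn_ge0; exact: ler0n].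
apply: (@hitting_bound R n%:R (ln n%:R) (ln (2 ^ (L ^ 3))%:R)
   ((2 ^ (L ^ 3))%:R * (max_deg ds)%:R) _ _ _ t2 L).
- exact: L10.
- by rewrite ltr0n.
- by rewrite ler_pdivlMr ?mul1r; lra.
- by rewrite ler_pdivrMr; lra.
- by rewrite t2E mulrA; apply: mulr_ge0; [exact: K0 | exact: ler0n].
- by [].
- rewrite t2E /tau_const [leLHS]mulrA; apply: ler_wpM2l; first exact: K0.
  by rewrite ler_nat.
- by [].
- by apply: mulr_ge0; exact: ler0n.
- rewrite mulrA ler_pdivlMr ?exprn_gt0 //.
  rewrite -natrX -!natrM ler_nat mulnAC; apply: leq_mul => //.
  by rewrite -expnD.
- exact: lnn.
- by rewrite natrX lnXn // -[leLHS]mulr_natl natrX ler_piMr // exprn_ge0.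
Qed.

Lemma good_prob :
  1 - (2 * sparse_const R / n%:R + (2 ^+ L)^-1) <=
    unif_prob R GS (fun G => (COV G (min_deg_weight R G) <= bnd)%E) <= 1.
Proof.
(* Without any graph the ratio would be 0/0 = 0 and the lower bound could fail. *)
have GS0 : (0 < #|GS|)%N.
  rewrite card_gt0; apply: graphs_with_neq0 => //.
    by move=> i; apply: leq_trans (ds3 i).
  apply: leq_trans poly_n'; rewrite -/Dl.
  apply: (@leq_trans (2 * L * (L + 2) + L + 2)).
    by rewrite !leq_add // leq_mul // ?leq_mul // leq_add.
  by rewrite expnS expn1; nia.
have GSR : 0 < #|GS|%:R :> R by rewrite ltr0n.
rewrite /unif_prob; set good := [set x in _ | _].
have sub : (#|GS| <= #|good| + #|many_lasso| + #|sparse_some ds|)%N.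
  apply: leq_trans (_ : #|good :|: many_lasso :|: sparse_some ds| <= _)%N.
    apply: subset_leq_card; apply/subsetP => G GG.
    rewrite !in_setU; case: (boolP (G \in many_lasso)) => nl; first by rewrite orbT.
    case: (boolP (G \in sparse_some ds)) => ns; first by rewrite !orbT.
    by rewrite in_set GG /= COV_final.
  rewrite cardsU; apply: leq_trans (leq_subr _ _) _; rewrite leq_add2r.
  by rewrite cardsU leq_subr.
have h1 := card_sparse_some R ds_even ds3 n0.
have m_large : ((2 * max_deg ds ^ 2 * 101) ^ 2 <= (\sum_i ds i)./2)%N.
  apply: (@leq_trans n); last by move: sum_ds; move: (\sum_i ds i)%N => s; lia.
  by apply: leq_trans poly_n; rewrite leq_exp2r // leq_mul2r leq_mul2l Dl2.
have {}h1 := h1 m_large.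
have h2 : #|many_lasso|%:R * 2 ^+ L <= #|GS|%:R :> R.
  by rewrite -natrX -natrM ler_nat card_many_lasso.
have nR : 0 < n%:R :> R by rewrite ltr0n.
have XR : 0 < 2 ^+ L :> R by apply: exprn_gt0.
apply/andP; split; last first.
  by rewrite ler_pdivrMr // mul1r ler_nat; apply: subset_leq_card; apply/subsetP => G; rewrite inE => /andP[].
rewrite ler_pdivlMr //.
have e1 : #|sparse_some ds|%:R <= 2 * sparse_const R / n%:R * #|GS|%:R :> R.
  by rewrite mulrAC ler_pdivlMr // mulrC.
have e2 : #|many_lasso|%:R <= (2 ^+ L)^-1 * #|GS|%:R :> R.
  by rewrite ler_pdivlMl // mulrC.
have e3 : #|GS|%:R <= #|good|%:R + #|many_lasso|%:R + #|sparse_some ds|%:R :> R.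
  by rewrite -!natrD ler_nat.
rewrite mulrBl mulrDl mul1r; lra.
Qed.

End Final.

Local Open Scope classical_set_scope.

(** * Choice of the radius and conclusion *)

Definition loglog (n : nat) : nat := trunc_log 2 (trunc_log 2 n).

Lemma cvg_loglog : loglog n @[n --> \oo] --> \oo.
Proof.
apply/cvgnyPge => A; near=> n.
rewrite /loglog; do 2 !apply: trunc_log_max => //.
near: n; exact: nbhs_infty_ge.
Unshelve. all: by end_near.
Qed.

Lemma loglog_exp n : (0 < loglog n)%N -> (2 ^ (2 ^ loglog n) <= n)%N.
Proof.
rewrite /loglog => l0.
have t0 : (0 < trunc_log 2 n)%N by move: l0; rewrite trunc_log_gt0 /=; exact: ltnW.
have n0 : (0 < n)%N by move: t0; rewrite trunc_log_gt0 /=; exact: ltnW.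
apply: leq_trans (trunc_logP (isT : 1 < 2)%N n0).
by rewrite leq_exp2l // trunc_logP.
Qed.

(** With L = [loglog n], ln n <= 2^(L+1), so ln ln n <= L + 1, and ln (L + 1) <= L. As [ln] is 0 at
    nonpositive reals, each level may assume a positive argument. *)
Lemma lnlnln_le (R : realType) n : (0 < loglog n)%N ->
  ln (ln (ln (n%:R : R))) <= (loglog n)%:R.
Proof.
move=> l0; have [lnl lnu] := ln2_bounds R.
have hn := loglog_exp l0.
have n0 : (0 < n)%N by apply: leq_trans hn; rewrite expn_gt0.
have mono (x y : R) : 0 < x -> x <= y -> ln x <= ln y.
  by move=> x0 xy; rewrite ler_ln ?posrE // (lt_le_trans x0).
have neg (x y : R) : 0 <= y -> (0 < x -> ln x <= y) -> ln x <= y.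
  by move=> y0 h; case: (ltrP 0 x) => [/h //|x0]; rewrite ln0.
have lnX j : ln ((2 ^ j)%N%:R) <= j%:R :> R.
  by rewrite natrX lnXn // -[leLHS]mulr_natl ler_piMr.
have h1 : ln n%:R <= (2 ^ (loglog n).+1)%N%:R :> R.
  apply: le_trans (lnX _); apply: mono; rewrite ?ltr0n // ler_nat.
  apply: ltnW; apply: leq_trans (trunc_log_ltn n (isT : 1 < 2)%N) _.
  by rewrite leq_exp2l // trunc_log_ltn.
apply: (neg) => // p3; apply: le_trans (mono _ (loglog n).+1%:R p3 _) _.
  apply: neg => // p2; apply: le_trans (lnX _); exact: mono.
have := @le_ln1Dx R (loglog n)%:R.
have -> : 1 + (loglog n)%:R = (loglog n).+1%:R :> R by rewrite nat1r.
by apply; apply: lt_le_trans (_ : 0 <= _) => //; lra.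
Qed.

Theorem theorem70 (R : realType) (alpha kappa : R) (d : nat)
    (ds : forall n : nat, 'I_n -> nat)
    (halpha : 0 < alpha < 1) (hkappa : 0 < kappa < 11^-1) (hd : (0 < d)%N)
    (hds : forall n : nat, degree_sequence (ds n))
    (hnice : nice alpha kappa d ds)
    (hmax : \forall n \near \oo,
      (max_deg (ds n))%:R <= (ln (ln (ln (n%:R : R)))) `^ 4^-1) :
  exists eps : nat -> R,
    (eps n @[n --> \oo] --> (0 : R)) /\
    (unif_prob R (graphs_with (ds n))
       (fun G => (COV G (min_deg_weight R G)
          <= ((1 + eps n)
              * (((min_deg (ds n))%:R - 1) / ((min_deg (ds n))%:R - 2))
              * (8 * n%:R * ln n%:R))%:E)%E)
     @[n --> \oo] --> (1 : R)).
Proof.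
exists (fun n => error_term R (loglog n)); split.
  exact: (cvg_comp _ _ cvg_loglog (@cvg_error_term R)).
apply: (@squeeze_cvgr _ _ _ _
  (fun n => 1 - (2 * sparse_const R / n%:R + (2 ^+ (loglog n))^-1)) (fun=> 1)); last 2 first.
- rewrite -[X in _ --> X](_ : 1 - (2 * sparse_const R * 0 + 0) = 1); last by ring.
  apply: cvgB; first exact: cvg_cst.
  apply: cvgD.
    apply: cvgMr; rewrite -(cvg_shiftS _ _); exact: cvg_harmonic.
  have h : ((1 / 2 : R) ^+ L @[L --> \oo] --> (0 : R)).
    by apply: cvg_expr; rewrite ger0_norm; lra.
  have := cvg_comp _ _ cvg_loglog h; apply: cvg_trans; apply: near_eq_cvg.
  by near=> n; rewrite /= div1r exprVn.
- exact: cvg_cst.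
near=> n.
have L10 : (10 <= loglog n)%N.
  by near: n; move/cvgnyPge: cvg_loglog; apply.
have l0 : (0 < loglog n)%N by lia.
have dl3 : (3 <= min_deg (ds n))%N by near: n; exact: (nice_min hnice).
have hD : (max_deg (ds n))%:R <= (ln (ln (ln (n%:R : R)))) `^ 4^-1 by near: n.
have [_ ev] := hds n.
apply: good_prob => //; last exact: loglog_exp.
rewrite -(ler_nat R); apply: le_trans hD _.
have l1 : 1 <= (loglog n)%:R :> R by rewrite ler1n.
have hl := lnlnln_le R l0.
move: (ln (ln (ln n%:R))) hl => x xl.
(* For 1 <= x the power is at most x. For 0 < x < 1 it is at most 1; for x <= 0 it is 0 or 1,
   because [ln x] is then 0. *)
case: (lerP 1 x) => x1.
  by apply: le_trans xl; apply: ler1_powR => //; lra.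
apply: le_trans l1; case: (ltrP 0 x) => x0.
  rewrite -[leRHS](powRr0 x); apply: ger_powR; last by rewrite invr_ge0.
  by rewrite x0 ltW.
rewrite /powR; case: eqP => _; first by rewrite lern1 leq_b1.
by rewrite ln0 // mulr0 expR0.
Unshelve. all: by end_near.
Qed.
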